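(* We have $$\frac{\varphi(e^{-21\pi})}{\varphi(e^{-\pi})} = \left(\frac{m(p)}{7(6\sqrt{3} - 9)^{1/2}}\right)^{1/2},$$ where $$p = \sqrt{2}\,\big(2-\sqrt{3}\big)\sqrt{\sqrt{3} + \sqrt{7}}\,\sqrt{2 + \sqrt{7} + \sqrt{7 + 4\sqrt{7}}}\,\sqrt{\frac{\sqrt{3 + \sqrt{7}} + (6\sqrt{7})^{1/4}}{\sqrt{3 + \sqrt{7}} - (6\sqrt{7})^{1/4}}}$$ and $$m(p) := \left(1 + \frac{5p}{2} + \frac{1}{2}\sqrt{(2 + 5p)^2 - 4(1 - p)^3}\right)^{1/2}.$$
   Context: For $|q|<1$, Ramanujan's theta function is $\varphi(q) := \sum_{n=-\infty}^{\infty} q^{n^2}$. Fractional powers of positive real numbers are the positive real ones. *)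

(* Defs.v *)
From Stdlib Require Import Reals ZArith.
From Coquelicot Require Import Coquelicot.
Open Scope R_scope.

(** Bilateral sum: the nonnegative indices plus the negative ones.
    [Series] is total; the value is meaningful when both halves converge. *)
Definition ZSeries (a : Z -> R) : R :=
  Series (fun n : nat => a (Z.of_nat n)) +
  Series (fun n : nat => a (- Z.of_nat (S n))%Z).

(** Meant for [Rabs q < 1], where both halves converge absolutely. The exponent
    [n * n] is nonnegative, so [Z.to_nat] does not truncate. *)
Definition phi (q : R) : R := ZSeries (fun n : Z => q ^ Z.to_nat (n * n)).

(** [sqrt] and [Rpower] give the positive root on positive arguments only; the
    radicands are positive at the value of [p] of interest (about 7.995). *)
Definition m (p : R) : R :=
  Rpower (1 + 5 * p / 2 + 1 / 2 * sqrt ((2 + 5 * p) ^ 2 - 4 * (1 - p) ^ 3))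
         (1 / 2).

(* Main.v *)
(* The proof needs no modular forms. Put rho(q) = phi(-q)/phi(q), so that
   k' = rho^2 is the complementary modulus and alpha = 1 - rho^4 the classical
   modulus squared.  Rotating Z^2 by 45 degrees gives Landen's transformation:
   rho(q^2)^2 = 2 rho/(1 + rho^2) and phi(q^2)^2 = phi(q)^2 (1 + rho^2)/2.

   A modular equation of degree n = 3, 7 has the form a + b = 1, where a and b are
   roots of alpha(q) alpha(q^n) and rho(q) rho(q^n).  Landen's transformation
   expresses the defect D = 1 - a - b at q^2 through that at q, with
   |D(q^2)| >= c q |D(q)|; since D(q) = O(q^2), iterating q -> q^2 forces D = 0.
   In the same way the multiplier phi(q)^2/phi(q^n)^2 equals an explicit function
   of b, because both change by the same factor under q -> q^2.

   The only transcendental input is phi(e^(-pi/4)) = 2 phi(e^(-4 pi)), that is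
   rho(e^(-pi))^4 = 1/2, which follows from Polya's limit of discrete Poisson
   summation for central binomial coefficients.  Degree 3 then gives alpha at
   e^(-3 pi), and degree 7 shows that the p belonging to (e^(-3 pi), e^(-21 pi))
   is the only root above 7 of an octic with coefficients in Q(sqrt 3), which the
   given radical expression also satisfies. *)

Require Import Defs.
From Stdlib Require Import Reals ZArith Lra Lia List FinFun Classical_Prop Bool.
From Coquelicot Require Import Coquelicot.
Open Scope R_scope.

(** * Unconditional sums and the duplication formulas *)

(** The inverse square of the ratio is the product of the degree 3 multiplier at e^(-pi), which
    equals (6 sqrt 3 - 9)^(1/2), and the degree 7 multiplier M at e^(-3 pi); the value m(p) is 7/M.
    The crux is the lower bound on D(q^2), since a sum could cancel. After Landen's transformation
    D(q^2) is, up to a bounded positive factor, a sum of two differences that vanish with D(q); for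
    a fixed product of the two rho values both have the sign of D(q), so one of them alone bounds
    the sum. Once D = 0 is known, the Landen factor becomes a perfect power of t + z for two square
    roots t and z, and the statements about multipliers turn into polynomial identities in such
    roots. The number p is 1 + (7/M)(2b - 1): with it (7/M)^2 solves a quadratic with coefficients
    in p, and p^3 b(1 - b) depends only on the modulus at e^(-3 pi), which degree 3 supplies.
    Products of theta series are handled as unconditional sums of nonnegative terms; signs enter
    only through phi(q) + phi(-q) = 2 phi(q^4). *)

Definition lsum {T : Type} (f : T -> R) (l : list T) : R :=
  fold_right (fun x s => f x + s) 0 l.

(** For nonnegative [f] this is unordered summation. As a supremum over finite families it is
    independent of any enumeration, so reindexing and products over pairs reduce to statements about
    lists. *)
Definition nnsum {T : Type} (f : T -> R) (s : R) : Prop :=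
  is_lub (fun x => exists l, NoDup l /\ x = lsum f l) s.

Lemma lsum_app {T} (f : T -> R) l1 l2 : lsum f (l1 ++ l2) = lsum f l1 + lsum f l2.
Proof. induction l1 as [|x l IH]; simpl; [ring|rewrite IH; ring]. Qed.

Lemma lsum_ext {T} (f g : T -> R) l : (forall x, f x = g x) -> lsum f l = lsum g l.
Proof. intros H; induction l as [|x l IH]; simpl; [easy|now rewrite IH, H]. Qed.

Lemma lsum_plus {T} (f g : T -> R) l : lsum (fun x => f x + g x) l = lsum f l + lsum g l.
Proof. induction l as [|x l IH]; simpl; [ring|rewrite IH; ring]. Qed.

Lemma lsum_scal {T} (c : R) (f : T -> R) l : lsum (fun x => c * f x) l = c * lsum f l.
Proof. induction l as [|x l IH]; simpl; [ring|rewrite IH; ring]. Qed.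

Lemma lsum_map {T U} (h : T -> U) (f : U -> R) l : lsum f (map h l) = lsum (fun x => f (h x)) l.
Proof. induction l as [|x l IH]; simpl; [easy|now rewrite IH]. Qed.

Lemma lsum_ge0 {T} (f : T -> R) l : (forall x, 0 <= f x) -> 0 <= lsum f l.
Proof. intros H; induction l as [|x l IH]; simpl; [lra|specialize (H x); lra]. Qed.

Lemma lsum_prod {T U} (f : T -> R) (g : U -> R) l1 l2 :
  lsum (fun x => f (fst x) * g (snd x)) (list_prod l1 l2) = lsum f l1 * lsum g l2.
Proof.
  induction l1 as [|x l IH]; simpl; [ring|].
  rewrite lsum_app, IH, lsum_map; simpl.
  rewrite (lsum_scal (f x) g); ring.
Qed.

Lemma lsum_incl {T} (f : T -> R) l1 l2 :
  (forall x, 0 <= f x) -> NoDup l1 ->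
  (forall x, In x l1 -> In x l2 \/ f x = 0) -> lsum f l1 <= lsum f l2.
Proof.
  intros Hf; revert l2; induction l1 as [|x l IH]; simpl; intros l2 Hn Hi.
  - now apply lsum_ge0.
  - inversion_clear Hn as [|? ? Hx Hl].
    destruct (Hi x (or_introl eq_refl)) as [Hx2|Hx0].
    + destruct (in_split _ _ Hx2) as (a & b & ->).
      rewrite lsum_app; simpl.
      assert (lsum f l <= lsum f (a ++ b)).
      { apply IH; [easy|]. intros y Hy.
        destruct (Hi y (or_intror Hy)) as [H|H]; [|now right].
        left. rewrite in_app_iff in *; simpl in H.
        destruct H as [H|[->|H]]; [now left|easy|now right]. }
      rewrite lsum_app in H; lra.
    + rewrite Hx0. assert (lsum f l <= lsum f l2); [|lra].
      apply IH; [easy|]. intros y Hy; apply Hi; now right.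
Qed.

Lemma nnsum_unique {T} (f : T -> R) s t : nnsum f s -> nnsum f t -> s = t.
Proof. apply is_lub_u. Qed.

Lemma nnsum_ext {T} (f g : T -> R) s : (forall x, f x = g x) -> nnsum f s -> nnsum g s.
Proof.
  intros H [Hu Hl]; split.
  - intros x (l & Hn & ->). apply Hu. exists l; split; [easy|]. now apply lsum_ext.
  - intros b Hb; apply Hl. intros x (l & Hn & ->). apply Hb. exists l; split; [easy|].
    now apply lsum_ext.
Qed.

Lemma nnsum_le {T} (f : T -> R) s l : nnsum f s -> NoDup l -> lsum f l <= s.
Proof. intros [Hu _] Hn; apply Hu; now exists l. Qed.

Lemma nnsum_ge0 {T} (f : T -> R) s : nnsum f s -> 0 <= s.
Proof. intros H; apply (nnsum_le f s nil H); constructor. Qed.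

Lemma nnsum_intro {T} (f : T -> R) s :
  (forall l, NoDup l -> lsum f l <= s) ->
  (forall eps, 0 < eps -> exists l, NoDup l /\ s - eps <= lsum f l) -> nnsum f s.
Proof.
  intros H1 H2; split.
  - intros x (l & Hn & ->); now apply H1.
  - intros b Hb. apply Rnot_lt_le; intros Hlt.
    destruct (H2 ((s - b) / 2)) as (l & Hn & Hl); [lra|].
    assert (lsum f l <= b); [|lra]. apply Hb; now exists l.
Qed.

Lemma nnsum_approx {T} (f : T -> R) s eps :
  nnsum f s -> 0 < eps -> exists l, NoDup l /\ s - eps <= lsum f l.
Proof.
  intros [_ Hl] He. apply NNPP; intros Hn.
  assert (s <= s - eps); [|lra].
  apply Hl. intros x (l & Hd & ->). apply Rnot_lt_le; intros Hlt.
  apply Hn; exists l; split; [easy|lra].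
Qed.

Lemma nnsum_dominated {T} (f g : T -> R) s :
  (forall x, 0 <= f x <= g x) -> nnsum g s -> exists t, nnsum f t.
Proof.
  intros H Hs.
  destruct (completeness (fun x => exists l, NoDup l /\ x = lsum f l)) as [t Ht].
  - exists s. intros x (l & Hn & ->).
    apply Rle_trans with (lsum g l); [|now apply nnsum_le].
    clear Hn; induction l as [|y l IH]; simpl; [lra|]. specialize (H y); lra.
  - exists 0, nil; split; [constructor|easy].
  - now exists t.
Qed.

Lemma nodup_dec_In {T} (dec : forall x y : T, {x = y} + {x <> y}) (l1 l2 : list T) :
  exists l, NoDup l /\ (forall x, In x l <-> In x l1 \/ In x l2).
Proof.
  exists (nodup dec (l1 ++ l2)); split; [apply NoDup_nodup|].
  intros x; rewrite nodup_In, in_app_iff; tauto.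
Qed.

Lemma nnsum_plus {T} (dec : forall x y : T, {x = y} + {x <> y}) (f g : T -> R) s t :
  (forall x, 0 <= f x) -> (forall x, 0 <= g x) ->
  nnsum f s -> nnsum g t -> nnsum (fun x => f x + g x) (s + t).
Proof.
  intros Hf Hg Hs Ht; apply nnsum_intro.
  - intros l Hn. rewrite lsum_plus.
    pose proof (nnsum_le _ _ _ Hs Hn); pose proof (nnsum_le _ _ _ Ht Hn); lra.
  - intros eps He.
    destruct (nnsum_approx f s (eps / 2) Hs) as (l1 & N1 & H1); [lra|].
    destruct (nnsum_approx g t (eps / 2) Ht) as (l2 & N2 & H2); [lra|].
    destruct (nodup_dec_In dec l1 l2) as (l & Hn & Hl).
    exists l; split; [easy|]. rewrite lsum_plus.
    assert (lsum f l1 <= lsum f l) by (apply lsum_incl; firstorder).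
    assert (lsum g l2 <= lsum g l) by (apply lsum_incl; firstorder).
    lra.
Qed.

Lemma nodup_list_prod {T U} (l1 : list T) (l2 : list U) :
  NoDup l1 -> NoDup l2 -> NoDup (list_prod l1 l2).
Proof.
  intros H1 H2; induction H1 as [|x l Hx Hl IH]; simpl; [constructor|].
  apply NoDup_app; [|easy|].
  - apply Injective_map_NoDup; [|easy]. intros a b H; now inversion H.
  - intros [a b] Hab Hc. apply in_map_iff in Hab; destruct Hab as (y & Hy & _).
    inversion Hy; subst. apply in_prod_iff in Hc; tauto.
Qed.

Lemma nnsum_prod {T U} (dT : forall x y : T, {x = y} + {x <> y})
  (dU : forall x y : U, {x = y} + {x <> y}) (f : T -> R) (g : U -> R) s t :
  (forall x, 0 <= f x) -> (forall x, 0 <= g x) ->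
  nnsum f s -> nnsum g t -> nnsum (fun x => f (fst x) * g (snd x)) (s * t).
Proof.
  intros Hf Hg Hs Ht.
  pose proof (nnsum_ge0 _ _ Hs) as Hs0; pose proof (nnsum_ge0 _ _ Ht) as Ht0.
  apply nnsum_intro.
  - intros l Hn.
    apply Rle_trans with
      (lsum f (nodup dT (map fst l)) * lsum g (nodup dU (map snd l))).
    + rewrite <- (lsum_prod f g). apply lsum_incl; [|easy|].
      * intros x; now apply Rmult_le_pos.
      * intros [a b] Hab; left. apply in_prod_iff; rewrite !nodup_In.
        split; [apply (in_map fst _ (a, b))|apply (in_map snd _ (a, b))]; easy.
    + apply Rmult_le_compat; try (now apply lsum_ge0);
        apply nnsum_le; auto using NoDup_nodup.
  - intros eps He.
    assert (Hd : 0 < eps / (s + t + 1)) by (apply Rdiv_lt_0_compat; lra).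
    destruct (nnsum_approx f s _ Hs Hd) as (l1 & N1 & H1).
    destruct (nnsum_approx g t _ Ht Hd) as (l2 & N2 & H2).
    exists (list_prod l1 l2); split; [now apply nodup_list_prod|].
    rewrite lsum_prod.
    pose proof (nnsum_le _ _ _ Hs N1); pose proof (nnsum_le _ _ _ Ht N2).
    pose proof (lsum_ge0 f l1 Hf); pose proof (lsum_ge0 g l2 Hg).
    set (d := eps / (s + t + 1)) in *.
    assert (Hde : d * (s + t + 1) = eps) by (unfold d; field; lra).
    assert (s * t - lsum f l1 * lsum g l2 = (s - lsum f l1) * t + lsum f l1 * (t - lsum g l2)) by ring.
    assert ((s - lsum f l1) * t <= d * t) by (apply Rmult_le_compat_r; lra).
    assert (lsum f l1 * (t - lsum g l2) <= s * d) by (apply Rmult_le_compat; lra).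
    lra.
Qed.

(** Entries outside the image of [h] contribute 0 and are dropped; each remaining entry is replaced
    by a preimage. This lets sums be transported along an injection with no inverse function at
    hand. *)
Lemma lsum_preimage {T U} (h : T -> U) (f : T -> R) (g : U -> R) (l : list U) :
  (forall x, f x = g (h x)) -> (forall y, g y = 0 \/ exists x, y = h x) ->
  exists l', lsum f l' = lsum g l /\ (forall x, In x l' -> In (h x) l) /\
  (NoDup l -> NoDup l').
Proof.
  intros Hfg Hz; induction l as [|y l (l' & IH1 & IH2 & IH3)].
  - exists nil; repeat split; [easy|constructor].
  - destruct (Hz y) as [Hy|[x ->]].
    + exists l'; simpl; repeat split.
      * rewrite Hy, IH1; ring.
      * intros x Hx; right; auto.
      * intros Hn; apply IH3; now inversion Hn.
    + exists (x :: l'); simpl; repeat split.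
      * now rewrite IH1, Hfg.
      * intros z [->|Hz']; [now left|right; auto].
      * intros Hn; inversion_clear Hn as [|? ? Ha Hb]; constructor; auto.
Qed.

Lemma nnsum_inj {T U} (h : T -> U) (f : T -> R) (g : U -> R) s :
  (forall x y, h x = h y -> x = y) ->
  (forall x, f x = g (h x)) -> (forall y, g y = 0 \/ exists x, y = h x) ->
  nnsum f s -> nnsum g s.
Proof.
  intros Hi Hfg Hz Hs; apply nnsum_intro.
  - intros l Hn. destruct (lsum_preimage h f g l Hfg Hz) as (l' & <- & _ & Hn').
    apply nnsum_le; auto.
  - intros eps He. destruct (nnsum_approx f s eps Hs He) as (l & Hn & Hl).
    exists (map h l); split; [now apply Injective_map_NoDup|].
    rewrite lsum_map. now rewrite <- (lsum_ext _ _ l Hfg).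
Qed.

(** * Symmetric integer ranges and bilateral series *)

Fixpoint zrange (N : nat) : list Z :=
  match N with
  | O => 0%Z :: nil
  | S n => Z.of_nat (S n) :: (- Z.of_nat (S n))%Z :: zrange n
  end.

Lemma In_zrange N z : In z (zrange N) <-> (Z.abs z <= Z.of_nat N)%Z.
Proof.
  induction N as [|N IH]; [simpl; lia|].
  change (zrange (S N)) with (Z.of_nat (S N) :: (- Z.of_nat (S N))%Z :: zrange N).
  cbn [In]. rewrite IH; lia.
Qed.

Lemma NoDup_zrange N : NoDup (zrange N).
Proof.
  induction N as [|N IH]; [simpl; constructor; [easy|constructor]|].
  change (zrange (S N)) with (Z.of_nat (S N) :: (- Z.of_nat (S N))%Z :: zrange N).
  constructor; [|constructor; [|easy]]; cbn [In]; rewrite In_zrange; lia.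
Qed.

Lemma zrange_cover l : exists N, incl l (zrange N).
Proof.
  induction l as [|z l [N HN]]; [exists O; easy|].
  exists (Nat.max N (Z.to_nat (Z.abs z))). intros y [->|Hy].
  - apply In_zrange; lia.
  - apply HN in Hy. rewrite In_zrange in *; lia.
Qed.

(** The negative half starts at -1, so its partial sum up to [N] and the nonnegative one up to [S N]
    both reach absolute value [N + 1]. *)
Lemma lsum_zrange (a : Z -> R) N :
  lsum a (zrange (S N)) = sum_n (fun n => a (Z.of_nat n)) (S N)
    + sum_n (fun n => a (- Z.of_nat (S n))%Z) N.
Proof.
  induction N as [|N IH].
  - rewrite sum_Sn, !sum_O. unfold plus; simpl. ring.
  - change (zrange (S (S N))) with (Z.of_nat (S (S N)) :: (- Z.of_nat (S (S N)))%Z :: zrange (S N)).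
    cbn [lsum fold_right] in *. fold (lsum a (zrange (S N))). rewrite IH.
    rewrite (sum_Sn _ (S N)), (sum_Sn (fun n => a (- Z.of_nat (S n))%Z) N).
    unfold plus; simpl. ring.
Qed.

Definition ex_zseries (a : Z -> R) : Prop :=
  ex_series (fun n => a (Z.of_nat n)) /\ ex_series (fun n => a (- Z.of_nat (S n))%Z).

Lemma ZSeries_lim (a : Z -> R) :
  ex_zseries a -> is_lim_seq (fun N => lsum a (zrange (S N))) (ZSeries a).
Proof.
  intros [H1 H2].
  apply is_lim_seq_ext with
    (fun N => sum_n (fun n => a (Z.of_nat n)) (S N) + sum_n (fun n => a (- Z.of_nat (S n))%Z) N).
  { intros n; now rewrite lsum_zrange. }
  apply is_lim_seq_plus'.
  - apply -> (is_lim_seq_incr_1 (sum_n (fun n => a (Z.of_nat n)))).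
    now apply Series_correct in H1.
  - now apply Series_correct in H2.
Qed.

Lemma nnsum_ZSeries (a : Z -> R) :
  (forall n, 0 <= a n) -> ex_zseries a -> nnsum a (ZSeries a).
Proof.
  intros Ha He. pose proof (ZSeries_lim a He) as Hlim.
  assert (Hmono : forall n m, (n <= m)%nat -> lsum a (zrange n) <= lsum a (zrange m)).
  { intros n m Hnm. apply lsum_incl; [easy|apply NoDup_zrange|].
    intros x; left. rewrite In_zrange in *; lia. }
  apply nnsum_intro.
  - intros l Hn. destruct (zrange_cover l) as [N HN].
    apply Rle_trans with (lsum a (zrange (S N))).
    + apply lsum_incl; [easy|easy|]. intros x Hx; left. apply HN in Hx.
      rewrite In_zrange in *; lia.
    + apply (is_lim_seq_incr_compare (fun N => lsum a (zrange (S N)))); [easy|].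
      intros n; apply Hmono; lia.
  - intros eps Heps. apply is_lim_seq_spec in Hlim.
    destruct (Hlim (mkposreal eps Heps)) as [N HN].
    exists (zrange (S N)); split; [apply NoDup_zrange|].
    specialize (HN N (Nat.le_refl _)); simpl pos in HN.
    apply Rabs_def2 in HN; lra.
Qed.

Lemma ZSeries_plus (a b : Z -> R) : ex_zseries a -> ex_zseries b ->
  ZSeries (fun n => a n + b n) = ZSeries a + ZSeries b.
Proof.
  intros [H1 H2] [H3 H4]. unfold ZSeries. rewrite !Series_plus by easy. ring.
Qed.

Lemma ex_zseries_plus (a b : Z -> R) : ex_zseries a -> ex_zseries b ->
  ex_zseries (fun n => a n + b n).
Proof. intros [H1 H2] [H3 H4]; split; now apply (ex_series_plus (V := R_NormedModule)). Qed.

(** * The theta series: convergence and behaviour near 0 *)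

Definition gauss (q : R) (n : Z) : R := q ^ Z.to_nat (n * n).

Lemma pow_decr_exponent q n k : 0 <= q <= 1 -> (k <= n)%nat -> q ^ n <= q ^ k.
Proof.
  intros Hq Hk. replace n with (k + (n - k))%nat by lia. rewrite pow_add.
  rewrite <- (Rmult_1_r (q ^ k)) at 2. apply Rmult_le_compat_l; [apply pow_le; lra|].
  rewrite <- (pow1 (n - k)). apply pow_incr; lra.
Qed.

Lemma ex_series_dom_geom (a : nat -> R) q :
  Rabs q < 1 -> (forall n, Rabs (a n) <= Rabs q ^ n) -> ex_series a.
Proof.
  intros Hq Ha. apply (ex_series_le (V := R_CompleteNormedModule)) with (fun n => Rabs q ^ n); [exact Ha|].
  apply ex_series_geom. now rewrite Rabs_Rabsolu.
Qed.

Lemma ex_zseries_gauss q : Rabs q < 1 -> ex_zseries (gauss q).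
Proof.
  intros Hq; pose proof (Rabs_pos q); split; apply ex_series_dom_geom with q; try easy;
    intros n; unfold gauss; rewrite <- RPow_abs; apply pow_decr_exponent; nia || lra.
Qed.

Lemma gauss_ge0 q n : 0 < q -> 0 <= gauss q n.
Proof. intros; apply pow_le; lra. Qed.

Lemma phi_eq q : Rabs q < 1 ->
  phi q = 1 + 2 * Series (fun n => q ^ ((n + 1) * (n + 1))).
Proof.
  intros Hq. destruct (ex_zseries_gauss q Hq) as [H1 _].
  change (phi q) with (ZSeries (gauss q)); unfold ZSeries.
  rewrite (Series_incr_1 _ H1).
  replace (gauss q (Z.of_nat 0)) with 1 by reflexivity.
  rewrite (Series_ext (fun n => gauss q (Z.of_nat (S n))) (fun n => q ^ ((n + 1) * (n + 1)))).
  2:{ intros n; unfold gauss; f_equal; nia. }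
  rewrite (Series_ext (fun n => gauss q (- Z.of_nat (S n))%Z) (fun n => q ^ ((n + 1) * (n + 1)))).
  2:{ intros n; unfold gauss; f_equal; nia. }
  ring.
Qed.

(** Since (n + 2)^2 >= n + 4, the tail is at most q^4 times a geometric series, whose sum is at most
    3/2. Negative [q] is allowed because [rho] needs the expansion at both signs. *)
Lemma phi_approx q : Rabs q <= 1 / 8 -> Rabs (phi q - (1 + 2 * q)) <= 3 * q ^ 4.
Proof.
  intros Hq. pose proof (Rabs_pos q).
  assert (Hex : forall k, ex_series (fun n => q ^ ((n + k) * (n + k)))).
  { intros k; apply ex_series_dom_geom with q; [lra|].
    intros n; rewrite <- RPow_abs; apply pow_decr_exponent; nia || lra. }
  rewrite phi_eq by lra. rewrite (Series_incr_1 _ (Hex 1%nat)).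
  rewrite (Series_ext _ (fun n => q ^ ((n + 2) * (n + 2)))).
  2:{ intros n; f_equal; nia. }
  simpl (q ^ ((0 + 1) * (0 + 1))).
  assert (Hb : Rabs (Series (fun n => q ^ ((n + 2) * (n + 2)))) <= q ^ 4 * / (1 - Rabs q)).
  { rewrite <- Series_geom by (rewrite Rabs_Rabsolu; lra).
    rewrite <- Series_scal_l.
    assert (Hg : ex_series (fun n => q ^ 4 * Rabs q ^ n)).
    { apply (ex_series_scal (V := R_NormedModule) (q ^ 4)). apply ex_series_geom. rewrite Rabs_Rabsolu; lra. }
    assert (Hle : forall n, 0 <= Rabs (q ^ ((n + 2) * (n + 2))) <= q ^ 4 * Rabs q ^ n).
    { intros n; split; [apply Rabs_pos|].
      replace (q ^ 4) with (Rabs q ^ 4).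
      2:{ rewrite RPow_abs. apply Rabs_pos_eq. replace (q ^ 4) with ((q * q) ^ 2) by ring. apply pow2_ge_0. }
      rewrite <- pow_add, <- RPow_abs. apply pow_decr_exponent; nia || lra. }
    apply Rle_trans with (Series (fun n => Rabs (q ^ ((n + 2) * (n + 2))))).
    - apply Series_Rabs. apply ex_series_dom_geom with q; [lra|].
      intros n. rewrite Rabs_Rabsolu, <- RPow_abs; apply pow_decr_exponent; nia || lra.
    - now apply Series_le. }
  replace (1 + 2 * (q * 1 + Series (fun n => q ^ ((n + 2) * (n + 2)))) - (1 + 2 * q))
    with (2 * Series (fun n => q ^ ((n + 2) * (n + 2)))) by ring.
  rewrite Rabs_mult, (Rabs_pos_eq 2) by lra.
  assert (0 <= q ^ 4). { replace (q ^ 4) with ((q * q) ^ 2) by ring. apply pow2_ge_0. }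
  assert (/ (1 - Rabs q) <= 3 / 2).
  { replace (3 / 2) with (/ (2 / 3)) by field. apply Rinv_le_contravar; lra. }
  nra.
Qed.

Lemma nnsum_phi q : 0 < q < 1 -> nnsum (gauss q) (phi q).
Proof.
  intros Hq. apply nnsum_ZSeries; [intros; apply gauss_ge0; lra|].
  apply ex_zseries_gauss. rewrite Rabs_pos_eq; lra.
Qed.

(** * Even and odd halves of the theta series *)

Definition evenpart (q : R) (n : Z) : R := if Z.even n then gauss q n else 0.
Definition oddpart (q : R) (n : Z) : R := if Z.even n then 0 else gauss q n.

Lemma evenpart_ge0 q n : 0 < q -> 0 <= evenpart q n.
Proof. intros; unfold evenpart; destruct (Z.even n); [now apply gauss_ge0|lra]. Qed.

Lemma oddpart_ge0 q n : 0 < q -> 0 <= oddpart q n.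
Proof. intros; unfold oddpart; destruct (Z.even n); [lra|now apply gauss_ge0]. Qed.

Lemma nnsum_even q : 0 < q < 1 -> nnsum (evenpart q) (phi (q ^ 4)).
Proof.
  intros Hq. apply nnsum_inj with (h := fun n => (2 * n)%Z) (f := gauss (q ^ 4)).
  - intros; lia.
  - intros n. unfold evenpart. rewrite Z.even_mul; simpl orb; cbv iota.
    unfold gauss. rewrite <- pow_mult. f_equal. nia.
  - intros n. unfold evenpart. destruct (Z.even n) eqn:E; [right|now left].
    apply Z.even_spec in E; exact E.
  - apply nnsum_phi. split; [apply pow_lt; lra|]. apply pow_lt_1_compat; [lra|lia].
Qed.

Lemma gauss_opp q n : gauss (- q) n = if Z.even n then gauss q n else - gauss q n.
Proof.
  unfold gauss.
  assert (H : forall x k, (- x) ^ k = if Nat.even k then x ^ k else - x ^ k).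
  { intros x k; induction k as [|k IH]; [reflexivity|].
    rewrite Nat.even_succ, <- Nat.negb_even. simpl; rewrite IH.
    destruct (Nat.even k); simpl; ring. }
  rewrite H.
  replace (Nat.even (Z.to_nat (n * n))) with (Z.even n); [easy|].
  destruct (Z.even n) eqn:E; symmetry.
  - apply Z.even_spec in E; destruct E as [m ->].
    apply Nat.even_spec. exists (Z.to_nat (2 * m * m)). nia.
  - apply not_true_is_false; intros F. apply Nat.even_spec in F; destruct F as [m Hm].
    assert (Z.even (n * n) = true).
    { apply Z.even_spec. exists (Z.of_nat m). nia. }
    rewrite Z.even_mul, E in H0; discriminate.
Qed.

(** The terms of phi(-q) have both signs, so [nnsum] does not apply to it; adding phi(q) cancels the
    odd terms and leaves a nonnegative family. *)
Lemma phi_plus_opp q : 0 < q < 1 -> phi q + phi (- q) = 2 * phi (q ^ 4).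
Proof.
  intros Hq.
  assert (H1 : ex_zseries (gauss q)) by (apply ex_zseries_gauss; rewrite Rabs_pos_eq; lra).
  assert (H2 : ex_zseries (gauss (- q))).
  { apply ex_zseries_gauss; rewrite Rabs_Ropp, Rabs_pos_eq; lra. }
  assert (He : forall n, gauss q n + gauss (- q) n = evenpart q n + evenpart q n).
  { intros n; rewrite gauss_opp; unfold evenpart; destruct (Z.even n); ring. }
  assert (Hp : forall n, 0 <= evenpart q n) by (intros; apply evenpart_ge0; lra).
  apply (nnsum_unique (fun n => evenpart q n + evenpart q n)).
  - apply nnsum_ext with (fun n => gauss q n + gauss (- q) n); [exact He|].
    replace (phi q + phi (- q)) with (ZSeries (fun n => gauss q n + gauss (- q) n))
      by (rewrite ZSeries_plus by easy; reflexivity).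
    apply nnsum_ZSeries; [|now apply ex_zseries_plus].
    intros n; rewrite He; specialize (Hp n); lra.
  - replace (2 * phi (q ^ 4)) with (phi (q ^ 4) + phi (q ^ 4)) by ring.
    apply nnsum_plus; try easy; [apply Z.eq_dec| |]; now apply nnsum_even.
Qed.

Lemma nnsum_odd q : 0 < q < 1 -> nnsum (oddpart q) (phi q - phi (q ^ 4)).
Proof.
  intros Hq.
  assert (He : forall n, evenpart q n + oddpart q n = gauss q n).
  { intros n; unfold evenpart, oddpart; destruct (Z.even n); ring. }
  assert (Hp : forall n, 0 <= evenpart q n) by (intros; apply evenpart_ge0; lra).
  assert (Ho : forall n, 0 <= oddpart q n) by (intros; apply oddpart_ge0; lra).
  (* Domination only yields that some sum exists; its value then follows by subtracting the even
     half from the whole. *)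
  destruct (nnsum_dominated (oddpart q) (gauss q) (phi q)) as [s Hs].
  - intros n; rewrite <- He; specialize (Hp n); specialize (Ho n); lra.
  - now apply nnsum_phi.
  - replace (phi q - phi (q ^ 4)) with s; [easy|].
    assert (phi (q ^ 4) + s = phi q); [|lra].
    apply (nnsum_unique (gauss q)); [|now apply nnsum_phi].
    apply nnsum_ext with (fun n => evenpart q n + oddpart q n); [exact He|].
    apply nnsum_plus; try easy; [apply Z.eq_dec|now apply nnsum_even].
Qed.

(** * Rotating the square lattice *)

Definition pair_dec (x y : Z * Z) : {x = y} + {x <> y}.
Proof. decide equality; apply Z.eq_dec. Defined.

(* The rotation (i,j) -> (i+j,i-j) doubles i^2+j^2, and its image consists of
   the pairs of equal parity. *)
Lemma nnsum_rotate (q s : R) (par : bool) :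
  0 < q < 1 ->
  nnsum (fun x => if Bool.eqb (Z.even (fst x + snd x)) par
                  then gauss (q ^ 2) (fst x) * gauss (q ^ 2) (snd x) else 0) s ->
  nnsum (fun x => if Bool.eqb (Z.even (fst x)) par && Bool.eqb (Z.even (snd x)) par
                  then gauss q (fst x) * gauss q (snd x) else 0) s.
Proof.
  intros Hq. apply nnsum_inj with (h := fun x => (fst x + snd x, fst x - snd x)%Z).
  - intros [a b] [c d] H; simpl in H; inversion H. f_equal; lia.
  - intros [i j]; cbn [fst snd].
    rewrite Z.even_sub, Z.even_add.
    destruct (Bool.eqb (Bool.eqb (Z.even i) (Z.even j)) par) eqn:E; cbn [andb]; [|easy].
    unfold gauss. rewrite <- !pow_mult, <- !pow_add. f_equal.
    apply Nat2Z.inj. rewrite !Nat2Z.inj_add, !Nat2Z.inj_mul, (Z2Nat.id (i * i)), (Z2Nat.id (j * j)),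
      (Z2Nat.id ((i + j) * (i + j))), (Z2Nat.id ((i - j) * (i - j))) by apply Z.square_nonneg.
    change (Z.of_nat 2) with 2%Z; ring.
  - intros [a b]; simpl.
    destruct (Bool.eqb (Z.even a) par) eqn:Ea; [|now left].
    destruct (Bool.eqb (Z.even b) par) eqn:Eb; [|now left].
    right. apply Bool.eqb_prop in Ea, Eb.
    assert (Z.Even (a + b)).
    { apply Z.even_spec. rewrite Z.even_add, Ea, Eb. now destruct par. }
    destruct H as [k Hk]. exists (k, a - k)%Z; simpl. f_equal; lia.
Qed.

(** Pairs of even integers come, under the rotation, from pairs with even sum, which are both even
    or both odd; these two cases give the two squares. *)
Lemma phi_even_sq q : 0 < q < 1 ->
  phi (q ^ 4) ^ 2 = phi (q ^ 8) ^ 2 + (phi (q ^ 2) - phi (q ^ 8)) ^ 2.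
Proof.
  intros Hq.
  assert (Hq2 : 0 < q ^ 2 < 1) by (split; [apply pow_lt; lra|apply pow_lt_1_compat; [lra|lia]]).
  assert (Ep : forall n, 0 <= evenpart q n) by (intros; apply evenpart_ge0; lra).
  assert (E2 : forall n, 0 <= evenpart (q ^ 2) n) by (intros; apply evenpart_ge0; lra).
  assert (O2 : forall n, 0 <= oddpart (q ^ 2) n) by (intros; apply oddpart_ge0; lra).
  pose proof (nnsum_even _ Hq2) as He; pose proof (nnsum_odd _ Hq2) as Ho.
  rewrite <- pow_mult in He, Ho; simpl Nat.mul in He, Ho.
  apply (nnsum_unique (fun x => evenpart q (fst x) * evenpart q (snd x))).
  - replace (phi (q ^ 4) ^ 2) with (phi (q ^ 4) * phi (q ^ 4)) by ring.
    apply nnsum_prod; try easy; try apply Z.eq_dec; now apply nnsum_even.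
  - eapply nnsum_ext; [|apply (nnsum_rotate q _ true Hq)].
    + intros [a b]; simpl; unfold evenpart.
      destruct (Z.even a), (Z.even b); simpl; ring.
    + apply nnsum_ext with (fun x => evenpart (q ^ 2) (fst x) * evenpart (q ^ 2) (snd x)
         + oddpart (q ^ 2) (fst x) * oddpart (q ^ 2) (snd x)).
      * intros [a b]; cbn [fst snd]. unfold evenpart, oddpart.
        rewrite Z.even_add. destruct (Z.even a), (Z.even b); simpl; ring.
      * replace (phi (q ^ 8) ^ 2 + (phi (q ^ 2) - phi (q ^ 8)) ^ 2)
          with (phi (q ^ 8) * phi (q ^ 8)
                + (phi (q ^ 2) - phi (q ^ 8)) * (phi (q ^ 2) - phi (q ^ 8))) by ring.
        apply nnsum_plus; [apply pair_dec| | | |].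
        1,2: intros [a b]; now apply Rmult_le_pos.
        1,2: apply nnsum_prod; try easy; apply Z.eq_dec.
Qed.

(** Pairs of odd integers come from pairs with odd sum, so exactly one entry is even; the two
    positions for it give the factor 2. *)
Lemma phi_odd_sq q : 0 < q < 1 ->
  (phi q - phi (q ^ 4)) ^ 2 = 2 * phi (q ^ 8) * (phi (q ^ 2) - phi (q ^ 8)).
Proof.
  intros Hq.
  assert (Hq2 : 0 < q ^ 2 < 1) by (split; [apply pow_lt; lra|apply pow_lt_1_compat; [lra|lia]]).
  assert (Ep : forall n, 0 <= oddpart q n) by (intros; apply oddpart_ge0; lra).
  assert (E2 : forall n, 0 <= evenpart (q ^ 2) n) by (intros; apply evenpart_ge0; lra).
  assert (O2 : forall n, 0 <= oddpart (q ^ 2) n) by (intros; apply oddpart_ge0; lra).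
  pose proof (nnsum_even _ Hq2) as He; pose proof (nnsum_odd _ Hq2) as Ho.
  rewrite <- pow_mult in He, Ho; simpl Nat.mul in He, Ho.
  apply (nnsum_unique (fun x => oddpart q (fst x) * oddpart q (snd x))).
  - replace ((phi q - phi (q ^ 4)) ^ 2)
      with ((phi q - phi (q ^ 4)) * (phi q - phi (q ^ 4))) by ring.
    apply nnsum_prod; try easy; try apply Z.eq_dec; now apply nnsum_odd.
  - eapply nnsum_ext; [|apply (nnsum_rotate q _ false Hq)].
    + intros [a b]; simpl; unfold oddpart.
      destruct (Z.even a), (Z.even b); simpl; ring.
    + apply nnsum_ext with (fun x => evenpart (q ^ 2) (fst x) * oddpart (q ^ 2) (snd x)
         + oddpart (q ^ 2) (fst x) * evenpart (q ^ 2) (snd x)).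
      * intros [a b]; cbn [fst snd]. unfold evenpart, oddpart.
        rewrite Z.even_add. destruct (Z.even a), (Z.even b); simpl; ring.
      * replace (2 * phi (q ^ 8) * (phi (q ^ 2) - phi (q ^ 8)))
          with (phi (q ^ 8) * (phi (q ^ 2) - phi (q ^ 8))
                + (phi (q ^ 2) - phi (q ^ 8)) * phi (q ^ 8)) by ring.
        apply nnsum_plus; [apply pair_dec| | | |].
        1,2: intros [a b]; now apply Rmult_le_pos.
        1,2: apply nnsum_prod; try easy; apply Z.eq_dec.
Qed.

Lemma phi_opp q : 0 < q < 1 -> phi (- q) = 2 * phi (q ^ 4) - phi q.
Proof. intros Hq; pose proof (phi_plus_opp q Hq); lra. Qed.

(** Let e, o be the even and odd halves of phi(q), and E, O those of phi(q^2). Then phi(-q) = e - o,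
    e^2 = E^2 + O^2 and o^2 = 2 E O, so e^2 + o^2 = (E + O)^2; likewise e^2 - o^2 = (E - O)^2 gives
    [phi_mult_opp]. *)
Lemma phi_sq_plus q : 0 < q < 1 -> phi q ^ 2 + phi (- q) ^ 2 = 2 * phi (q ^ 2) ^ 2.
Proof.
  intros Hq. rewrite phi_opp by easy.
  pose proof (phi_even_sq q Hq); pose proof (phi_odd_sq q Hq); nra.
Qed.

Lemma phi_mult_opp q : 0 < q < 1 -> phi q * phi (- q) = phi (- q ^ 2) ^ 2.
Proof.
  intros Hq. assert (Hq2 : 0 < q ^ 2 < 1) by (split; [apply pow_lt; lra|apply pow_lt_1_compat; [lra|lia]]).
  rewrite (phi_opp q), (phi_opp (q ^ 2)) by easy.
  rewrite <- pow_mult; simpl Nat.mul.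
  pose proof (phi_even_sq q Hq); pose proof (phi_odd_sq q Hq); nra.
Qed.

(** * The function rho *)

Lemma pow_unit_interval q n : 0 < q < 1 -> (0 < n)%nat -> 0 < q ^ n < 1.
Proof. intros Hq Hn; split; [apply pow_lt; lra|apply pow_lt_1_compat; [lra|lia]]. Qed.

(** Repeated squaring takes every q below [e] in finitely many steps, and the property is pulled
    back along them. The induction is on an exponent n with q^(n+1) <= e, which is roughly halved
    when q becomes q^2. *)
Lemma dyadic_ind (e : R) (P : R -> Prop) : 0 < e ->
  (forall q, 0 < q < 1 -> q <= e -> P q) ->
  (forall q, 0 < q < 1 -> P (q ^ 2) -> P q) -> forall q, 0 < q < 1 -> P q.
Proof.
  intros He Hs Hstep.
  assert (H : forall n q, 0 < q < 1 -> q ^ (S n) <= e -> P q).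
  { induction n as [n IH] using (well_founded_induction lt_wf).
    intros q Hq Hn. destruct n as [|n]; [apply Hs; [easy|simpl in Hn; lra]|].
    apply Hstep; [easy|]. apply (IH (Nat.div2 (S n))); [apply Nat.lt_div2; lia| |].
    - apply pow_unit_interval; [easy|lia].
    - rewrite <- pow_mult. apply Rle_trans with (q ^ S (S n)); [|easy].
      apply pow_decr_exponent; [lra|]. pose proof (Nat.div2_odd (S n)).
      destruct (Nat.odd (S n)); simpl Nat.b2n in *; lia. }
  intros q Hq. destruct (pow_lt_1_zero q) with (y := e) as [N HN]; [rewrite Rabs_pos_eq; lra|easy|].
  apply (H N); [easy|]. specialize (HN (S N) ltac:(lia)).
  rewrite Rabs_pos_eq in HN; [lra|]. apply pow_le; lra.
Qed.

(* With g(q) = |D(q)| / q^(j+1) the hypotheses give g(q) <= g(q^2) q / c, so g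
   halves at each squaring while staying bounded. *)
Lemma rigidity (D : R -> R) (j : nat) (c K e : R) : 0 < c -> 0 < e ->
  (forall q, 0 < q < 1 -> q <= e -> Rabs (D q) <= K * q ^ (S j)) ->
  (forall q, 0 < q < 1 -> q <= e -> c * q ^ j * Rabs (D q) <= Rabs (D (q ^ 2))) ->
  (forall q, 0 < q < 1 -> D (q ^ 2) = 0 -> D q = 0) ->
  forall q, 0 < q < 1 -> D q = 0.
Proof.
  intros Hc He Hb Hs Hz.
  assert (K0 : 0 <= K).
  { set (x := Rmin e (1 / 2)). assert (0 < x <= e /\ x < 1) as [? ?].
    { unfold x; pose proof (Rmin_l e (1/2)); pose proof (Rmin_r e (1/2)).
      assert (0 < Rmin e (1/2)) by (apply Rmin_pos; lra). lra. }
    specialize (Hb x ltac:(lra) ltac:(lra)). pose proof (Rabs_pos (D x)).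
    assert (0 < x ^ S j) by (apply pow_lt; lra). nra. }
  apply dyadic_ind with (e := Rmin e (c / 2)); [apply Rmin_pos; lra| |exact Hz].
  assert (H : forall n q, 0 < q < 1 -> q <= Rmin e (c / 2) -> Rabs (D q) <= K * (1 / 2) ^ n * q ^ S j).
  { induction n as [|n IH]; intros q Hq Hqe;
      pose proof (Rmin_l e (c/2)); pose proof (Rmin_r e (c/2)).
    - simpl pow at 1. rewrite Rmult_1_r. apply Hb; lra.
    - assert (Hq2 : 0 < q ^ 2 < 1) by (apply pow_unit_interval; [easy|lia]).
      assert (Hj : 0 < q ^ j) by (apply pow_lt; lra).
      assert (q ^ 2 <= q) by nra.
      specialize (IH (q ^ 2) Hq2 ltac:(lra)). specialize (Hs q Hq ltac:(lra)).
      apply Rmult_le_reg_l with (c * q ^ j); [now apply Rmult_lt_0_compat|].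
      apply Rle_trans with (1 := Hs). apply Rle_trans with (1 := IH).
      rewrite <- pow_mult. replace (2 * S j)%nat with (S j + (j + 1))%nat by lia.
      rewrite pow_add, (pow_add q j 1). simpl (q ^ 1). rewrite Rmult_1_r.
      replace (c * q ^ j * (K * (1 / 2) ^ S n * q ^ S j))
        with (K * (1 / 2) ^ n * (q ^ S j * (q ^ j * (c / 2)))) by (simpl; field).
      apply Rmult_le_compat_l; [apply Rmult_le_pos; [easy|apply pow_le; lra]|].
      apply Rmult_le_compat_l; [apply pow_le; lra|].
      apply Rmult_le_compat_l; lra. }
  intros q Hq Hqe.
  assert (Hl : Rabs (D q) <= 0).
  { change (Rbar_le (Rabs (D q)) 0).
    apply (is_lim_seq_le (fun _ => Rabs (D q)) (fun n => (K * q ^ S j) * (1 / 2) ^ n)).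
    - intros n. specialize (H n q Hq Hqe). lra.
    - apply is_lim_seq_const.
    - replace (Finite 0) with (Rbar_mult (K * q ^ S j) 0) by (simpl; f_equal; ring).
      apply is_lim_seq_scal_l. apply is_lim_seq_geom. rewrite Rabs_pos_eq; lra. }
  pose proof (Rabs_pos (D q)). apply Rabs_eq_0; lra.
Qed.

Definition rho (q : R) : R := phi (- q) / phi q.

Lemma phi_ge_1 q : 0 < q < 1 -> 1 <= phi q.
Proof.
  intros Hq. apply Rle_trans with (lsum (gauss q) (0%Z :: nil)).
  - unfold lsum, gauss; simpl; lra.
  - apply nnsum_le; [now apply nnsum_phi|]. constructor; [easy|constructor].
Qed.

Lemma phi_opp_lt q : 0 < q < 1 -> phi (- q) < phi q.
Proof.
  intros Hq. rewrite phi_opp by easy.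
  assert (q <= phi q - phi (q ^ 4)); [|lra].
  apply Rle_trans with (lsum (oddpart q) (1%Z :: nil)).
  - unfold lsum, oddpart, gauss; simpl; lra.
  - apply nnsum_le; [now apply nnsum_odd|]. constructor; [easy|constructor].
Qed.

(** The alternating signs defeat a termwise bound, but phi(q) phi(-q) = phi(-q^2)^2 carries
    positivity from q^2 back to q, and near 0 the expansion decides. *)
Lemma phi_opp_pos q : 0 < q < 1 -> 0 < phi (- q).
Proof.
  revert q; apply dyadic_ind with (e := 1 / 8); [lra| |].
  - intros q Hq He. pose proof (phi_approx (- q)) as H.
    rewrite Rabs_Ropp, Rabs_pos_eq in H by lra. specialize (H He).
    apply Rabs_le_between in H. replace ((- q) ^ 4) with (q ^ 4) in H by ring.
    assert (q ^ 4 <= q * 1 ^ 3).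
    { replace (q ^ 4) with (q * q ^ 3) by ring. apply Rmult_le_compat_l; [lra|].
      apply pow_incr; lra. }
    lra.
  - intros q Hq H. pose proof (phi_mult_opp q Hq) as E.
    pose proof (phi_ge_1 q Hq). assert (0 < phi (- q ^ 2) ^ 2) by (apply pow_lt; lra).
    rewrite <- E in H1. apply Rmult_lt_reg_l with (phi q); lra.
Qed.

Lemma rho_bounds q : 0 < q < 1 -> 0 < rho q < 1.
Proof.
  intros Hq. pose proof (phi_ge_1 q Hq); pose proof (phi_opp_pos q Hq);
  pose proof (phi_opp_lt q Hq). unfold rho; split.
  - apply Rdiv_lt_0_compat; lra.
  - apply Rmult_lt_reg_r with (phi q); [lra|]. field_simplify; lra.
Qed.

Lemma rho_sq q : 0 < q < 1 -> rho (q ^ 2) ^ 2 = 2 * rho q / (1 + rho q ^ 2).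
Proof.
  intros Hq. assert (Hq2 : 0 < q ^ 2 < 1) by (apply pow_unit_interval; [easy|lia]).
  pose proof (phi_ge_1 q Hq); pose proof (phi_ge_1 _ Hq2).
  pose proof (phi_mult_opp q Hq) as E1; pose proof (phi_sq_plus q Hq) as E2.
  unfold rho at 1. unfold Rdiv at 1. rewrite Rpow_mult_distr, <- E1, pow_inv.
  replace (phi (q ^ 2) ^ 2) with ((phi q ^ 2 + phi (- q) ^ 2) / 2) by lra.
  unfold rho; field. repeat split; try lra; nra.
Qed.

Lemma phi_sq_landen q : 0 < q < 1 -> phi (q ^ 2) ^ 2 = phi q ^ 2 * (1 + rho q ^ 2) / 2.
Proof.
  intros Hq. pose proof (phi_ge_1 q Hq); pose proof (phi_sq_plus q Hq) as E2.
  unfold rho. replace (phi (q ^ 2) ^ 2) with ((phi q ^ 2 + phi (- q) ^ 2) / 2) by lra.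
  field; lra.
Qed.

(** The quotient (1 - 2q)/(1 + 2q) has second coefficient 8; the ninth unit absorbs the q^4 errors
    of numerator and denominator. *)
Lemma rho_approx q : 0 < q <= 1 / 16 -> Rabs (rho q - (1 - 4 * q)) <= 9 * q ^ 2.
Proof.
  intros Hq. pose proof (phi_ge_1 q ltac:(lra)).
  pose proof (phi_approx q) as H1; pose proof (phi_approx (- q)) as H2.
  rewrite Rabs_Ropp, Rabs_pos_eq in H2 by lra; rewrite Rabs_pos_eq in H1 by lra.
  specialize (H1 ltac:(lra)); specialize (H2 ltac:(lra)).
  apply Rabs_le_between in H1, H2. replace ((- q) ^ 4) with (q ^ 4) in H2 by ring.
  set (e1 := phi q - (1 + 2 * q)) in *; set (e2 := phi (- q) - (1 + 2 * - q)) in *.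
  assert (Hn : rho q - (1 - 4 * q) = (8 * q ^ 2 + e2 - (1 - 4 * q) * e1) / phi q).
  { unfold rho, e1, e2. field; lra. }
  assert (0 <= q ^ 2 <= 1 / 256) by (split; nra).
  assert (q ^ 4 <= q ^ 2 * (1 / 256)) by (replace (q ^ 4) with (q ^ 2 * q ^ 2) by ring; nra).
  rewrite Hn. unfold Rdiv. rewrite Rabs_mult, (Rabs_pos_eq (/ phi q)).
  2:{ left; apply Rinv_0_lt_compat; lra. }
  assert (/ phi q <= 1). { rewrite <- Rinv_1. apply Rinv_le_contravar; lra. }
  assert (0 < / phi q) by (apply Rinv_0_lt_compat; lra).
  assert (Rabs (8 * q ^ 2 + e2 - (1 - 4 * q) * e1) <= 9 * q ^ 2).
  { apply Rabs_le. assert (-(3 * q ^ 4) <= (1 - 4 * q) * e1 <= 3 * q ^ 4) by (split; nra). nra. }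
  pose proof (Rabs_pos (8 * q ^ 2 + e2 - (1 - 4 * q) * e1)). nra.
Qed.

(** Near 0 the expansion decides; elsewhere the order at q^2 descends to q because u -> 2u/(1 + u^2)
    increases on (0,1). The order later settles which root of a quadratic belongs to q and which to
    q^n. *)
Lemma rho_lt_pow n q : (2 <= n)%nat -> 0 < q < 1 -> rho q < rho (q ^ n).
Proof.
  intros Hn; revert q; apply dyadic_ind with (e := 1 / 16); [lra| |].
  - intros q Hq He.
    assert (Hqn : 0 < q ^ n < 1) by (apply pow_unit_interval; [easy|lia]).
    assert (Hle : q ^ n <= q ^ 2) by (apply pow_decr_exponent; [lra|easy]).
    assert (q ^ 2 <= q / 16) by nra.
    pose proof (rho_approx q ltac:(lra)) as H1. pose proof (rho_approx (q ^ n) ltac:(lra)) as H2.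
    apply Rabs_le_between in H1, H2.
    assert ((q ^ n) ^ 2 <= q ^ n * (1 / 16)) by nra. lra.
  - intros q Hq H.
    assert (Hqn : 0 < q ^ n < 1) by (apply pow_unit_interval; [easy|lia]).
    assert (Hq2 : 0 < q ^ 2 < 1) by (apply pow_unit_interval; [easy|lia]).
    assert (Hq2n : 0 < (q ^ 2) ^ n < 1) by (apply pow_unit_interval; [easy|lia]).
    pose proof (rho_bounds _ Hq) as B1; pose proof (rho_bounds _ Hqn) as B2.
    pose proof (rho_bounds _ Hq2) as B3; pose proof (rho_bounds _ Hq2n) as B4.
    assert (Hs : rho (q ^ 2) ^ 2 < rho ((q ^ 2) ^ n) ^ 2) by nra.
    replace ((q ^ 2) ^ n) with ((q ^ n) ^ 2) in Hs by (rewrite <- !pow_mult; f_equal; lia).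
    rewrite !rho_sq in Hs by easy.
    set (u := rho q) in *; set (v := rho (q ^ n)) in *.
    apply Rnot_le_lt; intros Hc.
    assert (2 * v / (1 + v ^ 2) <= 2 * u / (1 + u ^ 2)); [|lra].
    apply Rmult_le_reg_r with ((1 + v ^ 2) * (1 + u ^ 2)); [nra|].
    replace (2 * v / (1 + v ^ 2) * ((1 + v ^ 2) * (1 + u ^ 2))) with (2 * v * (1 + u ^ 2)) by (field; nra).
    replace (2 * u / (1 + u ^ 2) * ((1 + v ^ 2) * (1 + u ^ 2))) with (2 * u * (1 + v ^ 2)) by (field; nra).
    assert (0 <= (u - v) * (1 - u * v)) by (apply Rmult_le_pos; nra). nra.
Qed.

(** * Modular equations of degrees 3 and 7 *)

Lemma pow_inj_pos n x y : 0 <= x -> 0 <= y -> x ^ S n = y ^ S n -> x = y.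
Proof.
  assert (H : forall a b, 0 <= a -> a < b -> a ^ S n < b ^ S n).
  { intros a b Ha Hab. simpl. apply Rle_lt_trans with (a * b ^ n).
    - apply Rmult_le_compat_l; [easy|]. apply pow_incr; lra.
    - apply Rmult_lt_compat_r; [apply pow_lt; lra|easy]. }
  intros Hx Hy E. destruct (Rtotal_order x y) as [L|[L|L]]; [|easy|].
  - pose proof (H x y Hx L); lra.
  - pose proof (H y x Hy L); lra.
Qed.

Lemma le_of_sq x y : 0 <= y -> x ^ 2 <= y ^ 2 -> x <= y.
Proof. intros; apply Rnot_lt_le; intros H1; nra. Qed.

(** Taking a root moves a number towards 1, so relative error bounds for the products of [alpha]
    pass to their fourth and eighth roots without loss. *)
Lemma root_dist n v : 0 <= v -> Rabs (v - 1) <= Rabs (v ^ S n - 1).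
Proof.
  intros Hv. destruct (Rle_dec 1 v) as [H|H].
  - assert (v <= v ^ S n).
    { simpl. rewrite <- (Rmult_1_r v) at 1. apply Rmult_le_compat_l; [lra|]. now apply pow_R1_Rle. }
    rewrite !Rabs_pos_eq; lra.
  - assert (v ^ S n <= v).
    { simpl. rewrite <- (Rmult_1_r v) at 3. apply Rmult_le_compat_l; [lra|].
      rewrite <- (pow1 n). apply pow_incr; lra. }
    rewrite !Rabs_left1; lra.
Qed.

Definition alpha (q : R) : R := 1 - rho q ^ 4.

Lemma alpha_bounds q : 0 < q < 1 -> 0 < alpha q < 1.
Proof.
  intros Hq; pose proof (rho_bounds q Hq); unfold alpha.
  pose proof (pow_unit_interval (rho q) 4 H ltac:(lia)); lra.
Qed.

Lemma alpha_approx q : 0 < q <= 1 / 100 -> Rabs (alpha q / (16 * q) - 1) <= 10 * q.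
Proof.
  intros Hq. pose proof (rho_approx q ltac:(lra)) as H. apply Rabs_le_between in H.
  assert (He : alpha q / (16 * q) - 1 = (alpha q - 16 * q) / (16 * q)) by (field; lra).
  set (d := 1 - rho q).
  assert (Hd : 39 / 10 * q <= d <= 41 / 10 * q) by (unfold d; nra).
  assert (Ha : alpha q = 4 * d - 6 * d ^ 2 + 4 * d ^ 3 - d ^ 4).
  { unfold alpha, d; ring. }
  assert (D2 : 0 <= d ^ 2 <= 17 * q ^ 2) by (split; nra).
  assert (D3 : 0 <= d ^ 3 <= q ^ 2) by (replace (d ^ 3) with (d * d ^ 2) by ring; split; nra).
  assert (D4 : 0 <= d ^ 4 <= q ^ 2) by (replace (d ^ 4) with (d * d ^ 3) by ring; split; nra).
  assert (Hn : Rabs (alpha q - 16 * q) <= 160 * q ^ 2).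
  { apply Rabs_le. unfold d in Hd. fold d in Hd. rewrite Ha.
    assert (-(9 * q ^ 2) <= d - 4 * q <= 9 * q ^ 2) by (unfold d; lra). lra. }
  rewrite He. unfold Rdiv. rewrite Rabs_mult, (Rabs_pos_eq (/ (16 * q))).
  2:{ left; apply Rinv_0_lt_compat; lra. }
  apply Rmult_le_reg_r with (16 * q); [lra|].
  rewrite Rmult_assoc, Rinv_l by lra. lra.
Qed.

Lemma alpha_sq q : 0 < q < 1 -> alpha (q ^ 2) = ((1 - rho q ^ 2) / (1 + rho q ^ 2)) ^ 2.
Proof.
  intros Hq. unfold alpha. replace (rho (q ^ 2) ^ 4) with ((rho (q ^ 2) ^ 2) ^ 2) by ring.
  rewrite rho_sq by easy. field. nra.
Qed.

(** Each factor is asymptotic to 16 times its argument. For n = 3 the product is therefore close to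
    (4q)^4, for n = 7 to (2q)^8, the leading terms of [a3] and [a7]. *)
Lemma alpha_product_approx n q : (2 <= n)%nat -> 0 < q <= 1 / 100 ->
  Rabs (alpha q * alpha (q ^ n) / (256 * q ^ S n) - 1) <= 11 * q.
Proof.
  intros Hn Hq.
  assert (Hx : 0 < q ^ n < 1) by (apply pow_unit_interval; [lra|lia]).
  assert (Hle : q ^ n <= q ^ 2) by (apply pow_decr_exponent; [lra|easy]).
  assert (q ^ 2 <= q / 100) by nra.
  pose proof (alpha_approx q Hq) as H1. pose proof (alpha_approx (q ^ n) ltac:(lra)) as H2.
  set (u1 := alpha q / (16 * q)) in *. set (u2 := alpha (q ^ n) / (16 * q ^ n)) in *.
  replace (alpha q * alpha (q ^ n) / (256 * q ^ S n)) with (u1 * u2)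
    by (unfold u1, u2; simpl; field; split; lra).
  apply Rabs_le_between in H1, H2. apply Rabs_le.
  assert (- (q / 10) <= u2 - 1 <= q / 10) by lra.
  assert (u1 * u2 - 1 = (u1 - 1) * u2 + (u2 - 1)) by ring.
  split; nra.
Qed.

Lemma rho_product_approx n q : (2 <= n)%nat -> 0 < q <= 1 / 100 ->
  Rabs (rho q * rho (q ^ n) - (1 - 4 * q)) <= 14 * q ^ 2.
Proof.
  intros Hn Hq.
  assert (Hx : 0 < q ^ n < 1) by (apply pow_unit_interval; [lra|lia]).
  assert (Hle : q ^ n <= q ^ 2) by (apply pow_decr_exponent; [lra|easy]).
  assert (q ^ 2 <= q / 100) by nra.
  pose proof (rho_approx q ltac:(lra)) as H1. pose proof (rho_approx (q ^ n) ltac:(lra)) as H2.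
  pose proof (rho_bounds _ Hx) as H3.
  apply Rabs_le_between in H1, H2. apply Rabs_le.
  assert ((q ^ n) ^ 2 <= q ^ n * (1 / 100)) by nra.
  assert (- (5 * q ^ 2) <= rho (q ^ n) - 1 <= 0) by lra.
  replace (rho q * rho (q ^ n) - (1 - 4 * q))
    with ((rho q - (1 - 4 * q)) * rho (q ^ n) + (1 - 4 * q) * (rho (q ^ n) - 1)) by ring.
  split; nra.
Qed.

(** The right side is [y ^ 2] times the defect at q^2, split as ((y - t)^2 - z^2) + ((1 - t^2)^2 -
    a^2). With t fixed, a larger [a] means a smaller u^2 + v^2, since (u^2 + v^2)^2 = (1 + t^4)^2 -
    a^4, hence a smaller y; and a = 1 - t^2 corresponds exactly to y = t + z. So both brackets have
    the sign of 1 - a - t^2, and the second alone is at least a |1 - a - t^2|. *)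
Lemma degree3_slope u v a t z y :
  0 < u < 1 -> 0 < v < 1 -> 0 < t -> t ^ 2 = u * v -> 0 < z -> z ^ 2 = 1 - t ^ 2 + t ^ 4 ->
  0 < a -> a ^ 4 = (1 - u ^ 4) * (1 - v ^ 4) -> 0 < y -> y ^ 2 = (1 + u ^ 2) * (1 + v ^ 2) ->
  a * Rabs (1 - a - t ^ 2) <= Rabs (y ^ 2 - 2 * t * y - a ^ 2).
Proof.
  intros Hu Hv Ht Htt Hz Hzz Ha Haa Hy Hyy.
  assert (Ht1 : t ^ 2 < 1) by nra.
  assert (Hs : 0 <= u ^ 2 + v ^ 2) by nra.
  assert (Et : t ^ 4 = u ^ 2 * v ^ 2) by (replace (t ^ 4) with ((t ^ 2) ^ 2) by ring; rewrite Htt; ring).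
  assert (E1 : (u ^ 2 + v ^ 2) ^ 2 = (1 + t ^ 4) ^ 2 - a ^ 4) by (rewrite Haa, Et; ring).
  assert (E2 : (2 * t * z) ^ 2 = (1 + t ^ 4) ^ 2 - (1 - t ^ 2) ^ 4).
  { replace ((2 * t * z) ^ 2) with (4 * t ^ 2 * z ^ 2) by ring. rewrite Hzz; ring. }
  assert (E3 : y ^ 2 = 1 + t ^ 4 + (u ^ 2 + v ^ 2)) by (rewrite Hyy, Et; ring).
  assert (E4 : (t + z) ^ 2 = 1 + t ^ 4 + 2 * t * z).
  { replace ((t + z) ^ 2) with (t ^ 2 + 2 * t * z + z ^ 2) by ring. rewrite Hzz; ring. }
  replace (y ^ 2 - 2 * t * y - a ^ 2)
    with (((y - t) ^ 2 - z ^ 2) + ((1 - t ^ 2) ^ 2 - a ^ 2)) by (rewrite Hzz; ring).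
  assert (Hyt : t <= y) by (apply le_of_sq; [lra|]; nra).
  destruct (Rle_dec a (1 - t ^ 2)) as [Hc|Hc].
  - assert (a ^ 4 <= (1 - t ^ 2) ^ 4) by (apply pow_incr; lra).
    assert (2 * t * z <= u ^ 2 + v ^ 2) by (apply le_of_sq; lra).
    assert (t + z <= y) by (apply le_of_sq; lra).
    assert (z ^ 2 <= (y - t) ^ 2) by (apply pow_incr; lra).
    assert (0 <= (1 - t ^ 2 - a) * (1 - t ^ 2)) by (apply Rmult_le_pos; lra).
    assert (0 <= (1 - t ^ 2 - a) * a) by (apply Rmult_le_pos; lra).
    assert ((1 - t ^ 2) ^ 2 - a ^ 2 = (1 - t ^ 2 - a) * (1 - t ^ 2) + (1 - t ^ 2 - a) * a) by ring.
    rewrite Rabs_pos_eq by lra. rewrite Rabs_pos_eq; lra.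
  - assert ((1 - t ^ 2) ^ 4 <= a ^ 4) by (apply pow_incr; lra).
    assert (u ^ 2 + v ^ 2 <= 2 * t * z) by (apply le_of_sq; [|lra]; nra).
    assert (y <= t + z) by (apply le_of_sq; lra).
    assert ((y - t) ^ 2 <= z ^ 2) by (apply pow_incr; lra).
    assert (0 <= (a - (1 - t ^ 2)) * (1 - t ^ 2)) by (apply Rmult_le_pos; lra).
    assert (0 <= (a - (1 - t ^ 2)) * a) by (apply Rmult_le_pos; lra).
    assert ((1 - t ^ 2) ^ 2 - a ^ 2
            = - ((a - (1 - t ^ 2)) * (1 - t ^ 2) + (a - (1 - t ^ 2)) * a)) by ring.
    rewrite Rabs_left1 by lra. rewrite Rabs_left1; lra.
Qed.

(** The monotonicity argument of [degree3_slope] again. It works because, with b = t^2, (1 + b^4)^2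
    - (1 - b)^8 = 4 b (1 - b + b^2)^2 (2 - 3b + 2b^2): the critical value of u^2 + v^2 involves only
    t and z, and there 4 (1 + u^2)(1 + v^2) = (t + z)^4. *)
Lemma degree7_slope u v a t z y :
  0 < u < 1 -> 0 < v < 1 -> 0 < t -> t ^ 4 = u * v ->
  0 < z -> z ^ 2 = 2 - 3 * t ^ 2 + 2 * t ^ 4 ->
  0 < a -> a ^ 8 = (1 - u ^ 4) * (1 - v ^ 4) ->
  0 < y -> y ^ 4 = 4 * ((1 + u ^ 2) * (1 + v ^ 2)) ->
  2 * a * Rabs (1 - a - t ^ 2) <= Rabs (y ^ 2 - 2 * t * y - 2 * a ^ 2).
Proof.
  intros Hu Hv Ht Htt Hz Hzz Ha Haa Hy Hyy.
  assert (Ht1 : t ^ 2 < 1) by nra.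
  assert (Ep : 0 < 1 - t ^ 2 + t ^ 4) by nra.
  assert (Hs : 0 <= u ^ 2 + v ^ 2) by nra.
  assert (Et : t ^ 8 = u ^ 2 * v ^ 2) by (replace (t ^ 8) with ((t ^ 4) ^ 2) by ring; rewrite Htt; ring).
  assert (E1 : (u ^ 2 + v ^ 2) ^ 2 = (1 + t ^ 8) ^ 2 - a ^ 8) by (rewrite Haa, Et; ring).
  assert (E2 : (2 * (1 - t ^ 2 + t ^ 4) * t * z) ^ 2 = (1 + t ^ 8) ^ 2 - (1 - t ^ 2) ^ 8).
  { replace ((2 * (1 - t ^ 2 + t ^ 4) * t * z) ^ 2)
      with (4 * (1 - t ^ 2 + t ^ 4) ^ 2 * t ^ 2 * z ^ 2) by ring. rewrite Hzz; ring. }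
  assert (E3 : y ^ 4 = 4 * (1 + t ^ 8 + (u ^ 2 + v ^ 2))) by (rewrite Hyy, Et; ring).
  assert (E4 : (t + z) ^ 4 = 4 * (1 + t ^ 8 + 2 * (1 - t ^ 2 + t ^ 4) * t * z)).
  { replace ((t + z) ^ 4) with ((t ^ 2 + 2 * t * z + z ^ 2) ^ 2) by ring. rewrite Hzz.
    replace ((t ^ 2 + 2 * t * z + (2 - 3 * t ^ 2 + 2 * t ^ 4)) ^ 2)
     with (4 * ((1 - t ^ 2 + t ^ 4) ^ 2 + 2 * (1 - t ^ 2 + t ^ 4) * t * z + t ^ 2 * z ^ 2)) by ring.
    rewrite Hzz. ring. }
  replace (y ^ 2 - 2 * t * y - 2 * a ^ 2)
    with (((y - t) ^ 2 - z ^ 2) + 2 * ((1 - t ^ 2) ^ 2 - a ^ 2)) by (rewrite Hzz; ring).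
  assert (Hp0 : 0 <= 2 * (1 - t ^ 2 + t ^ 4) * t * z) by (repeat apply Rmult_le_pos; lra).
  assert (Q4 : forall x w, 0 <= w -> 0 <= x -> x ^ 4 <= w ^ 4 -> x <= w).
  { intros x w Hw Hx H. apply le_of_sq; [easy|]. apply le_of_sq; [nra|].
    replace ((x ^ 2) ^ 2) with (x ^ 4) by ring. replace ((w ^ 2) ^ 2) with (w ^ 4) by ring. easy. }
  assert (Hyt : t <= y).
  { apply Q4; [lra|lra|]. assert (0 <= t ^ 8) by (apply pow_le; lra).
    replace (t ^ 4) with ((t ^ 2) ^ 2) by ring. nra. }
  destruct (Rle_dec a (1 - t ^ 2)) as [Hc|Hc].
  - assert (a ^ 8 <= (1 - t ^ 2) ^ 8) by (apply pow_incr; lra).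
    assert (2 * (1 - t ^ 2 + t ^ 4) * t * z <= u ^ 2 + v ^ 2) by (apply le_of_sq; lra).
    assert (t + z <= y) by (apply Q4; lra).
    assert (z ^ 2 <= (y - t) ^ 2) by (apply pow_incr; lra).
    assert (0 <= (1 - t ^ 2 - a) * (1 - t ^ 2)) by (apply Rmult_le_pos; lra).
    assert (0 <= (1 - t ^ 2 - a) * a) by (apply Rmult_le_pos; lra).
    assert ((1 - t ^ 2) ^ 2 - a ^ 2 = (1 - t ^ 2 - a) * (1 - t ^ 2) + (1 - t ^ 2 - a) * a) by ring.
    rewrite Rabs_pos_eq by lra. rewrite Rabs_pos_eq; lra.
  - assert ((1 - t ^ 2) ^ 8 <= a ^ 8) by (apply pow_incr; lra).
    assert (u ^ 2 + v ^ 2 <= 2 * (1 - t ^ 2 + t ^ 4) * t * z) by (apply le_of_sq; lra).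
    assert (y <= t + z) by (apply Q4; lra).
    assert ((y - t) ^ 2 <= z ^ 2) by (apply pow_incr; lra).
    assert (0 <= (a - (1 - t ^ 2)) * (1 - t ^ 2)) by (apply Rmult_le_pos; lra).
    assert (0 <= (a - (1 - t ^ 2)) * a) by (apply Rmult_le_pos; lra).
    assert ((1 - t ^ 2) ^ 2 - a ^ 2
            = - ((a - (1 - t ^ 2)) * (1 - t ^ 2) + (a - (1 - t ^ 2)) * a)) by ring.
    rewrite Rabs_left1 by lra. rewrite Rabs_left1; lra.
Qed.

(** With moduli k, l at q and q^n, [a3] and [b3] are the square roots of k l and k' l', [a7] and
    [b7] the fourth roots. The equations a + b = 1 are those of Legendre (degree 3) and Guetzlaff
    (degree 7). *)
Definition a3 (q : R) : R := sqrt (sqrt (alpha q * alpha (q ^ 3))).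
Definition b3 (q : R) : R := rho q * rho (q ^ 3).
Definition a7 (q : R) : R := sqrt (sqrt (sqrt (alpha q * alpha (q ^ 7)))).
Definition b7 (q : R) : R := sqrt (rho q * rho (q ^ 7)).

Lemma alpha_product_pos n q : (0 < n)%nat -> 0 < q < 1 -> 0 < alpha q * alpha (q ^ n).
Proof.
  intros Hn Hq. apply Rmult_lt_0_compat; apply alpha_bounds; [easy|now apply pow_unit_interval].
Qed.

Lemma rho_product_pos n q : (0 < n)%nat -> 0 < q < 1 -> 0 < rho q * rho (q ^ n).
Proof.
  intros Hn Hq. apply Rmult_lt_0_compat; apply rho_bounds; [easy|now apply pow_unit_interval].
Qed.

Lemma a3_pos q : 0 < q < 1 -> 0 < a3 q.
Proof. intros Hq; pose proof (alpha_product_pos 3 q ltac:(lia) Hq); now repeat apply sqrt_lt_R0. Qed.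

Lemma a3_pow q : 0 < q < 1 -> a3 q ^ 4 = alpha q * alpha (q ^ 3).
Proof.
  intros Hq; pose proof (alpha_product_pos 3 q ltac:(lia) Hq). unfold a3.
  replace (sqrt (sqrt (alpha q * alpha (q ^ 3))) ^ 4)
    with ((sqrt (sqrt (alpha q * alpha (q ^ 3))) ^ 2) ^ 2) by ring.
  rewrite !pow2_sqrt; [easy|lra|apply sqrt_pos].
Qed.

Lemma a7_pos q : 0 < q < 1 -> 0 < a7 q.
Proof. intros Hq; pose proof (alpha_product_pos 7 q ltac:(lia) Hq); now repeat apply sqrt_lt_R0. Qed.

Lemma a7_pow q : 0 < q < 1 -> a7 q ^ 8 = alpha q * alpha (q ^ 7).
Proof.
  intros Hq; pose proof (alpha_product_pos 7 q ltac:(lia) Hq). unfold a7.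
  set (x := alpha q * alpha (q ^ 7)) in *.
  replace (sqrt (sqrt (sqrt x)) ^ 8) with (((sqrt (sqrt (sqrt x)) ^ 2) ^ 2) ^ 2) by ring.
  rewrite !pow2_sqrt; [easy|lra|apply sqrt_pos|apply sqrt_pos].
Qed.

Lemma b7_pos q : 0 < q < 1 -> 0 < b7 q.
Proof. intros Hq; apply sqrt_lt_R0, rho_product_pos; [lia|easy]. Qed.

Lemma b7_pow q : 0 < q < 1 -> b7 q ^ 2 = rho q * rho (q ^ 7).
Proof. intros Hq; apply pow2_sqrt; left; apply rho_product_pos; [lia|easy]. Qed.

(* [W] below is (1 + k'(q)) (1 + k'(q^n)); these are Landen's transformation. *)
Lemma alpha_product_landen n q : (0 < n)%nat -> 0 < q < 1 ->
  let W := (1 + rho q ^ 2) * (1 + rho (q ^ n) ^ 2) in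
  alpha (q ^ 2) * alpha ((q ^ 2) ^ n) = (alpha q * alpha (q ^ n)) ^ 2 / W ^ 4.
Proof.
  intros Hn Hq W. assert (Hqn : 0 < q ^ n < 1) by now apply pow_unit_interval.
  replace ((q ^ 2) ^ n) with ((q ^ n) ^ 2) by (rewrite <- !pow_mult; f_equal; lia).
  rewrite !alpha_sq by easy. unfold W, alpha. field. split; nra.
Qed.

Lemma rho_product_landen n q : (0 < n)%nat -> 0 < q < 1 ->
  let W := (1 + rho q ^ 2) * (1 + rho (q ^ n) ^ 2) in
  (rho (q ^ 2) * rho ((q ^ 2) ^ n)) ^ 2 = 4 * (rho q * rho (q ^ n)) / W.
Proof.
  intros Hn Hq W. assert (Hqn : 0 < q ^ n < 1) by now apply pow_unit_interval.
  replace ((q ^ 2) ^ n) with ((q ^ n) ^ 2) by (rewrite <- !pow_mult; f_equal; lia).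
  rewrite Rpow_mult_distr, !rho_sq by easy. unfold W. field. split; nra.
Qed.

Lemma landen_factor_bounds n q : (0 < n)%nat -> 0 < q < 1 ->
  1 < (1 + rho q ^ 2) * (1 + rho (q ^ n) ^ 2) < 4.
Proof.
  intros Hn Hq. assert (Hqn : 0 < q ^ n < 1) by now apply pow_unit_interval.
  pose proof (rho_bounds _ Hq); pose proof (rho_bounds _ Hqn).
  assert (0 < rho q ^ 2 < 1) by (apply pow_unit_interval; [easy|lia]).
  assert (0 < rho (q ^ n) ^ 2 < 1) by (apply pow_unit_interval; [easy|lia]).
  nra.
Qed.

Lemma a3_sq q y : 0 < q < 1 -> 0 < y -> y ^ 2 = (1 + rho q ^ 2) * (1 + rho (q ^ 3) ^ 2) ->
  a3 (q ^ 2) = a3 q ^ 2 / y ^ 2.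
Proof.
  intros Hq Hy Hyy. assert (Hq2 : 0 < q ^ 2 < 1) by (apply pow_unit_interval; [easy|lia]).
  apply (pow_inj_pos 3).
  - left; now apply a3_pos.
  - apply Rmult_le_pos; [apply pow2_ge_0|left; apply Rinv_0_lt_compat, pow_lt; easy].
  - rewrite a3_pow by easy. rewrite (alpha_product_landen 3) by (lia || easy).
    rewrite <- Hyy, <- a3_pow by easy. field. lra.
Qed.

Lemma b3_sq q y : 0 < q < 1 -> 0 < y -> y ^ 2 = (1 + rho q ^ 2) * (1 + rho (q ^ 3) ^ 2) ->
  b3 (q ^ 2) = 2 * sqrt (b3 q) / y.
Proof.
  intros Hq Hy Hyy. assert (Hq2 : 0 < q ^ 2 < 1) by (apply pow_unit_interval; [easy|lia]).
  pose proof (rho_product_pos 3 q ltac:(lia) Hq).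
  apply (pow_inj_pos 1).
  - left; apply rho_product_pos; [lia|easy].
  - apply Rmult_le_pos; [|left; now apply Rinv_0_lt_compat].
    apply Rmult_le_pos; [lra|apply sqrt_pos].
  - unfold b3 at 1. rewrite (rho_product_landen 3) by (lia || easy). rewrite <- Hyy.
    replace ((2 * sqrt (b3 q) / y) ^ 2) with (4 * sqrt (b3 q) ^ 2 / y ^ 2) by (field; lra).
    rewrite pow2_sqrt; [reflexivity|unfold b3; lra].
Qed.

(** The factor 4 in the normalisation of [y] makes [b7] transform by 2 sqrt(b)/y, the same formula
    as for [b3]. *)
Lemma a7_sq q y : 0 < q < 1 -> 0 < y -> y ^ 4 = 4 * ((1 + rho q ^ 2) * (1 + rho (q ^ 7) ^ 2)) ->
  a7 (q ^ 2) = 2 * a7 q ^ 2 / y ^ 2.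
Proof.
  intros Hq Hy Hyy. assert (Hq2 : 0 < q ^ 2 < 1) by (apply pow_unit_interval; [easy|lia]).
  apply (pow_inj_pos 7).
  - left; now apply a7_pos.
  - apply Rmult_le_pos; [|left; apply Rinv_0_lt_compat, pow_lt; easy].
    apply Rmult_le_pos; [lra|apply pow2_ge_0].
  - rewrite a7_pow by easy. rewrite (alpha_product_landen 7) by (lia || easy).
    replace ((1 + rho q ^ 2) * (1 + rho (q ^ 7) ^ 2)) with (y ^ 4 / 4) by lra.
    rewrite <- a7_pow by easy. field. lra.
Qed.

Lemma b7_sq q y : 0 < q < 1 -> 0 < y -> y ^ 4 = 4 * ((1 + rho q ^ 2) * (1 + rho (q ^ 7) ^ 2)) ->
  b7 (q ^ 2) = 2 * sqrt (b7 q) / y.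
Proof.
  intros Hq Hy Hyy. assert (Hq2 : 0 < q ^ 2 < 1) by (apply pow_unit_interval; [easy|lia]).
  pose proof (b7_pos q Hq) as Hb.
  apply (pow_inj_pos 3).
  - left; now apply b7_pos.
  - apply Rmult_le_pos; [|left; now apply Rinv_0_lt_compat].
    apply Rmult_le_pos; [lra|apply sqrt_pos].
  - replace (b7 (q ^ 2) ^ 4) with ((b7 (q ^ 2) ^ 2) ^ 2) by ring.
    rewrite b7_pow by easy.
    rewrite (rho_product_landen 7) by (lia || easy).
    replace ((1 + rho q ^ 2) * (1 + rho (q ^ 7) ^ 2)) with (y ^ 4 / 4) by lra.
    replace ((2 * sqrt (b7 q) / y) ^ 4) with (16 * (sqrt (b7 q) ^ 2) ^ 2 / y ^ 4) by (field; lra).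
    rewrite pow2_sqrt by lra. rewrite b7_pow by easy. field. lra.
Qed.

(** Multiplying the defect at q^2 by [y ^ 2] gives the quantity bounded below in [degree3_slope];
    the 4 is the upper bound for [y ^ 2], the Landen factor. *)
Lemma degree3_landen q : 0 < q < 1 ->
  a3 q * Rabs (1 - a3 q - b3 q) <= 4 * Rabs (1 - a3 (q ^ 2) - b3 (q ^ 2)).
Proof.
  intros Hq. assert (Hq3 : 0 < q ^ 3 < 1) by (apply pow_unit_interval; [easy|lia]).
  pose proof (landen_factor_bounds 3 q ltac:(lia) Hq) as HW.
  set (W := (1 + rho q ^ 2) * (1 + rho (q ^ 3) ^ 2)) in *.
  set (y := sqrt W). assert (Hy : 0 < y) by (apply sqrt_lt_R0; lra).
  assert (Hyy : y ^ 2 = W) by (apply pow2_sqrt; lra).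
  pose proof (rho_product_pos 3 q ltac:(lia) Hq) as Hb. fold (b3 q) in Hb.
  assert (Ht : 0 < sqrt (b3 q)) by now apply sqrt_lt_R0.
  assert (Htt : sqrt (b3 q) ^ 2 = b3 q) by (apply pow2_sqrt; lra).
  rewrite (a3_sq q y), (b3_sq q y) by easy.
  set (t := sqrt (b3 q)) in *.
  assert (Hp : 0 < 1 - t ^ 2 + t ^ 4) by nra.
  apply Rle_trans with (Rabs (y ^ 2 - 2 * t * y - a3 q ^ 2)).
  - rewrite <- Htt. apply degree3_slope with (rho q) (rho (q ^ 3)) (sqrt (1 - t ^ 2 + t ^ 4));
      try easy; try (now apply rho_bounds); [now apply sqrt_lt_R0|apply pow2_sqrt; lra|now apply a3_pos|now apply a3_pow].
  - replace (y ^ 2 - 2 * t * y - a3 q ^ 2) with (y ^ 2 * (1 - a3 q ^ 2 / y ^ 2 - 2 * t / y)) by (field; lra).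
    rewrite Rabs_mult, (Rabs_pos_eq (y ^ 2)) by lra.
    apply Rmult_le_compat_r; [apply Rabs_pos|lra].
Qed.

Lemma degree7_landen q : 0 < q < 1 ->
  a7 q * Rabs (1 - a7 q - b7 q) <= 2 * Rabs (1 - a7 (q ^ 2) - b7 (q ^ 2)).
Proof.
  intros Hq. assert (Hq7 : 0 < q ^ 7 < 1) by (apply pow_unit_interval; [easy|lia]).
  pose proof (landen_factor_bounds 7 q ltac:(lia) Hq) as HW.
  set (W := (1 + rho q ^ 2) * (1 + rho (q ^ 7) ^ 2)) in *.
  set (y := sqrt (sqrt (4 * W))). assert (Hy : 0 < y) by (repeat apply sqrt_lt_R0; lra).
  assert (Hyy : y ^ 4 = 4 * W).
  { replace (y ^ 4) with ((y ^ 2) ^ 2) by ring. unfold y. rewrite !pow2_sqrt; [easy|lra|apply sqrt_pos]. }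
  assert (Hy2 : y ^ 2 <= 4) by (apply le_of_sq; [lra|]; replace ((y ^ 2) ^ 2) with (y ^ 4) by ring; lra).
  pose proof (b7_pos q Hq) as Hb.
  assert (Ht : 0 < sqrt (b7 q)) by now apply sqrt_lt_R0.
  assert (Htt : sqrt (b7 q) ^ 2 = b7 q) by (apply pow2_sqrt; lra).
  rewrite (a7_sq q y), (b7_sq q y) by easy.
  set (t := sqrt (b7 q)) in *.
  assert (Hp : 0 < 2 - 3 * t ^ 2 + 2 * t ^ 4) by (pose proof (pow2_ge_0 (t ^ 2 - 3 / 4)); nra).
  apply Rmult_le_reg_l with 2; [lra|].
  apply Rle_trans with (Rabs (y ^ 2 - 2 * t * y - 2 * a7 q ^ 2)).
  - rewrite <- Htt, <- Rmult_assoc.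
    apply degree7_slope with (rho q) (rho (q ^ 7)) (sqrt (2 - 3 * t ^ 2 + 2 * t ^ 4));
      try easy; try (now apply rho_bounds);
      [|now apply sqrt_lt_R0|apply pow2_sqrt; lra|now apply a7_pos|now apply a7_pow].
    replace (t ^ 4) with ((t ^ 2) ^ 2) by ring. rewrite Htt. now apply b7_pow.
  - replace (y ^ 2 - 2 * t * y - 2 * a7 q ^ 2) with (y ^ 2 * (1 - 2 * a7 q ^ 2 / y ^ 2 - 2 * t / y)) by (field; lra).
    rewrite Rabs_mult, (Rabs_pos_eq (y ^ 2)) by (apply pow2_ge_0).
    rewrite <- Rmult_assoc. apply Rmult_le_compat_r; [apply Rabs_pos|lra].
Qed.

Lemma a3_approx q : 0 < q <= 1 / 100 -> Rabs (a3 q - 4 * q) <= 44 * q ^ 2.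
Proof.
  intros Hq. pose proof (a3_pos q ltac:(lra)).
  set (v := a3 q / (4 * q)).
  assert (Hv : 0 <= v) by (apply Rmult_le_pos; [lra|left; apply Rinv_0_lt_compat; lra]).
  pose proof (root_dist 3 v Hv) as Hr.
  replace (v ^ 4) with (alpha q * alpha (q ^ 3) / (256 * q ^ 4)) in Hr
    by (rewrite <- a3_pow by lra; unfold v; field; lra).
  pose proof (alpha_product_approx 3 q ltac:(lia) Hq) as Ha.
  replace (a3 q - 4 * q) with (4 * q * (v - 1)) by (unfold v; field; lra).
  rewrite Rabs_mult, (Rabs_pos_eq (4 * q)) by lra. nra.
Qed.

Lemma a7_approx q : 0 < q <= 1 / 100 -> Rabs (a7 q - 2 * q) <= 22 * q ^ 2.
Proof.
  intros Hq. pose proof (a7_pos q ltac:(lra)).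
  set (v := a7 q / (2 * q)).
  assert (Hv : 0 <= v) by (apply Rmult_le_pos; [lra|left; apply Rinv_0_lt_compat; lra]).
  pose proof (root_dist 7 v Hv) as Hr.
  replace (v ^ 8) with (alpha q * alpha (q ^ 7) / (256 * q ^ 8)) in Hr
    by (rewrite <- a7_pow by lra; unfold v; field; lra).
  pose proof (alpha_product_approx 7 q ltac:(lia) Hq) as Ha.
  replace (a7 q - 2 * q) with (2 * q * (v - 1)) by (unfold v; field; lra).
  rewrite Rabs_mult, (Rabs_pos_eq (2 * q)) by lra. nra.
Qed.

Lemma b7_approx q : 0 < q <= 1 / 100 -> Rabs (b7 q - (1 - 2 * q)) <= 20 * q ^ 2.
Proof.
  intros Hq. pose proof (b7_pos q ltac:(lra)).
  pose proof (rho_product_approx 7 q ltac:(lia) Hq) as H1.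
  rewrite <- b7_pow in H1 by lra.
  apply Rabs_le_between in H1. apply Rabs_le.
  (* Here 18 = 14 + 4, the 4 coming from (1 - 2q)^2. Dividing by the second factor, at least 0.98,
     stays below 20. *)
  assert (- (18 * q ^ 2) <= (b7 q - (1 - 2 * q)) * (b7 q + (1 - 2 * q)) <= 18 * q ^ 2) by (split; nra).
  split; nra.
Qed.

Theorem modular_equation_3 q : 0 < q < 1 -> a3 q + b3 q = 1.
Proof.
  intros Hq. assert (1 - a3 q - b3 q = 0); [|lra].
  (* The linear terms 4q and -4q cancel, leaving at most (44 + 14) q^2. The slope 3/4 is
     [a3 q >= 3 * q] divided by the 4 of [degree3_landen]. *)
  revert q Hq. apply (rigidity (fun q => 1 - a3 q - b3 q) 1 (3 / 4) 60 (1 / 100)); try lra.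
  - intros q Hq He. pose proof (a3_approx q ltac:(lra)) as H1.
    pose proof (rho_product_approx 3 q ltac:(lia) ltac:(lra)) as H2. fold (b3 q) in H2.
    apply Rabs_le_between in H1, H2. apply Rabs_le. split; nra.
  - intros q Hq He. pose proof (a3_approx q ltac:(lra)) as H1. apply Rabs_le_between in H1.
    pose proof (degree3_landen q Hq). pose proof (Rabs_pos (1 - a3 q - b3 q)).
    assert (3 * q <= a3 q) by nra. simpl (q ^ 1). nra.
  - intros q Hq H0. pose proof (degree3_landen q Hq) as H. rewrite H0, Rabs_R0 in H.
    pose proof (a3_pos q Hq). pose proof (Rabs_pos (1 - a3 q - b3 q)). apply Rabs_eq_0. nra.
Qed.

Theorem modular_equation_7 q : 0 < q < 1 -> a7 q + b7 q = 1.
Proof.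
  intros Hq. assert (1 - a7 q - b7 q = 0); [|lra].
  revert q Hq. apply (rigidity (fun q => 1 - a7 q - b7 q) 1 (1 / 2) 60 (1 / 100)); try lra.
  - intros q Hq He. pose proof (a7_approx q ltac:(lra)) as H1.
    pose proof (b7_approx q ltac:(lra)) as H2.
    apply Rabs_le_between in H1, H2. apply Rabs_le. split; nra.
  - intros q Hq He. pose proof (a7_approx q ltac:(lra)) as H1. apply Rabs_le_between in H1.
    pose proof (degree7_landen q Hq). pose proof (Rabs_pos (1 - a7 q - b7 q)).
    assert (q <= a7 q) by nra. simpl (q ^ 1). nra.
  - intros q Hq H0. pose proof (degree7_landen q Hq) as H. rewrite H0, Rabs_R0 in H.
    pose proof (a7_pos q Hq). pose proof (Rabs_pos (1 - a7 q - b7 q)). apply Rabs_eq_0. nra.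
Qed.

(** * Multipliers *)

Lemma sum_diff_unique (x y s d : R) : 0 <= s -> 0 <= d -> 0 <= x -> x <= y ->
  (x + y) ^ 2 = s ^ 2 -> 4 * (x * y) = s ^ 2 - d ^ 2 -> x = (s - d) / 2 /\ y = (s + d) / 2.
Proof.
  intros Hs Hd Hx Hxy H1 H2.
  assert (x + y = s) by (apply (pow_inj_pos 1); lra).
  assert (y - x = d) by (apply (pow_inj_pos 1); nra).
  lra.
Qed.

(** The modular equation turns the product of the two [alpha] into (1 - b)^4, so both sum and
    product of the squared [rho] are known in b; here (1 + b^2)^2 - (1 - b)^4 = 4b(1 - b + b^2) is a
    square in t and z. [rho_lt_pow] assigns the minus sign to q. *)
Lemma degree3_param q : 0 < q < 1 ->
  let t := sqrt (b3 q) in let z := sqrt (1 - b3 q + b3 q ^ 2) in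
  rho q ^ 2 = t * z - (1 - t ^ 2) * t /\ rho (q ^ 3) ^ 2 = t * z + (1 - t ^ 2) * t.
Proof.
  intros Hq t z. assert (Hq3 : 0 < q ^ 3 < 1) by (apply pow_unit_interval; [easy|lia]).
  pose proof (rho_product_pos 3 q ltac:(lia) Hq) as Hb. fold (b3 q) in Hb.
  pose proof (a3_pos q Hq) as Ha. pose proof (modular_equation_3 q Hq) as HD.
  pose proof (rho_bounds _ Hq) as Hu; pose proof (rho_bounds _ Hq3) as Hv.
  pose proof (rho_lt_pow 3 q ltac:(lia) Hq) as Hlt.
  assert (Hz : z ^ 2 = 1 - b3 q + b3 q ^ 2) by (apply pow2_sqrt; nra).
  assert (Ht : t ^ 2 = b3 q) by (apply pow2_sqrt; lra).
  assert (Hz0 : 0 <= z) by apply sqrt_pos. assert (Ht0 : 0 <= t) by apply sqrt_pos.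
  pose proof (a3_pow q Hq) as Ea. replace (a3 q) with (1 - t ^ 2) in Ea by lra.
  destruct (sum_diff_unique (rho q ^ 2) (rho (q ^ 3) ^ 2) (2 * (t * z)) (2 * ((1 - t ^ 2) * t)))
    as [E1 E2]; try lra.
  - assert (0 <= t * z) by (now apply Rmult_le_pos). lra.
  - assert (0 <= (1 - t ^ 2) * t) by (apply Rmult_le_pos; lra). lra.
  - apply pow2_ge_0.
  - apply pow_incr; lra.
  - transitivity ((1 + b3 q ^ 2) ^ 2 - (1 - t ^ 2) ^ 4).
    + rewrite Ea. unfold b3, alpha. ring.
    + replace ((2 * (t * z)) ^ 2) with (4 * t ^ 2 * z ^ 2) by ring. rewrite Hz, Ht. ring.
  - replace (rho q ^ 2 * rho (q ^ 3) ^ 2) with (b3 q ^ 2) by (unfold b3; ring).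
    replace ((2 * (t * z)) ^ 2 - (2 * ((1 - t ^ 2) * t)) ^ 2)
      with (4 * t ^ 2 * (z ^ 2 - (1 - t ^ 2) ^ 2)) by ring. rewrite Hz, Ht. ring.
Qed.

(** As in degree 3, sum and product determine both values. The radicand of [g] is the polynomial for
    which (1 - b + b^2)^2 z^2 - (1 - b)^2 g^2 = b^3, as the product requires. *)
Lemma degree7_param q : 0 < q < 1 ->
  let b := b7 q in let t := sqrt b in let z := sqrt (2 - 3 * b + 2 * b ^ 2) in
  let g := sqrt (2 - 3 * b + 6 * b ^ 2 - 3 * b ^ 3 + 2 * b ^ 4) in
  rho q ^ 2 = (1 - b + b ^ 2) * t * z - (1 - b) * t * g /\
  rho (q ^ 7) ^ 2 = (1 - b + b ^ 2) * t * z + (1 - b) * t * g.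
Proof.
  intros Hq b t z g. assert (Hq7 : 0 < q ^ 7 < 1) by (apply pow_unit_interval; [easy|lia]).
  pose proof (b7_pos q Hq) as Hb. fold b in Hb.
  pose proof (a7_pos q Hq) as Ha. pose proof (modular_equation_7 q Hq) as HD. fold b in HD.
  pose proof (rho_bounds _ Hq) as Hu; pose proof (rho_bounds _ Hq7) as Hv.
  pose proof (rho_lt_pow 7 q ltac:(lia) Hq) as Hlt.
  assert (Hz : z ^ 2 = 2 - 3 * b + 2 * b ^ 2) by (apply pow2_sqrt; nra).
  assert (Hg : g ^ 2 = 2 - 3 * b + 6 * b ^ 2 - 3 * b ^ 3 + 2 * b ^ 4).
  { apply pow2_sqrt. assert (0 <= b ^ 2 * (6 - 3 * b)) by (apply Rmult_le_pos; nra).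
    assert (0 <= b ^ 4) by (apply pow_le; lra).
    assert (0 <= 2 - 3 * b + 2 * b ^ 2) by nra. nra. }
  assert (Ht : t ^ 2 = b) by (apply pow2_sqrt; lra).
  assert (Hz0 : 0 <= z) by apply sqrt_pos. assert (Ht0 : 0 <= t) by apply sqrt_pos.
  assert (Hg0 : 0 <= g) by apply sqrt_pos.
  assert (Hp : 0 <= 1 - b + b ^ 2) by nra.
  pose proof (a7_pow q Hq) as Ea. replace (a7 q) with (1 - b) in Ea by lra.
  pose proof (b7_pow q Hq) as Eb. fold b in Eb.
  destruct (sum_diff_unique (rho q ^ 2) (rho (q ^ 7) ^ 2)
    (2 * ((1 - b + b ^ 2) * t * z)) (2 * ((1 - b) * t * g))) as [E1 E2]; try lra.
  - assert (0 <= (1 - b + b ^ 2) * t * z) by (repeat apply Rmult_le_pos; lra). lra.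
  - assert (0 <= (1 - b) * t * g) by (repeat apply Rmult_le_pos; lra). lra.
  - apply pow2_ge_0.
  - apply pow_incr; lra.
  - transitivity ((1 + (b ^ 2) ^ 2) ^ 2 - (1 - b) ^ 8).
    + rewrite Ea, Eb. unfold alpha. ring.
    + replace ((2 * ((1 - b + b ^ 2) * t * z)) ^ 2)
        with (4 * (1 - b + b ^ 2) ^ 2 * t ^ 2 * z ^ 2) by ring. rewrite Hz, Ht. ring.
  - replace (rho q ^ 2 * rho (q ^ 7) ^ 2) with ((b ^ 2) ^ 2) by (rewrite Eb; ring).
    replace ((2 * ((1 - b + b ^ 2) * t * z)) ^ 2 - (2 * ((1 - b) * t * g)) ^ 2)
      with (4 * t ^ 2 * ((1 - b + b ^ 2) ^ 2 * z ^ 2 - (1 - b) ^ 2 * g ^ 2)) by ring.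
    rewrite Hz, Ht, Hg. ring.
Qed.

Definition multiplier (n : nat) (q : R) : R := phi q ^ 2 / phi (q ^ n) ^ 2.

Lemma mult_landen n q : (0 < n)%nat -> 0 < q < 1 ->
  multiplier n (q ^ 2) = multiplier n q * ((1 + rho q ^ 2) / (1 + rho (q ^ n) ^ 2)).
Proof.
  intros Hn Hq. assert (Hqn : 0 < q ^ n < 1) by now apply pow_unit_interval.
  unfold multiplier. replace ((q ^ 2) ^ n) with ((q ^ n) ^ 2) by (rewrite <- !pow_mult; f_equal; lia).
  pose proof (phi_ge_1 _ Hqn). rewrite !phi_sq_landen by easy. field. split; [nra|lra].
Qed.

Lemma mult_approx n q : (2 <= n)%nat -> 0 < q <= 1 / 100 -> Rabs (multiplier n q - 1) <= 7 * q.
Proof.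
  intros Hn Hq.
  assert (Hx : 0 < q ^ n < 1) by (apply pow_unit_interval; [lra|lia]).
  assert (Hle : q ^ n <= q ^ 2) by (apply pow_decr_exponent; [lra|easy]).
  assert (q ^ 2 <= q / 100) by nra.
  assert (B : forall x, 0 < x <= 1 / 100 -> 1 <= phi x ^ 2 <= 1 + 7 * x).
  { intros x Hx'. pose proof (phi_ge_1 x ltac:(lra)). pose proof (phi_approx x) as H1.
    rewrite Rabs_pos_eq in H1 by lra. specialize (H1 ltac:(lra)). apply Rabs_le_between in H1.
    assert (x ^ 4 <= x * 1 ^ 3 / 100).
    { replace (x ^ 4) with (x * x * x ^ 2) by ring. assert (x ^ 2 <= 1) by nra.
      assert (x * x <= x / 100) by nra. assert (0 <= x * x) by nra. nra. }
    split; nra. }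
  pose proof (B q Hq) as [L1 U1]; pose proof (B (q ^ n) ltac:(lra)) as [L2 U2].
  unfold multiplier. set (X := phi q ^ 2) in *; set (Y := phi (q ^ n) ^ 2) in *.
  replace (X / Y - 1) with ((X - Y) * / Y) by (field; lra).
  rewrite Rabs_mult, (Rabs_pos_eq (/ Y)) by (left; apply Rinv_0_lt_compat; lra).
  assert (0 < / Y <= 1). { split; [apply Rinv_0_lt_compat; lra|]. rewrite <- Rinv_1. apply Rinv_le_contravar; lra. }
  assert (Rabs (X - Y) <= 7 * q) by (apply Rabs_le; lra).
  pose proof (Rabs_pos (X - Y)). nra.
Qed.

(** Under q -> q^2 the difference of the two sides is multiplied by a quotient that is at least 1/2,
    since its numerator exceeds 1 and its denominator is below 2. Both sides tend to 1 at 0, so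
    [rigidity] applies with j = 0. *)
Lemma mult_rigid (n : nat) (f : R -> R) (K : R) : (2 <= n)%nat ->
  (forall q, 0 < q <= 1 / 100 -> Rabs (f q - 1) <= K * q) ->
  (forall q, 0 < q < 1 -> f (q ^ 2) * (1 + rho (q ^ n) ^ 2) = f q * (1 + rho q ^ 2)) ->
  forall q, 0 < q < 1 -> multiplier n q = f q.
Proof.
  intros Hn Hf Hl q Hq. assert (multiplier n q - f q = 0); [|lra].
  assert (E : forall q, 0 < q < 1 -> multiplier n (q ^ 2) - f (q ^ 2)
    = (multiplier n q - f q) * ((1 + rho q ^ 2) / (1 + rho (q ^ n) ^ 2))).
  { intros x Hx. rewrite mult_landen by (lia || easy).
    replace (f (x ^ 2)) with (f x * (1 + rho x ^ 2) / (1 + rho (x ^ n) ^ 2)).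
    - field. nra.
    - rewrite <- Hl by easy. field. nra. }
  assert (F : forall q, 0 < q < 1 -> 1 / 2 <= (1 + rho q ^ 2) / (1 + rho (q ^ n) ^ 2)).
  { intros x Hx. assert (Hxn : 0 < x ^ n < 1) by (apply pow_unit_interval; [easy|lia]).
    pose proof (rho_bounds _ Hxn). pose proof (pow2_ge_0 (rho x)).
    apply Rmult_le_reg_r with (1 + rho (x ^ n) ^ 2); [nra|].
    unfold Rdiv at 2. rewrite Rmult_assoc, Rinv_l by nra. nra. }
  revert q Hq. apply (rigidity (fun q => multiplier n q - f q) 0 (1 / 2) (7 + K) (1 / 100)); try lra.
  - intros q Hq He. pose proof (mult_approx n q Hn ltac:(lra)) as H1.
    pose proof (Hf q ltac:(lra)) as H2. apply Rabs_le_between in H1, H2.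
    apply Rabs_le. simpl (q ^ 1). lra.
  - intros q Hq He. rewrite E by easy. rewrite Rabs_mult.
    pose proof (F q Hq). pose proof (Rabs_pos (multiplier n q - f q)).
    rewrite (Rabs_pos_eq (_ / _)) by lra. simpl (q ^ 0). nra.
  - intros q Hq H0. rewrite E in H0 by easy. pose proof (F q Hq).
    apply Rmult_integral in H0. lra.
Qed.

(** For [f3] and [f7] alike, b -> 1 - b changes the sign of the first summand and fixes the
    radicand. The values at b = 1 are 1, those at b = 0 are 3 and 7, and f(b) f(1 - b) is 3 or 7
    respectively. *)
Definition f3 (b : R) : R := 1 - 2 * b + 2 * sqrt (1 - b + b ^ 2).
Definition f7 (b : R) : R := (1 - 2 * b) * (3 - 2 * b + 2 * b ^ 2) +
  2 * sqrt ((2 - 3 * b + 2 * b ^ 2) * (2 - 3 * b + 6 * b ^ 2 - 3 * b ^ 3 + 2 * b ^ 4)).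

Theorem multiplier_3 q : 0 < q < 1 -> multiplier 3 q = f3 (b3 q).
Proof.
  apply (mult_rigid 3 (fun q => f3 (b3 q)) 20); [lia| |].
  - intros x Hx. pose proof (modular_equation_3 x ltac:(lra)) as HD.
    pose proof (a3_pos x ltac:(lra)). pose proof (a3_approx x Hx) as Ha.
    pose proof (rho_product_pos 3 x ltac:(lia) ltac:(lra)) as Hb. fold (b3 x) in Hb.
    apply Rabs_le_between in Ha. set (b := b3 x) in *.
    assert (1 - b <= 5 * x) by nra.
    set (s := sqrt (1 - b + b ^ 2)).
    assert (Hs : s ^ 2 = 1 - b + b ^ 2) by (apply pow2_sqrt; nra).
    assert (Hs0 : 0 <= s) by apply sqrt_pos.
    assert (Hs1 : 1 / 2 <= s) by (apply le_of_sq; [lra|]; nra).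
    unfold f3. fold s. apply Rabs_le. assert (b <= s <= 1) by (split; apply le_of_sq; nra). lra.
  - intros x Hx. assert (Hx3 : 0 < x ^ 3 < 1) by (apply pow_unit_interval; [easy|lia]).
    pose proof (rho_product_pos 3 x ltac:(lia) Hx) as Hb. fold (b3 x) in Hb.
    pose proof (modular_equation_3 x Hx) as HD. pose proof (a3_pos x Hx).
    destruct (degree3_param x Hx) as [E1 E2].
    set (b := b3 x) in *. set (t := sqrt b) in *. set (z := sqrt (1 - b + b ^ 2)) in *.
    assert (Hz : z ^ 2 = 1 - b + b ^ 2) by (apply pow2_sqrt; nra).
    assert (Ht : t ^ 2 = b) by (apply pow2_sqrt; lra).
    assert (Hz0 : 0 < z) by (apply sqrt_lt_R0; nra). assert (Ht0 : 0 < t) by (now apply sqrt_lt_R0).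
    (* By the modular equation the Landen factor is the square of t + z, so b at x^2 is 2t/(t + z)
       and the functional equation becomes algebraic in t and z. *)
    rewrite (b3_sq x (t + z)); [|easy|lra|].
    2:{ rewrite E1, E2. replace ((1 + (t * z - (1 - t ^ 2) * t)) * (1 + (t * z + (1 - t ^ 2) * t)))
          with (1 + 2 * (t * z) + t ^ 2 * (z ^ 2 - (1 - t ^ 2) ^ 2)) by ring.
        replace ((t + z) ^ 2) with (t ^ 2 + 2 * (t * z) + z ^ 2) by ring. rewrite Hz, Ht. ring. }
    fold b. fold t. unfold f3 at 1.
    (* The new radicand is again a square because 3t^2 + z^2 = (1 + b)^2. *)
    replace (1 - 2 * t / (t + z) + (2 * t / (t + z)) ^ 2) with (((1 + b) / (t + z)) ^ 2).
    2:{ apply Rmult_eq_reg_r with ((t + z) ^ 2); [|apply pow_nonzero; lra].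
        transitivity ((1 + b) ^ 2); [field; lra|].
        transitivity (3 * t ^ 2 + z ^ 2); [rewrite Hz, Ht; ring|field; lra]. }
    rewrite sqrt_pow2 by (apply Rmult_le_pos; [lra|left; apply Rinv_0_lt_compat; lra]).
    unfold f3. fold z. rewrite E1, E2.
    apply Rmult_eq_reg_r with (t + z); [|lra].
    transitivity ((z - 3 * t + 2 + 2 * b) * (1 + (t * z + (1 - t ^ 2) * t))); [field; lra|].
    rewrite <- Ht in *.
    assert (H3 : z ^ 3 = z * (1 - t ^ 2 + (t ^ 2) ^ 2)) by (rewrite <- Hz; ring).
    apply Rminus_diag_uniq. ring_simplify. rewrite ?H3, ?Hz. ring.
Qed.

Theorem multiplier_7 q : 0 < q < 1 -> multiplier 7 q = f7 (b7 q).
Proof.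
  apply (mult_rigid 7 (fun q => f7 (b7 q)) 200); [lia| |].
  - intros x Hx. pose proof (modular_equation_7 x ltac:(lra)) as HD.
    pose proof (a7_pos x ltac:(lra)). pose proof (a7_approx x Hx) as Ha.
    pose proof (b7_pos x ltac:(lra)) as Hb.
    apply Rabs_le_between in Ha.
    unfold f7. replace (b7 x) with (1 - a7 x) by lra. set (d := a7 x) in *.
    assert (Hd : 0 < d <= 3 * x) by nra. assert (Hd1 : d <= 3 / 100) by lra.
    clear Ha HD Hb H.
    match goal with |- context [sqrt ?X] => set (w := sqrt X);
      assert (Hw : w ^ 2 = X) end.
    { apply pow2_sqrt. apply Rmult_le_pos; nra. }
    assert (Hw0 : 0 <= w) by apply sqrt_pos.
    assert (E : w ^ 2 - 4 = d * (-12 + d * (25 + d * (-30 + d * (25 + d * (-12 + 4 * d)))))).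
    { rewrite Hw. ring. }
    apply Rabs_le. assert (-(20 * d) <= w ^ 2 - 4 <= 20 * d).
    { rewrite E. set (h := -12 + d * (25 + d * (-30 + d * (25 + d * (-12 + 4 * d))))).
      assert (-20 <= h <= 20) by (unfold h; split; nra). split; nra. }
    assert (-(10 * d) <= w - 2 <= 10 * d) by (split; nra).
    split; nra.
  - intros x Hx. assert (Hx7 : 0 < x ^ 7 < 1) by (apply pow_unit_interval; [easy|lia]).
    pose proof (b7_pos x Hx) as Hb.
    pose proof (modular_equation_7 x Hx) as HD. pose proof (a7_pos x Hx).
    destruct (degree7_param x Hx) as [E1 E2].
    set (b := b7 x) in *. set (t := sqrt b) in *. set (z := sqrt (2 - 3 * b + 2 * b ^ 2)) in *.
    set (g := sqrt (2 - 3 * b + 6 * b ^ 2 - 3 * b ^ 3 + 2 * b ^ 4)) in *.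
    assert (HP : 0 < 2 - 3 * b + 2 * b ^ 2) by nra.
    assert (HQ : 0 < 2 - 3 * b + 6 * b ^ 2 - 3 * b ^ 3 + 2 * b ^ 4).
    { assert (0 <= b ^ 2 * (4 - 3 * b)) by (apply Rmult_le_pos; nra).
      assert (0 <= b ^ 4) by (apply pow_le; lra). nra. }
    assert (Hz : z ^ 2 = 2 - 3 * b + 2 * b ^ 2) by (apply pow2_sqrt; lra).
    assert (Hg : g ^ 2 = 2 - 3 * b + 6 * b ^ 2 - 3 * b ^ 3 + 2 * b ^ 4) by (apply pow2_sqrt; lra).
    assert (Ht : t ^ 2 = b) by (apply pow2_sqrt; lra).
    assert (Hz0 : 0 < z) by (now apply sqrt_lt_R0). assert (Ht0 : 0 < t) by (now apply sqrt_lt_R0).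
    assert (Hg0 : 0 < g) by (now apply sqrt_lt_R0).
    rewrite (b7_sq x (t + z)); [|easy|lra|].
    2:{ rewrite E1, E2.
        replace ((1 + ((1 - b + b ^ 2) * t * z - (1 - b) * t * g)) * (1 + ((1 - b + b ^ 2) * t * z + (1 - b) * t * g)))
          with (1 + 2 * (1 - b + b ^ 2) * (t * z) + t ^ 2 * ((1 - b + b ^ 2) ^ 2 * z ^ 2 - (1 - b) ^ 2 * g ^ 2)) by ring.
        replace ((t + z) ^ 4) with ((t ^ 2 + z ^ 2) ^ 2 + 4 * (t ^ 2 + z ^ 2) * (t * z) + 4 * (t ^ 2 * z ^ 2)) by ring.
        rewrite Hz, Ht, Hg. ring. }
    fold b. fold t. unfold f7 at 1.
    set (b2 := 2 * t / (t + z)).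
    (* The square comes from z^2 + 7t^2 = 2(1 + b)^2 and z^4 + 3t^2 z^2 + 4t^4 = 2g^2. *)
    replace ((2 - 3 * b2 + 2 * b2 ^ 2) * (2 - 3 * b2 + 6 * b2 ^ 2 - 3 * b2 ^ 3 + 2 * b2 ^ 4))
      with ((4 * g * (1 + b) / (t + z) ^ 3) ^ 2).
    2:{ apply Rmult_eq_reg_r with ((t + z) ^ 6); [|apply pow_nonzero; lra].
        transitivity (16 * g ^ 2 * (1 + b) ^ 2); [field; lra|].
        transitivity (4 * (z ^ 4 + 3 * t ^ 2 * z ^ 2 + 4 * t ^ 4) * (z ^ 2 + 7 * t ^ 2)).
        - replace (z ^ 4) with ((z ^ 2) ^ 2) by ring. replace (t ^ 4) with ((t ^ 2) ^ 2) by ring.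
          rewrite Hz, Ht, Hg. ring.
        - unfold b2. field. lra. }
    rewrite sqrt_pow2.
    2:{ apply Rmult_le_pos; [|left; apply Rinv_0_lt_compat, pow_lt; lra].
        apply Rmult_le_pos; lra. }
    unfold f7. rewrite sqrt_mult by lra. fold z. fold g. rewrite E1, E2.
    apply Rmult_eq_reg_r with ((t + z) ^ 3); [|apply pow_nonzero; lra].
    unfold b2.
    transitivity (((z - 3 * t) * (3 * (t + z) ^ 2 - 4 * t * (t + z) + 8 * t ^ 2) + 8 * g * (1 + b))
      * (1 + ((1 - b + b ^ 2) * t * z + (1 - b) * t * g))); [field; lra|].
    clear - Hz Ht Hg. clearbody t z g. clearbody b. subst b.
    assert (z5 : z ^ 5 = z * (2 - 3 * t ^ 2 + 2 * (t ^ 2) ^ 2) ^ 2) by (rewrite <- Hz; ring).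
    assert (z4 : z ^ 4 = (2 - 3 * t ^ 2 + 2 * (t ^ 2) ^ 2) ^ 2) by (rewrite <- Hz; ring).
    assert (z3 : z ^ 3 = z * (2 - 3 * t ^ 2 + 2 * (t ^ 2) ^ 2)) by (rewrite <- Hz; ring).
    apply Rminus_diag_uniq. ring_simplify. rewrite ?z5, ?z4, ?z3, ?Hz, ?Hg. ring.
Qed.

(** * Polya's proof of the theta transformation *)

Lemma sum_n_to_series_split (a : nat -> R) K : ex_series a ->
  Series a = sum_n a K + Series (fun k => a (S K + k)%nat).
Proof.
  intros H. rewrite (Series_incr_n a (S K)) by (lia || easy).
  now rewrite <- sum_n_Reals.
Qed.

Lemma sum_n_lim (a : nat -> nat -> R) (b : nat -> R) K :
  (forall k, is_lim_seq (fun n => a n k) (b k)) ->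
  is_lim_seq (fun n => sum_n (a n) K) (sum_n b K).
Proof.
  intros H. induction K as [|K IH].
  - apply is_lim_seq_ext with (fun n => a n 0%nat); [intros; now rewrite sum_O|].
    rewrite sum_O; apply H.
  - apply is_lim_seq_ext with (fun n => sum_n (a n) K + a n (S K)); [intros; now rewrite sum_Sn|].
    rewrite sum_Sn. apply is_lim_seq_plus'; [exact IH|apply H].
Qed.

(** Tannery's theorem: the tails of all series are bounded by one tail of [M], and finitely many
    terms remain. *)
Lemma Series_dominated_lim (a : nat -> nat -> R) (b M : nat -> R) (n0 : nat) :
  ex_series M -> (forall n k, (n0 <= n)%nat -> Rabs (a n k) <= M k) ->
  (forall k, is_lim_seq (fun n => a n k) (b k)) ->
  is_lim_seq (fun n => Series (a n)) (Series b).
Proof.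
  intros HM Ha Hb.
  assert (HbM : forall k, Rabs (b k) <= M k).
  { intros k. change (Rbar_le (Rabs (b k)) (M k)).
    apply (is_lim_seq_le_loc (fun n => Rabs (a n k)) (fun _ => M k)).
    - exists n0; intros n Hn; now apply Ha.
    - apply (is_lim_seq_abs _ (b k)). apply Hb.
    - apply is_lim_seq_const. }
  assert (Hexb : ex_series b) by (apply (ex_series_le (V := R_CompleteNormedModule)) with M; easy).
  assert (Hexa : forall n, (n0 <= n)%nat -> ex_series (a n)).
  { intros n Hn. apply (ex_series_le (V := R_CompleteNormedModule)) with M; [|easy].
    intros k; now apply Ha. }
  assert (Htail : forall (c : nat -> R) K, (forall k, Rabs (c k) <= M k) ->
    Rabs (Series (fun k => c (S K + k)%nat)) <= Series (fun k => M (S K + k)%nat)).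
  { intros c K Hc.
    assert (HMK : ex_series (fun k => M (S K + k)%nat)) by (now apply ex_series_incr_n).
    apply Rle_trans with (Series (fun k => Rabs (c (S K + k)%nat))).
    - apply Series_Rabs. apply (ex_series_le (V := R_CompleteNormedModule)) with (fun k => M (S K + k)%nat); [|easy].
      intros k. unfold norm; simpl. rewrite Rabs_Rabsolu. apply Hc.
    - apply Series_le; [|easy]. intros k; split; [apply Rabs_pos|apply Hc]. }
  apply is_lim_seq_spec. intros eps.
  assert (HK : exists K, Series (fun k => M (S K + k)%nat) < eps / 4).
  { assert (HS : is_lim_seq (sum_n M) (Series M)) by exact (Series_correct M HM).
    apply is_lim_seq_spec in HS.
    destruct (HS (mkposreal (eps / 4) ltac:(destruct eps; simpl; lra))) as [K HK].
    exists K. specialize (HK K (Nat.le_refl _)). simpl in HK.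
    rewrite (sum_n_to_series_split M K HM) in HK. apply Rabs_def2 in HK.
    change (Series (fun k : nat => M (S K + k)%nat)) with (Series (fun k : nat => M (S (K + k)))) in *.
    lra. }
  destruct HK as [K HK].
  pose proof (sum_n_lim a b K Hb) as HL. apply is_lim_seq_spec in HL.
  destruct (HL (mkposreal (eps / 4) ltac:(destruct eps; simpl; lra))) as [N HN].
  exists (Nat.max N n0). intros n Hn.
  specialize (HN n ltac:(lia)); simpl in HN.
  rewrite (sum_n_to_series_split (a n) K) by (apply Hexa; lia).
  rewrite (sum_n_to_series_split b K) by easy.
  pose proof (Htail (a n) K (fun k => Ha n k ltac:(lia))) as T1.
  pose proof (Htail b K HbM) as T2.
  destruct eps as [eps He]; simpl in *.
  apply Rabs_def2 in HN. apply Rabs_le_between in T1, T2. apply Rabs_def1; lra.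
Qed.

(* [walk m j] is the central binomial weight C(2m, m+j) / 4^m, defined through
   the two-step random walk so that no binomial coefficients are needed. *)
Fixpoint walk (m : nat) (j : Z) : R :=
  match m with
  | O => if Z.eq_dec j 0 then 1 else 0
  | S m => walk m j / 2 + (walk m (j + 1) + walk m (j - 1)) / 4
  end.

Lemma walk_ge0 m j : 0 <= walk m j.
Proof.
  revert j; induction m as [|m IH]; intros j; simpl; [destruct (Z.eq_dec j 0); lra|].
  pose proof (IH j); pose proof (IH (j + 1)%Z); pose proof (IH (j - 1)%Z); lra.
Qed.

Lemma walk_0_pos m : 0 < walk m 0.
Proof.
  induction m as [|m IH]; [simpl; lra|]. cbn [walk].
  pose proof (walk_ge0 m (0 + 1)); pose proof (walk_ge0 m (0 - 1)); lra.
Qed.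

Lemma walk_opp m j : walk m (- j) = walk m j.
Proof.
  revert j; induction m as [|m IH]; intros j; cbn [walk].
  - destruct (Z.eq_dec (- j) 0), (Z.eq_dec j 0); lia || easy.
  - rewrite <- (IH (j + 1)%Z), <- (IH (j - 1)%Z), IH.
    replace (- (j + 1))%Z with (- j - 1)%Z by lia.
    replace (- (j - 1))%Z with (- j + 1)%Z by lia. lra.
Qed.

Lemma walk_out m j : (Z.of_nat m < Z.abs j)%Z -> walk m j = 0.
Proof.
  revert j; induction m as [|m IH]; intros j Hj; cbn [walk].
  - destruct (Z.eq_dec j 0); [lia|easy].
  - rewrite !IH by lia. lra.
Qed.

(** This is the quotient of neighbouring binomial coefficients in a row, cross-multiplied so that it
    also holds outside the support and can be proved from the recurrence for every integer [j]. *)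
Lemma walk_ratio m j : walk m (j + 1) * (INR m + IZR j + 1) = walk m j * (INR m - IZR j).
Proof.
  revert j; induction m as [|m IH]; intros j.
  - cbn [walk]. destruct (Z.eq_dec (j + 1) 0) as [H|H], (Z.eq_dec j 0) as [H'|H']; simpl INR.
    + lia.
    + replace j with (-1)%Z by lia. lra.
    + subst j. lra.
    + ring.
  - cbn [walk]. rewrite S_INR.
    pose proof (IH j) as H0. pose proof (IH (j + 1)%Z) as H1. pose proof (IH (j - 1)%Z) as H2.
    rewrite plus_IZR in H1. rewrite minus_IZR in H2.
    replace (j - 1 + 1)%Z with j in H2 by lia. replace (j + 1 - 1)%Z with j by lia.
    set (x := INR m) in *; set (y := IZR j) in *.
    set (B0 := walk m j) in *; set (B1 := walk m (j + 1)) in *.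
    set (B2 := walk m (j + 1 + 1)) in *; set (Bm := walk m (j - 1)) in *.
    assert (E2 : B2 * (x + y + 2) = B1 * (x - (y + 1))) by lra.
    assert (Em : Bm * (x + 1 - y) = B0 * (x + y)) by lra.
    replace ((B1 / 2 + (B2 + B0) / 4) * (x + 1 + y + 1))
      with (B1 / 2 * (x + y + 2) + (B2 * (x + y + 2)) / 4 + B0 / 4 * (x + y + 2)) by field.
    replace ((B0 / 2 + (B1 + Bm) / 4) * (x + 1 - y))
      with (B0 / 2 * (x + 1 - y) + B1 / 4 * (x + 1 - y) + (Bm * (x + 1 - y)) / 4) by field.
    rewrite E2, Em. lra.
Qed.

Lemma walk_step m i : (i < m)%nat ->
  walk m (Z.of_nat (S i)) = walk m (Z.of_nat i) * ((INR m - INR i) / (INR m + INR i + 1)).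
Proof.
  intros Hi. pose proof (walk_ratio m (Z.of_nat i)) as H.
  rewrite <- INR_IZR_INZ in H. replace (Z.of_nat i + 1)%Z with (Z.of_nat (S i)) in H by lia.
  pose proof (pos_INR m); pose proof (pos_INR i).
  apply Rmult_eq_reg_r with (INR m + INR i + 1); [|lra]. rewrite H. field. lra.
Qed.

(** Each step ratio is 1 - (2i + 1)/(m + i + 1), at most exp(-(2i + 1)/(m + J)), and the odd numbers
    below 2J add up to J^2. *)
Lemma walk_upper m J : (J <= m)%nat ->
  walk m (Z.of_nat J) <= walk m 0 * exp (- (INR J ^ 2 / (INR m + INR J))).
Proof.
  intros HJ. destruct (Nat.eq_dec J 0) as [->|HJ0].
  { simpl. replace (0 * (0 * 1) / (INR m + 0)) with 0 by (unfold Rdiv; ring).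
    rewrite Ropp_0, exp_0. lra. }
  assert (HJ1 : 0 < INR J) by (apply lt_0_INR; lia). pose proof (pos_INR m) as Hm0.
  assert (H : forall i, (i <= J)%nat ->
    walk m (Z.of_nat i) <= walk m 0 * exp (- (INR i ^ 2 / (INR m + INR J)))).
  { induction i as [|i IH]; intros Hi.
    - simpl. replace (0 * (0 * 1) / (INR m + INR J)) with 0 by (unfold Rdiv; ring).
      rewrite Ropp_0, exp_0. lra.
    - rewrite walk_step by lia. rewrite S_INR.
      pose proof (pos_INR i). specialize (IH ltac:(lia)).
      assert (HiJ : INR i + 1 <= INR J) by (rewrite <- S_INR; apply le_INR; lia).
      assert (HJm : INR J <= INR m) by (apply le_INR; lia).
      assert (Hf : (INR m - INR i) / (INR m + INR i + 1)
        <= exp (- ((2 * INR i + 1) / (INR m + INR J)))).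
      { apply Rle_trans with (2 := exp_ineq1_le _).
        apply Rle_trans with (1 + - ((2 * INR i + 1) / (INR m + INR i + 1))).
        - right; field; lra.
        - apply Rplus_le_compat_l, Ropp_le_contravar. apply Rmult_le_compat_l; [lra|].
          apply Rinv_le_contravar; lra. }
      replace (- ((INR i + 1) ^ 2 / (INR m + INR J)))
        with (- (INR i ^ 2 / (INR m + INR J)) + - ((2 * INR i + 1) / (INR m + INR J))) by (field; lra).
      rewrite exp_plus, <- Rmult_assoc. apply Rmult_le_compat; try easy; [apply walk_ge0|].
      apply Rmult_le_pos; [lra|left; apply Rinv_0_lt_compat; lra]. }
  now apply H.
Qed.

(** The inverse step ratio is 1 + (2i + 1)/(m - i), at most exp((2i + 1)/(m - J)); the odd numbers
    again add up to J^2. *)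
Lemma walk_lower m J : (J < m)%nat ->
  walk m 0 * exp (- (INR J ^ 2 / (INR m - INR J))) <= walk m (Z.of_nat J).
Proof.
  intros HJ. assert (HJm : INR J < INR m) by now apply lt_INR.
  assert (H : forall i, (i <= J)%nat ->
    walk m 0 * exp (- (INR i ^ 2 / (INR m - INR J))) <= walk m (Z.of_nat i)).
  { induction i as [|i IH]; intros Hi.
    - simpl. replace (0 * (0 * 1) / (INR m - INR J)) with 0 by (unfold Rdiv; ring).
      rewrite Ropp_0, exp_0. lra.
    - rewrite walk_step by lia. rewrite S_INR.
      pose proof (pos_INR i). specialize (IH ltac:(lia)).
      assert (HiJ : INR i + 1 <= INR J) by (rewrite <- S_INR; apply le_INR; lia).
      assert (Hf : exp (- ((2 * INR i + 1) / (INR m - INR J)))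
        <= (INR m - INR i) / (INR m + INR i + 1)).
      { rewrite exp_Ropp. replace ((INR m - INR i) / (INR m + INR i + 1))
          with (/ ((INR m + INR i + 1) / (INR m - INR i))) by (field; lra).
        apply Rinv_le_contravar.
        - apply Rdiv_lt_0_compat; lra.
        - apply Rle_trans with (2 := exp_ineq1_le _).
          apply Rle_trans with (1 + (2 * INR i + 1) / (INR m - INR i)).
          + right; field; lra.
          + apply Rplus_le_compat_l. apply Rmult_le_compat_l; [lra|].
            apply Rinv_le_contravar; lra. }
      replace (- ((INR i + 1) ^ 2 / (INR m - INR J)))
        with (- (INR i ^ 2 / (INR m - INR J)) + - ((2 * INR i + 1) / (INR m - INR J))) by (field; lra).
      rewrite exp_plus, <- Rmult_assoc. apply Rmult_le_compat; try easy.
      + apply Rmult_le_pos; [apply walk_ge0|left; apply exp_pos].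
      + left; apply exp_pos. }
  now apply H.
Qed.

(** The Fourier side of Poisson summation modulo [S l]: cos^(2m) y is the sum over j of [walk m j]
    times cos(2jy), sampled at the points y = pi v/(l + 1). *)
Definition walk_dual (l m : nat) (x : Z) : R :=
  sum_n (fun v => cos (PI * INR v / INR (S l)) ^ (2 * m) * cos (2 * IZR x * (PI * INR v / INR (S l)))) l.

(** The recurrence of [walk], because multiplication by cos^2 y = 1/2 + cos(2y)/2 averages a cosine
    with its two shifts. *)
Lemma walk_dual_step l m x :
  walk_dual l (S m) x = walk_dual l m x / 2 + (walk_dual l m (x + 1) + walk_dual l m (x - 1)) / 4.
Proof.
  unfold walk_dual.
  assert (E : forall a b c : nat -> R, sum_n a l / 2 + (sum_n b l + sum_n c l) / 4
    = sum_n (fun v => a v / 2 + (b v + c v) / 4) l).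
  { intros a b c. induction l as [|k IH]; [now rewrite !sum_O|].
    rewrite !sum_Sn, <- IH. unfold plus; simpl. field. }
  rewrite E. apply sum_n_ext. intros v. set (y := PI * INR v / INR (S l)).
  replace (2 * S m)%nat with (2 * m + 2)%nat by lia. rewrite pow_add.
  rewrite plus_IZR, minus_IZR.
  replace (2 * (IZR x + 1) * y) with (2 * IZR x * y + 2 * y) by ring.
  replace (2 * (IZR x - 1) * y) with (2 * IZR x * y - 2 * y) by ring.
  rewrite cos_plus, cos_minus, cos_2a.
  pose proof (sin2_cos2 y) as Hs. unfold Rsqr in Hs.
  replace (sin y * sin y) with (1 - cos y * cos y) by lra.
  match goal with |- ?a = ?b => change (@eq R a b) end. field.
Qed.

Lemma sum_cos_arith (th : R) l :
  2 * sin (th / 2) * sum_n (fun v => cos (INR v * th)) l = sin (INR (S l) * th - th / 2) + sin (th / 2).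
Proof.
  induction l as [|l IH].
  - rewrite sum_O. simpl INR. replace (0 * th) with 0 by ring. rewrite cos_0.
    replace (1 * th - th / 2) with (th / 2) by field. ring.
  - rewrite sum_Sn. change plus with Rplus. rewrite Rmult_plus_distr_l, IH.
    rewrite !S_INR.
    replace ((INR l + 1 + 1) * th - th / 2) with ((INR l + 1) * th + th / 2) by field.
    replace ((INR l + 1) * th - th / 2) with ((INR l + 1) * th - th / 2) by ring.
    rewrite sin_plus, sin_minus. ring.
Qed.

(** Orthogonality of characters modulo [S l]: if x is not a multiple, sin(th/2) is nonzero and the
    closed form of the cosine sum gives 0. *)
Lemma walk_dual_0 l x :
  walk_dual l 0 x = if Z.eq_dec (x mod Z.of_nat (S l)) 0 then INR (S l) else 0.
Proof.
  assert (Hl : 0 < INR (S l)) by (apply lt_0_INR; lia).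
  unfold walk_dual.
  rewrite (sum_n_ext _ (fun v => cos (INR v * (2 * IZR x * PI / INR (S l))))).
  2:{ intros v. simpl (_ ^ (2 * 0)). rewrite Rmult_1_l. f_equal. field. lra. }
  destruct (Z.eq_dec (x mod Z.of_nat (S l)) 0) as [H|H].
  - apply Z_div_exact_full_2 in H; [|lia]. set (k := (x / Z.of_nat (S l))%Z) in *.
    rewrite (sum_n_ext _ (fun _ => 1)).
    + rewrite sum_n_const. ring.
    + intros v. rewrite H, mult_IZR, <- INR_IZR_INZ.
      replace (INR v * (2 * (INR (S l) * IZR k) * PI / INR (S l)))
        with (2 * (IZR (Z.of_nat v * k) * PI)) by (rewrite mult_IZR, <- INR_IZR_INZ; field; lra).
      rewrite cos_2a_sin, sin_eq_0_1 by now eexists.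
      match goal with |- ?a = ?b => change (@eq R a b) end. ring.
  - set (th := 2 * IZR x * PI / INR (S l)).
    pose proof (sum_cos_arith th l) as E.
    replace (INR (S l) * th - th / 2) with (2 * (IZR x * PI) - th / 2) in E by (unfold th; field; lra).
    rewrite sin_minus, sin_2a, cos_2a_sin, (sin_eq_0_1 (IZR x * PI)) in E by now eexists.
    assert (Hs : sin (th / 2) <> 0).
    { intros H0. apply sin_eq_0_0 in H0. destruct H0 as [k Hk]. apply H.
      assert (E2 : IZR x = IZR (k * Z.of_nat (S l))).
      { rewrite mult_IZR, <- INR_IZR_INZ. pose proof PI_RGT_0.
        apply Rmult_eq_reg_r with PI; [|lra].
        replace (IZR k * INR (S l) * PI) with (INR (S l) * (IZR k * PI)) by ring.
        rewrite <- Hk. unfold th. field. lra. }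
      apply eq_IZR in E2. rewrite E2. apply Z_mod_mult. }
    apply Rmult_eq_reg_l with (2 * sin (th / 2)); [|lra]. rewrite E. ring.
Qed.

(** Both sides obey one recurrence in [m] and agree at m = 0 by orthogonality. The hypothesis makes
    [zrange N] cover every lattice point in the support, and it survives the shifts of [x] by 1 when
    [m] drops. *)
Lemma walk_poisson l N m x : (Z.abs x + Z.of_nat m <= Z.of_nat N * Z.of_nat (S l))%Z ->
  INR (S l) * lsum (fun j => walk m (x + j * Z.of_nat (S l))) (zrange N) = walk_dual l m x.
Proof.
  revert x; induction m as [|m IH]; intros x Hx.
  - rewrite walk_dual_0. set (L := Z.of_nat (S l)) in *. assert (HL : (0 < L)%Z) by (unfold L; lia).
    destruct (Z.eq_dec (x mod L) 0) as [H|H].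
    + apply Z_div_exact_full_2 in H; [|lia]. set (k := (x / L)%Z) in *.
      assert (Hk : In (- k)%Z (zrange N)) by (apply In_zrange; nia).
      destruct (in_split _ _ Hk) as (l1 & l2 & E). rewrite E, lsum_app.
      assert (Hn : NoDup (l1 ++ (- k)%Z :: l2)) by (rewrite <- E; apply NoDup_zrange).
      apply NoDup_remove_2 in Hn. rewrite in_app_iff in Hn.
      assert (Z0 : forall l', ~ In (- k)%Z l' -> lsum (fun j => walk 0 (x + j * L)) l' = 0).
      { induction l' as [|y l' IHl]; intros Hy; [easy|]. simpl in Hy. cbn [lsum fold_right].
        fold (lsum (fun j => walk 0 (x + j * L)) l'). rewrite IHl by tauto.
        cbn [walk]. destruct (Z.eq_dec (x + y * L) 0) as [H0|H0]; [|ring].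
        exfalso; apply Hy; left. nia. }
      cbn [lsum fold_right]. fold (lsum (fun j => walk 0 (x + j * L)) l2).
      rewrite !Z0 by tauto. cbn [walk].
      destruct (Z.eq_dec (x + - k * L) 0) as [_|H0]; [ring|exfalso; nia].
    + assert (Z0 : forall l', lsum (fun j => walk 0 (x + j * L)) l' = 0).
      { induction l' as [|y l' IHl]; [easy|]. cbn [lsum fold_right].
        fold (lsum (fun j => walk 0 (x + j * L)) l'). rewrite IHl. cbn [walk].
        destruct (Z.eq_dec (x + y * L) 0) as [H0|H0]; [|ring].
        exfalso; apply H. replace x with ((- y) * L)%Z by lia. apply Z_mod_mult. }
      rewrite Z0. ring.
  - rewrite walk_dual_step, <- !IH by lia. cbn [walk].
    set (L := Z.of_nat (S l)).
    assert (E : forall l', lsum (fun j => walk m (x + j * L) / 2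
        + (walk m (x + j * L + 1) + walk m (x + j * L - 1)) / 4) l'
      = lsum (fun j => walk m (x + j * L)) l' / 2
        + (lsum (fun j => walk m (x + 1 + j * L)) l' + lsum (fun j => walk m (x - 1 + j * L)) l') / 4).
    { induction l' as [|y l' IHl]; unfold lsum in *; cbn [fold_right]; [lra|].
      rewrite IHl.
      replace (x + 1 + y * L)%Z with (x + y * L + 1)%Z by lia.
      replace (x - 1 + y * L)%Z with (x + y * L - 1)%Z by lia. field. }
    rewrite E. field.
Qed.

Lemma Series_finite (a : nat -> R) N : (forall n, (N < n)%nat -> a n = 0) -> Series a = sum_n a N.
Proof.
  intros H. apply is_series_unique. change (is_lim_seq (sum_n a) (sum_n a N)).
  apply is_lim_seq_ext_loc with (fun _ => sum_n a N); [|apply is_lim_seq_const].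
  exists N. intros n Hn. induction Hn as [|n Hn IH]; [easy|].
  rewrite sum_Sn, <- IH, H by lia. unfold plus; simpl.
  symmetry; apply Rplus_0_r.
Qed.

Lemma sum_n_shift (a : nat -> R) N : sum_n a (S N) = a 0%nat + sum_n (fun n => a (S n)) N.
Proof.
  induction N as [|N IH]; [now rewrite sum_Sn, !sum_O|].
  rewrite sum_Sn, IH, (sum_Sn (fun n => a (S n))). unfold plus; simpl. ring.
Qed.

Lemma walk_lattice_sum l m :
  walk_dual l m 0 = INR (S l) * (walk m 0 + 2 * Series (fun j => walk m (Z.of_nat ((j + 1) * S l)))).
Proof.
  rewrite <- (walk_poisson l (S m) m 0) by nia.
  f_equal. rewrite lsum_zrange.
  rewrite (Series_finite _ m).
  2:{ intros n Hn. apply walk_out. nia. }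
  rewrite sum_n_shift.
  rewrite (sum_n_ext (fun n => walk m (0 + Z.of_nat (S n) * Z.of_nat (S l)))
    (fun j => walk m (Z.of_nat ((j + 1) * S l)))).
  2:{ intros n; f_equal; lia. }
  rewrite (sum_n_ext (fun n => walk m (0 + - Z.of_nat (S n) * Z.of_nat (S l)))
    (fun j => walk m (Z.of_nat ((j + 1) * S l)))).
  2:{ intros n. rewrite <- walk_opp. f_equal. lia. }
  replace (0 + Z.of_nat 0 * Z.of_nat (S l))%Z with 0%Z by lia. ring.
Qed.

(* The indices v and 2L - v contribute equally, and v = L contributes 0. *)
Lemma walk_dual_half L m : (0 < L)%nat -> (0 < m)%nat ->
  walk_dual (2 * L - 1) m 0 =
  1 + 2 * Series (fun v => if lt_dec (v + 1) L then cos (PI * INR (v + 1) / INR (2 * L)) ^ (2 * m) else 0).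
Proof.
  intros HL Hm. unfold walk_dual. replace (S (2 * L - 1)) with (2 * L)%nat by lia.
  assert (H2L : 0 < INR (2 * L)) by (apply lt_0_INR; lia).
  set (c := fun v => cos (PI * INR v / INR (2 * L)) ^ (2 * m)).
  rewrite (sum_n_ext _ c).
  2:{ intros v. unfold c. replace (2 * 0 * _) with 0 by ring. now rewrite cos_0, Rmult_1_r. }
  assert (Hc0 : c 0%nat = 1).
  { unfold c. change (INR 0) with 0. replace (PI * 0 / INR (2 * L)) with 0 by (unfold Rdiv; ring).
    rewrite cos_0; apply pow1. }
  assert (HcL : c L = 0).
  { unfold c. rewrite mult_INR. change (INR 2) with 2. assert (0 < INR L) by (apply lt_0_INR; lia).
    replace (PI * INR L / (2 * INR L)) with (PI / 2) by (field; lra).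
    rewrite cos_PI2. apply pow_i. lia. }
  assert (Hsym : forall v, (v <= 2 * L)%nat -> c (2 * L - v)%nat = c v).
  { intros v Hv. unfold c. rewrite minus_INR by lia.
    replace (PI * (INR (2 * L) - INR v) / INR (2 * L)) with (PI - PI * INR v / INR (2 * L)) by (field; lra).
    rewrite Rtrigo_facts.cos_pi_minus, !pow_mult.
    now rewrite <- !Rsqr_pow2, <- Rsqr_neg. }
  set (a := fun v => if lt_dec (v + 1) L then c (v + 1)%nat else 0).
  change (sum_n c (2 * L - 1) = 1 + 2 * Series a).
  rewrite (Series_finite a L).
  2:{ intros n Hn. unfold a. destruct (lt_dec (n + 1) L); [lia|easy]. }
  assert (Ha : forall K, (K < L)%nat -> sum_n c K = 1 + sum_n a K - a K :> R).
  { induction K as [|K IH]; intros HK.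
    - rewrite !sum_O, Hc0. ring.
    - rewrite sum_Sn, IH by lia. rewrite sum_Sn. unfold plus; simpl.
      replace (c (S K)) with (a K); [ring|]. unfold a.
      destruct (lt_dec (K + 1) L); [f_equal; lia|lia]. }
  assert (Haz : forall K, (L - 1 <= K)%nat -> sum_n a K = sum_n a (L - 1) :> R).
  { intros K HK. induction HK as [|K HK IH]; [easy|]. rewrite sum_Sn, IH.
    replace (a (S K)) with 0; [unfold plus; simpl; ring|].
    unfold a. destruct (lt_dec (S K + 1) L); [lia|easy]. }
  rewrite Haz by lia.
  assert (HaL : a (L - 1)%nat = 0) by (unfold a; destruct (lt_dec (L - 1 + 1) L); [lia|easy]).
  assert (Hb : forall K, (K < L)%nat -> sum_n c (L + K) = sum_n c L + sum_n c (L - 1) - sum_n c (L - 1 - K) :> R).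
  { induction K as [|K IH]; intros HK.
    - rewrite Nat.add_0_r, Nat.sub_0_r. lra.
    - rewrite Nat.add_succ_r, sum_Sn, IH by lia. unfold plus; simpl.
      replace (L - 1 - K)%nat with (S (L - 1 - S K))%nat by lia.
      rewrite (sum_Sn c (L - 1 - S K)). unfold plus; simpl.
      replace (c (S (L + K))) with (c (S (L - 1 - S K))); [ring|].
      rewrite <- Hsym by lia. f_equal. lia. }
  replace (2 * L - 1)%nat with (L + (L - 1))%nat by lia. rewrite Hb by lia.
  replace (L - 1 - (L - 1))%nat with 0%nat by lia. rewrite sum_O, Hc0.
  assert (HS : sum_n c L = sum_n c (L - 1) :> R).
  { destruct L as [|k]; [lia|]. rewrite sum_Sn, HcL. unfold plus; simpl. rewrite Nat.sub_0_r. lra. }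
  rewrite HS, Ha by lia. rewrite HaL. lra.
Qed.

Lemma exp_pow_nat y n : exp y ^ n = exp (INR n * y).
Proof.
  induction n as [|n IH]; [simpl; rewrite Rmult_0_l, exp_0; easy|].
  rewrite S_INR. simpl. rewrite IH, <- exp_plus. f_equal. ring.
Qed.

Lemma exp_le x y : x <= y -> exp x <= exp y.
Proof. intros [H|<-]; [left; now apply exp_increasing|apply Rle_refl]. Qed.

Lemma is_lim_seq_exp (u : nat -> R) (l : R) :
  is_lim_seq u l -> is_lim_seq (fun n => exp (u n)) (exp l).
Proof. apply is_lim_seq_continuous. apply derivable_continuous_pt, derivable_pt_exp. Qed.

Lemma is_lim_seq_opp' (u : nat -> R) (l : R) :
  is_lim_seq u l -> is_lim_seq (fun n => - u n) (- l).
Proof. intros H; apply (is_lim_seq_opp u l) in H; exact H. Qed.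

Lemma pow_one_minus_bounds s m : 0 <= s < 1 ->
  exp (- (INR m * s / (1 - s))) <= (1 - s) ^ m <= exp (- (INR m * s)).
Proof.
  intros Hs. split.
  - replace (- (INR m * s / (1 - s))) with (INR m * (- (s / (1 - s)))) by (field; lra).
    rewrite <- exp_pow_nat. apply pow_incr. split; [left; apply exp_pos|].
    rewrite exp_Ropp. rewrite <- (Rinv_inv (1 - s)). apply Rinv_le_contravar.
    + apply Rinv_0_lt_compat; lra.
    + apply Rle_trans with (2 := exp_ineq1_le _). right; field; lra.
  - replace (- (INR m * s)) with (INR m * (- s)) by ring.
    rewrite <- exp_pow_nat. apply pow_incr. split; [lra|].
    apply Rle_trans with (2 := exp_ineq1_le _). lra.
Qed.

Lemma sin_lower y : 0 <= y <= 4 -> y - y ^ 3 / 6 <= sin y.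
Proof.
  intros Hy. destruct (pre_sin_bound y 0 ltac:(lra) ltac:(lra)) as [H _].
  apply Rle_trans with (2 := H). unfold sin_approx, sin_term. simpl. right. field.
Qed.

Lemma exp_neg_bounds x : 0 < x -> 0 < exp (- x) < 1.
Proof.
  intros Hx; split; [apply exp_pos|]. rewrite <- exp_0. apply exp_increasing; lra.
Qed.

(** * Polya's limit: lattice spacing 2L and walk length m with (2L)^2/m -> x *)

Section Polya.
Variables (L m : nat -> nat) (x : R).
Hypotheses (Hx : 0 < x) (HL : forall n, (0 < L n)%nat) (Hm : forall n, (0 < m n)%nat).
Let l (n : nat) : R := INR (2 * L n).
Let r (n : nat) : R := l n ^ 2 / INR (m n).
Hypotheses (HLlim : is_lim_seq l p_infty) (Hr : is_lim_seq r x).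

Let l_pos n : 0 < l n.
Proof. apply lt_0_INR. specialize (HL n); lia. Qed.

Let m_pos n : 0 < INR (m n).
Proof. apply lt_0_INR. apply Hm. Qed.

Let l_inv : is_lim_seq (fun n => / l n) 0.
Proof. apply (is_lim_seq_inv _ p_infty); easy. Qed.

Let r_eventually : exists n0, forall n, (n0 <= n)%nat -> x / 2 <= r n <= 2 * x.
Proof.
  assert (H := Hr). apply is_lim_seq_spec in H.
  destruct (H (mkposreal (x / 2) ltac:(lra))) as [n0 Hn0]. exists n0. intros n Hn.
  specialize (Hn0 n Hn). simpl in Hn0. apply Rabs_def2 in Hn0. lra.
Qed.

Let ex_series_M c : 0 < c -> ex_series (fun j => exp (- c) ^ j).
Proof.
  intros Hc. apply ex_series_geom. pose proof (exp_neg_bounds c Hc). rewrite Rabs_pos_eq; lra.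
Qed.

Lemma walk_series_lim :
  is_lim_seq (fun n => Series (fun j => walk (m n) (Z.of_nat ((j + 1) * (2 * L n))) / walk (m n) 0))
    (Series (fun j => exp (- x) ^ ((j + 1) * (j + 1)))).
Proof.
  destruct r_eventually as [n0 Hn0].
  (* On the support m + J <= 2m, so the exponent J^2/(m + J) is at least (j + 1)^2 r/2, and
     eventually r >= x/2. *)
  apply Series_dominated_lim with (M := fun j => exp (- (x / 4)) ^ j) (n0 := n0).
  - apply ex_series_M; lra.
  - intros n k Hn. specialize (Hn0 n Hn).
    set (J := ((k + 1) * (2 * L n))%nat).
    pose proof (walk_0_pos (m n)) as Hw. pose proof (walk_ge0 (m n) (Z.of_nat J)) as Hw0.
    rewrite Rabs_pos_eq by (apply Rmult_le_pos; [easy|left; now apply Rinv_0_lt_compat]).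
    destruct (le_lt_dec J (m n)) as [HJ|HJ].
    + apply Rmult_le_reg_r with (walk (m n) 0); [easy|].
      unfold Rdiv at 1. rewrite Rmult_assoc, Rinv_l, Rmult_1_r, Rmult_comm by lra.
      apply Rle_trans with (1 := walk_upper _ _ HJ). apply Rmult_le_compat_l; [lra|].
      rewrite exp_pow_nat. apply exp_le.
      assert (EJ : INR J = (INR k + 1) * l n) by (unfold J, l; rewrite mult_INR, plus_INR; reflexivity).
      pose proof (pos_INR k). pose proof (m_pos n). pose proof (l_pos n).
      assert (HJm : INR J <= INR (m n)) by (now apply le_INR).
      assert (G1 : INR J ^ 2 / (2 * INR (m n)) <= INR J ^ 2 / (INR (m n) + INR J)).
      { apply Rmult_le_compat_l; [apply pow2_ge_0|]. apply Rinv_le_contravar; [|lra].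
        pose proof (pos_INR J); lra. }
      assert (G2 : INR J ^ 2 / (2 * INR (m n)) = (INR k + 1) ^ 2 * r n / 2).
      { unfold r. rewrite EJ. field. lra. }
      assert (INR k * (x / 2) <= (INR k + 1) ^ 2 * r n).
      { apply Rmult_le_compat; nra. }
      lra.
    + rewrite walk_out by lia. unfold Rdiv. rewrite Rmult_0_l. apply pow_le. left; apply exp_pos.
  - intros k. set (K := INR k + 1). assert (HK : 0 < K) by (unfold K; pose proof (pos_INR k); lra).
    rewrite exp_pow_nat, mult_INR, plus_INR. change (INR 1) with 1. fold K.
    assert (HJm : is_lim_seq (fun n => K * r n * / l n) 0).
    { replace 0 with (K * x * 0) by ring. apply is_lim_seq_mult'; [|apply l_inv].
      apply is_lim_seq_mult'; [apply is_lim_seq_const|apply Hr]. }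
    assert (EJ : forall n, INR ((k + 1) * (2 * L n)) = K * r n * / l n * INR (m n)).
    { intros n. pose proof (m_pos n). pose proof (l_pos n).
      rewrite mult_INR, plus_INR. change (INR 1) with 1. fold K. fold (l n). unfold r. field. lra. }
    assert (Hsmall : exists n1, forall n, (n1 <= n)%nat -> K * r n * / l n < 1 /\ 0 <= K * r n * / l n).
    { assert (Hsp := HJm). apply is_lim_seq_spec in Hsp.
      destruct (Hsp (mkposreal 1 Rlt_0_1)) as [n1 Hn1].
      exists n1. intros n Hn. specialize (Hn1 n Hn). simpl in Hn1. apply Rabs_def2 in Hn1.
      split; [lra|]. apply Rmult_le_pos; [apply Rmult_le_pos; [lra|]|].
      - apply Rmult_le_pos; [apply pow2_ge_0|left; apply Rinv_0_lt_compat, m_pos].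
      - left; apply Rinv_0_lt_compat, l_pos. }
    destruct Hsmall as [n1 Hn1].
    (* With J/m = K r/l tending to 0, the two exponents J^2/(m - J) and J^2/(m + J) both tend to K^2
       x. *)
    apply is_lim_seq_le_le_loc with
      (u := fun n => exp (- (K ^ 2 * r n / (1 - K * r n * / l n))))
      (w := fun n => exp (- (K ^ 2 * r n / (1 + K * r n * / l n)))).
    + exists n1. intros n Hn. specialize (Hn1 n Hn).
      pose proof (walk_0_pos (m n)) as Hw. pose proof (m_pos n) as Hmn. pose proof (l_pos n) as Hln.
      set (J := ((k + 1) * (2 * L n))%nat) in *. specialize (EJ n). fold J in EJ.
      set (e := K * r n * / l n) in *.
      assert (HJ : (J < m n)%nat) by (apply INR_lt; rewrite EJ; nra).
      assert (E2 : INR J ^ 2 = K ^ 2 * r n * INR (m n)).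
      { rewrite EJ. unfold e, r. field. lra. }
      pose proof (walk_lower _ _ HJ) as B1. pose proof (walk_upper (m n) J ltac:(lia)) as B2.
      replace (INR J ^ 2 / (INR (m n) - INR J)) with (K ^ 2 * r n / (1 - e)) in B1
        by (rewrite E2, EJ; field; repeat split; nra).
      replace (INR J ^ 2 / (INR (m n) + INR J)) with (K ^ 2 * r n / (1 + e)) in B2
        by (rewrite E2, EJ; field; repeat split; nra).
      assert (EW : walk (m n) (Z.of_nat J) / walk (m n) 0 * walk (m n) 0 = walk (m n) (Z.of_nat J))
        by (field; lra).
      split; apply Rmult_le_reg_r with (walk (m n) 0); try easy; lra.
    + apply is_lim_seq_exp. replace (K * K * - x) with (- (K ^ 2 * x / (1 - 0))) by field.
      apply is_lim_seq_opp'. apply is_lim_seq_div'; [| |lra].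
      * apply is_lim_seq_mult'; [apply is_lim_seq_const|apply Hr].
      * apply is_lim_seq_minus'; [apply is_lim_seq_const|apply HJm].
    + apply is_lim_seq_exp. replace (K * K * - x) with (- (K ^ 2 * x / (1 + 0))) by field.
      apply is_lim_seq_opp'. apply is_lim_seq_div'; [| |lra].
      * apply is_lim_seq_mult'; [apply is_lim_seq_const|apply Hr].
      * apply is_lim_seq_plus'; [apply is_lim_seq_const|apply HJm].
Qed.

(** The power of cosine is (1 - sin^2 y)^m, close to exp(-m y^2), and at y = pi k/l the exponent m
    y^2 equals pi^2 k^2/r. *)
Lemma cos_series_lim :
  is_lim_seq (fun n => Series (fun v => if lt_dec (v + 1) (L n)
      then cos (PI * INR (v + 1) / l n) ^ (2 * m n) else 0))
    (Series (fun v => exp (- (PI ^ 2 / x)) ^ ((v + 1) * (v + 1)))).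
Proof.
  destruct r_eventually as [n0 Hn0]. pose proof PI_RGT_0 as HPI.
  assert (HPI3 : 3 < PI) by (pose proof PI2_3_2; lra).
  assert (HPI4 : PI <= 4) by apply PI_4.
  assert (Ecos : forall y k, cos y ^ (2 * k) = (1 - sin y ^ 2) ^ k).
  { intros y k. rewrite pow_mult. f_equal. rewrite <- !Rsqr_pow2. pose proof (sin2_cos2 y); lra. }
  apply Series_dominated_lim with (M := fun j => exp (- (1 / (2 * x))) ^ j) (n0 := n0).
  - apply ex_series_M. apply Rdiv_lt_0_compat; lra.
  - intros n v Hn. specialize (Hn0 n Hn).
    destruct (lt_dec (v + 1) (L n)) as [Hv|Hv].
    2:{ rewrite Rabs_R0. apply pow_le. left; apply exp_pos. }
    pose proof (l_pos n) as Hln. pose proof (m_pos n) as Hmn.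
    rewrite plus_INR. change (INR 1) with 1. set (k := INR v + 1).
    assert (Hk : 1 <= k) by (unfold k; pose proof (pos_INR v); lra).
    assert (Hkl : 2 * k < l n).
    { unfold k, l. rewrite mult_INR. change (INR 2) with 2. apply lt_INR in Hv.
      rewrite plus_INR in Hv. change (INR 1) with 1 in Hv. lra. }
    set (y := PI * k / l n).
    assert (Ey : y * l n = PI * k) by (unfold y; field; lra).
    assert (Hy : 0 < y < 2).
    { split; [unfold y; apply Rdiv_lt_0_compat; nra|]. apply Rmult_lt_reg_r with (l n); [easy|].
      rewrite Ey. nra. }
    pose proof (sin_lower y ltac:(lra)) as Hs.
    (* From y - y^3/6 and y < 2. With pi > 3 and r <= 2x it yields m sin^2 y >= k/(2x), the
       dominating exponent. *)
    assert (Hs3 : y / 3 <= sin y) by nra.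
    assert (Hs1 : 0 <= sin y ^ 2 <= 1).
    { pose proof (SIN_bound y). split; [apply pow2_ge_0|nra]. }
    assert (Hs2 : y ^ 2 / 9 <= sin y ^ 2) by nra.
    rewrite Ecos. rewrite Rabs_pos_eq by (apply pow_le; lra).
    apply Rle_trans with (exp (- (INR (m n) * sin y ^ 2))).
    { destruct (Rle_lt_or_eq_dec _ _ (proj2 Hs1)) as [Hlt|Heq]; [now apply pow_one_minus_bounds|].
      rewrite Heq, Rminus_diag, pow_i by apply Hm. left; apply exp_pos. }
    rewrite exp_pow_nat. apply exp_le.
    assert (Em : INR (m n) * y ^ 2 = PI ^ 2 * k ^ 2 / r n).
    { unfold y, r. field. lra. }
    assert (H1 : 9 * k / (2 * x) <= PI ^ 2 * k ^ 2 / r n).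
    { assert (9 <= PI ^ 2) by nra. assert (k <= k ^ 2) by nra.
      apply Rmult_le_compat; [lra|left; apply Rinv_0_lt_compat; lra| |].
      { apply Rmult_le_compat; lra. }
      apply Rinv_le_contravar; lra. }
    assert (0 < / (2 * x)) by (apply Rinv_0_lt_compat; lra).
    replace (INR v * - (1 / (2 * x))) with (- (INR v * / (2 * x))) by (field; lra).
    apply Ropp_le_contravar.
    assert (INR v * / (2 * x) <= k * / (2 * x)) by (apply Rmult_le_compat_r; unfold k; lra).
    unfold Rdiv in H1. nra.
  - intros v. rewrite exp_pow_nat, mult_INR, plus_INR. change (INR 1) with 1. set (k := INR v + 1).
    assert (Hk : 1 <= k) by (unfold k; pose proof (pos_INR v); lra).
    set (y := fun n => PI * k * / l n).
    assert (Hy0 : is_lim_seq y 0).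
    { replace 0 with (PI * k * 0) by ring. apply is_lim_seq_mult'; [apply is_lim_seq_const|apply l_inv]. }
    assert (Hypos : forall n, 0 < y n).
    { intros n. apply Rmult_lt_0_compat; [nra|apply Rinv_0_lt_compat, l_pos]. }
    assert (Hy1 : exists n1, forall n, (n1 <= n)%nat -> y n < 1).
    { assert (H := Hy0). apply is_lim_seq_spec in H. destruct (H (mkposreal 1 Rlt_0_1)) as [n1 Hn1].
      exists n1. intros n Hn. specialize (Hn1 n Hn). simpl in Hn1. apply Rabs_def2 in Hn1. lra. }
    destruct Hy1 as [n1 Hn1].
    set (E := fun n => PI ^ 2 * k ^ 2 / r n).
    assert (HE : is_lim_seq E (PI ^ 2 * k ^ 2 / x)).
    { apply is_lim_seq_div'; [apply is_lim_seq_const|apply Hr|lra]. }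
    assert (EE : forall n, INR (m n) * y n ^ 2 = E n).
    { intros n. unfold y, E, r. pose proof (l_pos n). pose proof (m_pos n). field. lra. }
    replace (k * k * - (PI ^ 2 / x)) with (- (PI ^ 2 * k ^ 2 / x)) by (field; lra).
    assert (Hy2 : is_lim_seq (fun n => y n ^ 2) 0).
    { apply is_lim_seq_ext with (fun n => y n * y n); [intros; ring|].
      replace 0 with (0 * 0) by ring. now apply is_lim_seq_mult'. }
    assert (Hlow : is_lim_seq (fun n => E n * (1 - y n ^ 2 / 6) ^ 2) (PI ^ 2 * k ^ 2 / x)).
    { apply is_lim_seq_ext with (fun n => E n * ((1 - y n ^ 2 / 6) * (1 - y n ^ 2 / 6))); [intros; ring|].
      replace (PI ^ 2 * k ^ 2 / x) with (PI ^ 2 * k ^ 2 / x * ((1 - 0 / 6) * (1 - 0 / 6))) by (field; lra).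
      apply is_lim_seq_mult'; [exact HE|].
      assert (is_lim_seq (fun n => 1 - y n ^ 2 / 6) (1 - 0 / 6)).
      { apply is_lim_seq_minus'; [apply is_lim_seq_const|].
        apply is_lim_seq_div'; [exact Hy2|apply is_lim_seq_const|lra]. }
      now apply is_lim_seq_mult'. }
    assert (Hsy : forall n, (n1 <= n)%nat -> 0 <= y n * (1 - y n ^ 2 / 6) <= sin (y n) /\ sin (y n) <= y n).
    { intros n Hn. specialize (Hn1 n Hn). pose proof (Hypos n).
      pose proof (sin_lower (y n) ltac:(lra)). pose proof (sin_lt_x (y n) ltac:(lra)).
      assert (y n ^ 2 <= 1) by nra.
      split; [split|]; [apply Rmult_le_pos; lra| |lra].
      replace (y n * (1 - y n ^ 2 / 6)) with (y n - y n ^ 3 / 6) by field. easy. }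
    assert (HkL : forall n, (n1 <= n)%nat -> (v + 1 < L n)%nat).
    { intros n Hn. specialize (Hn1 n Hn). unfold y in Hn1. pose proof (l_pos n) as Hln.
      assert (PI * k < l n).
      { apply Rmult_lt_reg_r with (/ l n); [now apply Rinv_0_lt_compat|]. rewrite Rinv_r; lra. }
      apply INR_lt. rewrite plus_INR. change (INR 1) with 1. fold k.
      unfold l in *. rewrite mult_INR in *. change (INR 2) with 2 in *. nra. }
    apply is_lim_seq_le_le_loc with
      (u := fun n => exp (- (E n / (1 - y n ^ 2))))
      (w := fun n => exp (- (E n * (1 - y n ^ 2 / 6) ^ 2))).
    + exists n1. intros n Hn. specialize (Hn1 n Hn). specialize (Hsy n Hn). specialize (HkL n Hn).
      pose proof (Hypos n) as Hyn.
      destruct (lt_dec (v + 1) (L n)) as [_|Hc]; [|lia].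
      replace (PI * k / l n) with (y n) by reflexivity. rewrite Ecos.
      pose proof (m_pos n) as Hmn.
      assert (Hs2 : 0 <= sin (y n) ^ 2 <= y n ^ 2) by (split; [apply pow2_ge_0|apply pow_incr; lra]).
      assert (Hy21 : y n ^ 2 < 1) by nra.
      destruct (pow_one_minus_bounds (sin (y n) ^ 2) (m n) ltac:(lra)) as [B1 B2].
      split.
      * apply Rle_trans with (2 := B1). apply exp_le. apply Ropp_le_contravar.
        rewrite <- EE. apply Rmult_le_compat.
        -- apply Rmult_le_pos; lra.
        -- left; apply Rinv_0_lt_compat; lra.
        -- apply Rmult_le_compat_l; lra.
        -- apply Rinv_le_contravar; lra.
      * apply Rle_trans with (1 := B2). apply exp_le. apply Ropp_le_contravar.
        rewrite <- EE, Rmult_assoc. apply Rmult_le_compat_l; [lra|].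
        rewrite <- Rpow_mult_distr. apply pow_incr. lra.
    + apply is_lim_seq_exp, is_lim_seq_opp'.
      replace (PI ^ 2 * k ^ 2 / x) with (PI ^ 2 * k ^ 2 / x / (1 - 0)) by (field; lra).
      apply is_lim_seq_div'; [exact HE| |lra].
      apply is_lim_seq_minus'; [apply is_lim_seq_const|exact Hy2].
    + now apply is_lim_seq_exp, is_lim_seq_opp'.
Qed.

(** Dividing Poisson's identity by the lattice sum relative to [walk (m n) 0] leaves a quotient of
    two series whose limits are the theta values at pi^2/x and at x. *)
Lemma walk_return_lim :
  is_lim_seq (fun n => l n * walk (m n) 0) (phi (exp (- (PI ^ 2 / x))) / phi (exp (- x))).
Proof.
  assert (Hx1 : 0 < exp (- x) < 1) by now apply exp_neg_bounds.
  assert (Hx2 : 0 < exp (- (PI ^ 2 / x)) < 1).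
  { apply exp_neg_bounds. apply Rdiv_lt_0_compat; [|easy]. apply pow_lt, PI_RGT_0. }
  pose proof (phi_ge_1 _ Hx1) as P1.
  rewrite !phi_eq in * by (rewrite Rabs_pos_eq; lra).
  pose proof walk_series_lim as H1. pose proof cos_series_lim as H2.
  eapply is_lim_seq_ext_loc.
  2:{ apply is_lim_seq_div'.
    - apply is_lim_seq_plus'; [apply is_lim_seq_const|].
      apply is_lim_seq_mult'; [apply is_lim_seq_const|exact H2].
    - apply is_lim_seq_plus'; [apply is_lim_seq_const|].
      apply is_lim_seq_mult'; [apply is_lim_seq_const|exact H1].
    - lra. }
  exists 0%nat. intros n _. cbv beta.
  pose proof (walk_lattice_sum (2 * L n - 1) (m n)) as E1.
  rewrite (walk_dual_half (L n) (m n) (HL n) (Hm n)) in E1.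
  unfold l. rewrite E1.
  replace (S (2 * L n - 1)) with (2 * L n)%nat by (specialize (HL n); lia).
  pose proof (walk_0_pos (m n)) as Hw.
  set (S1 := Series (fun j => walk (m n) (Z.of_nat ((j + 1) * (2 * L n))) / walk (m n) 0)).
  assert (ES : Series (fun j => walk (m n) (Z.of_nat ((j + 1) * (2 * L n)))) = walk (m n) 0 * S1).
  { unfold S1. rewrite <- Series_scal_l. apply Series_ext. intros j. field. lra. }
  (* Nonnegativity keeps the denominator 1 + 2 S1 away from 0. *)
  rewrite ES. assert (0 <= S1); [|field; lra].
  unfold S1.
  apply Rmult_le_reg_l with (walk (m n) 0); [easy|]. rewrite Rmult_0_r. fold S1. rewrite <- ES.
  rewrite (Series_finite _ (m n)).
  2:{ intros j Hj. apply walk_out. specialize (HL n). nia. }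
  assert (Hs : forall N, 0 <= sum_n (fun j => walk (m n) (Z.of_nat ((j + 1) * (2 * L n)))) N); [|apply Hs].
  induction N as [|N IH]; [rewrite sum_O; apply walk_ge0|].
  rewrite sum_Sn. apply Rplus_le_le_0_compat; [exact IH|apply walk_ge0].
Qed.
End Polya.

(** One walk is sampled on two lattices, with x = pi/4 and x = pi. The point pi is fixed by x ->
    pi^2/x, so the limit there is 1; its lattice spacing is twice the other, so the limit for pi/4
    is 1/2. *)
Theorem phi_quarter : phi (exp (- (PI / 4))) = 2 * phi (exp (- (4 * PI))).
Proof.
  pose proof PI_RGT_0 as HPI. pose proof PI_4 as HPI4.
  (* Chosen so that (2c(n + 1))^2/m tends to c^2 pi/4, which is pi/4 for c = 1 and pi for c = 2. *)
  set (m := fun n => Z.to_nat (Int_part (16 * INR (S n) ^ 2 / PI))).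
  assert (Hm : forall n, 16 * INR (S n) ^ 2 / PI - 1 <= INR (m n) <= 16 * INR (S n) ^ 2 / PI /\ (0 < m n)%nat).
  { intros n. destruct (base_Int_part (16 * INR (S n) ^ 2 / PI)) as [H1 H2].
    assert (H3 : 4 <= 16 * INR (S n) ^ 2 / PI).
    { apply Rmult_le_reg_r with PI; [easy|]. unfold Rdiv. rewrite Rmult_assoc, Rinv_l by lra.
      assert (1 <= INR (S n)) by (rewrite S_INR; pose proof (pos_INR n); lra). nra. }
    assert (H4 : (0 < Int_part (16 * INR (S n) ^ 2 / PI))%Z) by (apply lt_IZR; lra).
    unfold m. rewrite (INR_IZR_INZ (Z.to_nat _)), Z2Nat.id by lia. split; [lra|lia]. }
  assert (HSn : is_lim_seq (fun n => INR (S n)) p_infty).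
  { apply -> (is_lim_seq_incr_1 INR). apply is_lim_seq_INR. }
  assert (Hinv : is_lim_seq (fun n => / INR (S n)) 0) by (apply (is_lim_seq_inv _ p_infty); easy).
  assert (Hinv2 : is_lim_seq (fun n => INR (m n) / INR (S n) ^ 2) (16 / PI)).
  { apply is_lim_seq_le_le with
      (u := fun n => 16 / PI - / INR (S n) * / INR (S n)) (w := fun _ => 16 / PI).
    - intros n. destruct (Hm n) as [Hmn _].
      assert (Hn : 0 < INR (S n)) by (apply lt_0_INR; lia).
      assert (Hn2 : 0 < INR (S n) ^ 2) by (now apply pow_lt).
      split; apply Rmult_le_reg_r with (INR (S n) ^ 2); try easy.
      + replace ((16 / PI - / INR (S n) * / INR (S n)) * INR (S n) ^ 2)
          with (16 * INR (S n) ^ 2 / PI - 1) by (field; lra).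
        replace (INR (m n) / INR (S n) ^ 2 * INR (S n) ^ 2) with (INR (m n)) by (field; lra). lra.
      + replace (16 / PI * INR (S n) ^ 2) with (16 * INR (S n) ^ 2 / PI) by (field; lra).
        replace (INR (m n) / INR (S n) ^ 2 * INR (S n) ^ 2) with (INR (m n)) by (field; lra). lra.
    - assert (T : is_lim_seq (fun n => 16 / PI - / INR (S n) * / INR (S n)) (16 / PI - 0 * 0)).
      { apply is_lim_seq_minus'; [apply is_lim_seq_const|now apply is_lim_seq_mult']. }
      now rewrite Rmult_0_l, Rminus_0_r in T.
    - apply is_lim_seq_const. }
  assert (Hlim : forall c : nat, (0 < c)%nat ->
    is_lim_seq (fun n => INR (2 * (c * S n)) ^ 2 / INR (m n)) (INR c ^ 2 * (PI / 4))).
  { intros c Hc. apply is_lim_seq_ext with (fun n => 4 * INR c ^ 2 / (INR (m n) / INR (S n) ^ 2)).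
    - intros n. destruct (Hm n) as [_ Hmn]. apply lt_0_INR in Hmn.
      assert (Hn : 0 < INR (S n)) by (apply lt_0_INR; lia).
      rewrite !mult_INR. change (INR 2) with 2. field. lra.
    - replace (INR c ^ 2 * (PI / 4)) with (4 * INR c ^ 2 / (16 / PI)) by (field; lra).
      apply is_lim_seq_div'; [apply is_lim_seq_const|easy|].
      apply Rgt_not_eq, Rdiv_lt_0_compat; lra. }
  assert (Hinf : forall c : nat, (0 < c)%nat -> is_lim_seq (fun n => INR (2 * (c * S n))) p_infty).
  { intros c Hc. apply is_lim_seq_le_p_loc with (fun n => INR (S n)); [|easy].
    exists 0%nat. intros n _. apply le_INR. nia. }
  assert (HW : forall c : nat, (0 < c)%nat -> is_lim_seq (fun n => INR (2 * (c * S n)) * walk (m n) 0)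
    (phi (exp (- (PI ^ 2 / (INR c ^ 2 * (PI / 4))))) / phi (exp (- (INR c ^ 2 * (PI / 4)))))).
  { intros c Hc. apply (walk_return_lim (fun n => c * S n)%nat m).
    - apply Rmult_lt_0_compat; [apply pow_lt, lt_0_INR; lia|lra].
    - intros; nia.
    - intros n; apply Hm.
    - now apply Hinf.
    - now apply Hlim. }
  pose proof (HW 1%nat ltac:(lia)) as W1. pose proof (HW 2%nat ltac:(lia)) as W2.
  change (INR 1) with 1 in W1. change (INR 2) with 2 in W2.
  replace (PI ^ 2 / (1 ^ 2 * (PI / 4))) with (4 * PI) in W1 by (field; lra).
  replace (1 ^ 2 * (PI / 4)) with (PI / 4) in W1 by ring.
  replace (PI ^ 2 / (2 ^ 2 * (PI / 4))) with PI in W2 by (field; lra).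
  replace (2 ^ 2 * (PI / 4)) with PI in W2 by field.
  assert (Q1 : 1 <= phi (exp (- (PI / 4)))) by (apply phi_ge_1, exp_neg_bounds; lra).
  assert (Q2 : 1 <= phi (exp (- PI))) by (apply phi_ge_1, exp_neg_bounds; lra).
  replace (phi (exp (- PI)) / phi (exp (- PI))) with 1 in W2 by (field; lra).
  assert (W3 : is_lim_seq (fun n => INR (2 * (2 * S n)) * walk (m n) 0)
    (2 * (phi (exp (- (4 * PI))) / phi (exp (- (PI / 4)))))).
  { apply is_lim_seq_ext with (fun n => 2 * (INR (2 * (1 * S n)) * walk (m n) 0)).
    - intros n. rewrite !mult_INR. change (INR 1) with 1. change (INR 2) with 2. ring.
    - apply is_lim_seq_mult'; [apply is_lim_seq_const|exact W1]. }
  apply is_lim_seq_unique in W2, W3. rewrite W2 in W3.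
  assert (E : 1 = 2 * (phi (exp (- (4 * PI))) / phi (exp (- (PI / 4))))) by (injection W3; easy).
  apply Rmult_eq_reg_r with (/ phi (exp (- (PI / 4)))); [|apply Rinv_neq_0_compat; lra].
  rewrite Rinv_r by lra. rewrite E at 1. unfold Rdiv. ring.
Qed.

Corollary rho_exp_PI : rho (exp (- PI)) ^ 4 = 1 / 2.
Proof.
  pose proof PI_RGT_0 as HPI.
  set (q := exp (- (PI / 4))).
  assert (Hq : 0 < q < 1) by (apply exp_neg_bounds; lra).
  assert (Eq4 : q ^ 4 = exp (- PI)).
  { unfold q. rewrite exp_pow_nat. f_equal. simpl. field. }
  assert (Hq4 : 0 < exp (- PI) < 1) by (now apply exp_neg_bounds).
  assert (E16 : exp (- PI) ^ 4 = exp (- (4 * PI))).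
  { rewrite exp_pow_nat. f_equal. simpl. ring. }
  pose proof (phi_opp _ Hq4) as H1. rewrite E16 in H1.
  pose proof phi_quarter as H2. fold q in H2.
  assert (Hq2 : 0 < q ^ 2 < 1) by (apply pow_unit_interval; [easy|lia]).
  pose proof (phi_odd_sq q Hq) as A1. pose proof (phi_odd_sq (q ^ 2) Hq2) as A2.
  replace (q ^ 16) with (exp (- PI) ^ 4) in * by (rewrite <- Eq4; ring).
  rewrite <- !pow_mult in A2. simpl Nat.mul in A2. rewrite Eq4 in *.
  replace (q ^ 16) with (exp (- PI) ^ 4) in A2 by (rewrite <- Eq4; ring). rewrite E16 in A2.
  pose proof (phi_sq_plus _ Hq4) as D1.
  replace (exp (- PI) ^ 2) with (q ^ 8) in D1 by (rewrite <- Eq4; ring).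
  set (A := phi (exp (- PI))) in *. set (B := phi (- exp (- PI))) in *.
  set (C := phi (exp (- (4 * PI)))) in *.
  assert (HA : 1 <= A) by now apply phi_ge_1.
  (* With S(x) = phi(x) - phi(x^4) the odd part of phi(x), phi_quarter says
     B = S(q), and S(q)^4 = A^4 - B^4 holds for every q. *)
  assert (EAB : B ^ 4 = A ^ 4 - B ^ 4).
  { replace (B ^ 4) with ((B ^ 2) ^ 2) at 1 by ring.
    replace (B ^ 2) with (2 * phi (q ^ 8) * (phi (q ^ 2) - phi (q ^ 8))) by (rewrite <- A1; f_equal; lra).
    replace ((2 * phi (q ^ 8) * (phi (q ^ 2) - phi (q ^ 8))) ^ 2)
      with (2 * (2 * phi (q ^ 8) ^ 2) * (phi (q ^ 2) - phi (q ^ 8)) ^ 2) by ring.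
    rewrite A2, <- D1. replace C with ((A + B) / 2) by lra. field. }
  unfold rho. fold A B. apply Rmult_eq_reg_r with (A ^ 4); [|apply pow_nonzero; lra].
  replace ((B / A) ^ 4 * A ^ 4) with (B ^ 4) by (field; lra). lra.
Qed.

(** * The octic satisfied by p *)

(** The first relation involves only p, b(1 - b) and the modulus at q, which degree 3 makes
    explicit; the second is a quadratic in m^2 whose larger root is the radical defining m(p). *)
Lemma degree7_multiplier_quotient b t z g k' M :
  b = t ^ 2 -> 0 < t -> z ^ 2 = 2 - 3 * b + 2 * b ^ 2 ->
  g ^ 2 = 2 - 3 * b + 6 * b ^ 2 - 3 * b ^ 3 + 2 * b ^ 4 -> M <> 0 ->
  k' = (1 - b + b ^ 2) * t * z - (1 - b) * t * g ->
  M = (1 - 2 * b) * (3 - 2 * b + 2 * b ^ 2) + 2 * z * g ->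
  let m := 7 / M in let p := 1 + m * (2 * b - 1) in
  p ^ 3 * (b * (1 - b)) = 64 * (k' ^ 2 * (1 - k' ^ 2)) /\
  m ^ 4 - (2 + 5 * p) * m ^ 2 + (1 - p) ^ 3 = 0.
Proof.
  intros Hb Ht Hz Hg HM Hk HMe m p.
  assert (Hm : m = (2 * b - 1) * (3 - 2 * b + 2 * b ^ 2) + 2 * (z * g)).
  { unfold m. apply Rmult_eq_reg_r with M; [|easy].
    replace (7 / M * M) with 7 by (field; easy). rewrite HMe.
    replace (((2 * b - 1) * (3 - 2 * b + 2 * b ^ 2) + 2 * (z * g)) *
      ((1 - 2 * b) * (3 - 2 * b + 2 * b ^ 2) + 2 * z * g))
    with (4 * (z ^ 2 * g ^ 2) - ((1 - 2 * b) * (3 - 2 * b + 2 * b ^ 2)) ^ 2) by ring.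
    rewrite Hz, Hg. ring. }
  assert (Hw : (z * g) ^ 2 = (2 - 3 * b + 2 * b ^ 2) * (2 - 3 * b + 6 * b ^ 2 - 3 * b ^ 3 + 2 * b ^ 4)).
  { rewrite Rpow_mult_distr, Hz, Hg; ring. }
  (* After squaring, z and g occur only through w = z g, so both claims become polynomial identities
     in b and w modulo the value of w^2. *)
  assert (Hk2 : k' ^ 2 = b * ((1 - b + b ^ 2) ^ 2 * (2 - 3 * b + 2 * b ^ 2)
     + (1 - b) ^ 2 * (2 - 3 * b + 6 * b ^ 2 - 3 * b ^ 3 + 2 * b ^ 4)
     - 2 * (1 - b) * (1 - b + b ^ 2) * (z * g))).
  { rewrite Hk. rewrite <- Hz, <- Hg, Hb. ring. }
  unfold p. rewrite Hm, Hk2. clear Hk2 Hk Hm HMe Hz Hg.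
  set (w := z * g) in *. clearbody w.
  split.
  - assert (H3 : w ^ 3 = w * ((2 - 3 * b + 2 * b ^ 2) * (2 - 3 * b + 6 * b ^ 2 - 3 * b ^ 3 + 2 * b ^ 4))).
    { rewrite <- Hw; ring. }
    apply Rminus_diag_uniq. ring_simplify. rewrite ?H3, ?Hw. ring.
  - apply Rminus_diag_uniq.
    assert (H3 : w ^ 3 = w * ((2 - 3 * b + 2 * b ^ 2) * (2 - 3 * b + 6 * b ^ 2 - 3 * b ^ 3 + 2 * b ^ 4))).
    { rewrite <- Hw; ring. }
    assert (H4 : w ^ 4 = ((2 - 3 * b + 2 * b ^ 2) * (2 - 3 * b + 6 * b ^ 2 - 3 * b ^ 3 + 2 * b ^ 4)) ^ 2).
    { rewrite <- Hw; ring. }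
    ring_simplify. rewrite ?H4, ?H3, ?Hw. ring.
Qed.

(** Elimination of m: with c = b(1 - b) one has (2b - 1)^2 = 1 - 4c. Multiplying the quartic by (1 -
    4c)^2 expresses it in p and c with a spare factor (1 - p)^2, and c = A/p^3 then gives the
    octic. *)
Lemma octic_of_quotient p m c A :
  m <> 0 -> p <> 0 -> p <> 1 -> (1 - 4 * c) * m ^ 2 = (1 - p) ^ 2 -> p ^ 3 * c = A ->
  m ^ 4 - (2 + 5 * p) * m ^ 2 + (1 - p) ^ 3 = 0 ->
  p ^ 8 - 8 * p ^ 7 + 28 * A * p ^ 4 - 16 * A ^ 2 * (p - 1) = 0.
Proof.
  intros Hm Hp Hp1 H1 <- H2.
  apply Rmult_eq_reg_l with ((1 - p) ^ 2 / p ^ 6); [rewrite Rmult_0_r|].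
  2:{ apply Rmult_integral_contrapositive; split; [apply pow_nonzero; lra|apply Rinv_neq_0_compat, pow_nonzero; lra]. }
  replace ((1 - p) ^ 2 / p ^ 6 * (p ^ 8 - 8 * p ^ 7 + 28 * (p ^ 3 * c) * p ^ 4 - 16 * (p ^ 3 * c) ^ 2 * (p - 1)))
    with ((1 - p) ^ 2 * (p ^ 2 - 8 * p + 28 * c * p - 16 * c ^ 2 * (p - 1))) by (field; easy).
  transitivity ((1 - 4 * c) ^ 2 * (m ^ 4 - (2 + 5 * p) * m ^ 2 + (1 - p) ^ 3)).
  2:{ rewrite H2; ring. }
  replace ((1 - 4 * c) ^ 2 * (m ^ 4 - (2 + 5 * p) * m ^ 2 + (1 - p) ^ 3))
    with (((1 - 4 * c) * m ^ 2) ^ 2 - (2 + 5 * p) * (1 - 4 * c) * ((1 - 4 * c) * m ^ 2)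
     + (1 - 4 * c) ^ 2 * (1 - p) ^ 3) by ring.
  rewrite H1. ring.
Qed.

(** The point 7 is critical for p^8 - 8p^7, and in powers of p - 7 all nonconstant coefficients are
    nonnegative. The negative term in A^2 is outweighed by the growth of 28 A p^4. *)
Lemma octic_increasing A p x : 0 < A < 1 -> 7 < p -> p < x ->
  p ^ 8 - 8 * p ^ 7 + 28 * A * p ^ 4 - 16 * A ^ 2 * (p - 1)
  < x ^ 8 - 8 * x ^ 7 + 28 * A * x ^ 4 - 16 * A ^ 2 * (x - 1).
Proof.
  intros HA Hp Hx.
  assert (E : forall u, (7 + u) ^ 8 - 8 * (7 + u) ^ 7 = u ^ 8 + 48 * u ^ 7 + 980 * u ^ 6
    + 10976 * u ^ 5 + 72030 * u ^ 4 + 268912 * u ^ 3 + 470596 * u ^ 2 - 7 ^ 7) by (intros; ring).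
  assert (B : forall n, (p - 7) ^ n <= (x - 7) ^ n) by (intros; apply pow_incr; lra).
  replace (p ^ 8 - 8 * p ^ 7) with ((7 + (p - 7)) ^ 8 - 8 * (7 + (p - 7)) ^ 7)
    by (replace (7 + (p - 7)) with p by ring; ring).
  replace (x ^ 8 - 8 * x ^ 7) with ((7 + (x - 7)) ^ 8 - 8 * (7 + (x - 7)) ^ 7)
    by (replace (7 + (x - 7)) with x by ring; ring).
  rewrite !E.
  pose proof (B 8%nat); pose proof (B 7%nat); pose proof (B 6%nat); pose proof (B 5%nat);
  pose proof (B 4%nat); pose proof (B 3%nat); pose proof (B 2%nat).
  assert (H6 : A * (x - p) <= A * (x ^ 4 - p ^ 4)).
  { apply Rmult_le_compat_l; [lra|].
    replace (x ^ 4 - p ^ 4) with ((x - p) * (x ^ 3 + x ^ 2 * p + x * p ^ 2 + p ^ 3)) by ring.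
    rewrite <- (Rmult_1_r (x - p)) at 1. apply Rmult_le_compat_l; [lra|].
    assert (1 <= p ^ 3) by (apply pow_R1_Rle; lra).
    assert (0 <= x ^ 3) by (apply pow_le; lra).
    assert (0 <= x * p ^ 2) by (apply Rmult_le_pos; [lra|apply pow_le; lra]).
    assert (0 <= x ^ 2 * p) by (apply Rmult_le_pos; [apply pow_le; lra|lra]).
    lra. }
  assert (H7 : A ^ 2 * (x - p) <= A * (x - p)).
  { apply Rmult_le_compat_r; [lra|nra]. }
  assert (0 < A * (x - p)) by (apply Rmult_lt_0_compat; lra).
  assert (28 * A * x ^ 4 - 28 * A * p ^ 4 = 28 * (A * (x ^ 4 - p ^ 4))) by ring.
  assert (16 * A ^ 2 * (x - 1) - 16 * A ^ 2 * (p - 1) = 16 * (A ^ 2 * (x - p))) by ring.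
  lra.
Qed.

Lemma octic_root_unique A p x : 0 < A < 1 -> 7 < p -> 7 < x ->
  p ^ 8 - 8 * p ^ 7 + 28 * A * p ^ 4 - 16 * A ^ 2 * (p - 1) = 0 ->
  x ^ 8 - 8 * x ^ 7 + 28 * A * x ^ 4 - 16 * A ^ 2 * (x - 1) = 0 -> p = x.
Proof.
  intros HA Hp Hx H1 H2. destruct (Rtotal_order p x) as [H|[H|H]]; [|easy|].
  - pose proof (octic_increasing A p x HA Hp H); lra.
  - pose proof (octic_increasing A x p HA Hx H); lra.
Qed.

Lemma Rpower_half x : 0 < x -> Rpower x (1 / 2) = sqrt x.
Proof. intros Hx. rewrite <- Rpower_sqrt by easy. f_equal. field. Qed.

Lemma sqrt_3_bounds : 173 / 100 < sqrt 3 < 1733 / 1000.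
Proof.
  assert (sqrt 3 ^ 2 = 3) by (apply pow2_sqrt; lra). pose proof (sqrt_pos 3). split; nra.
Qed.

Lemma Rpower_quarter x : 0 < x -> Rpower x (1 / 4) ^ 4 = x.
Proof.
  intros Hx. rewrite <- Rpower_pow by apply exp_pos. rewrite Rpower_mult.
  simpl INR. replace (1 / 4 * (1 + 1 + 1 + 1)) with 1 by field. now apply Rpower_1.
Qed.

(* Over Q(sqrt 3, sqrt 7) the octic for y = p / (2 (2 - sqrt 3)) splits into two
   quartics; the first one splits further over the extension by
   w = (6 sqrt 7)^(1/2), which contains h = (7 + 4 sqrt 7)^(1/2). *)
Lemma octic_value s3 s7 w y :
  s3 ^ 2 = 3 -> s7 ^ 2 = 7 -> w ^ 2 = 6 * s7 ->
  let u := s3 + s7 in let h := w * (1 + s7) * s3 / 6 in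
  let sg := ((4 + 2 * s3 + (1 + s3) * s7) + w * (3 + s3) * (3 + s7) / 6) / 2 in
  y ^ 2 - sg * y + u * ((2 + s7 + h) / 2) = 0 ->
  y ^ 8 - 4 * (2 + s3) * y ^ 7 + 28 * y ^ 4 - 32 * (2 - s3) * y + 16 = 0.
Proof.
  intros H3 H7 Hw u h sg Hy.
  (* The conjugate of [sg] under w -> -w, which also sends h to -h; the two conjugate quadratics
     multiply to the quartic [G]. *)
  set (ta := ((4 + 2 * s3 + (1 + s3) * s7) - w * (3 + s3) * (3 + s7) / 6) / 2).
  set (G := y ^ 4 - (4 + 2 * s3 + (1 + s3) * s7) * y ^ 3 - u * y ^ 2
     + (1 + 3 * s3 + (1 + s3) * s7) * y + u ^ 2).
  assert (HG : G = 0).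
  { transitivity ((y ^ 2 - sg * y + u * ((2 + s7 + h) / 2)) * (y ^ 2 - ta * y + u * ((2 + s7 - h) / 2))).
    - unfold G, sg, ta, u, h. field [H3 H7 Hw].
    - rewrite Hy; ring. }
  (* The second factor is the conjugate of [G] under s7 -> -s7. *)
  transitivity (G * (y ^ 4 - (4 + 2 * s3 - (1 + s3) * s7) * y ^ 3 - (s3 - s7) * y ^ 2
     + (1 + 3 * s3 - (1 + s3) * s7) * y + (s3 - s7) ^ 2)).
  - unfold G, u. ring [H3 H7].
  - rewrite HG; ring.
Qed.

(** After scaling p to y, y^2 = X U3 with X = u(2 + s7 + h)/2, and the quadratic y^2 + X = sg y only
    has to be checked after squaring, since everything is positive. There it reads X (U3 + 1)^2 =
    sg^2 U3. *)
Lemma octic_class_invariant (p : R) :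
  p = sqrt 2 * (2 - sqrt 3) * sqrt (sqrt 3 + sqrt 7)
            * sqrt (2 + sqrt 7 + sqrt (7 + 4 * sqrt 7))
            * sqrt ((sqrt (3 + sqrt 7) + Rpower (6 * sqrt 7) (1 / 4))
                    / (sqrt (3 + sqrt 7) - Rpower (6 * sqrt 7) (1 / 4))) ->
  let A := 16 * (2 - sqrt 3) ^ 4 in
  7 < p /\ p ^ 8 - 8 * p ^ 7 + 28 * A * p ^ 4 - 16 * A ^ 2 * (p - 1) = 0.
Proof.
  intros Hp A.
  set (s3 := sqrt 3) in *. set (s7 := sqrt 7) in *.
  assert (H3 : s3 ^ 2 = 3) by (apply pow2_sqrt; lra).
  assert (H7 : s7 ^ 2 = 7) by (apply pow2_sqrt; lra).
  assert (P7 : 0 <= s7) by apply sqrt_pos.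
  assert (B3 : 173 / 100 < s3 < 1733 / 1000) by apply sqrt_3_bounds.
  assert (B7 : 264 / 100 < s7 < 265 / 100) by (split; nra).
  set (r := Rpower (6 * s7) (1 / 4)) in *.
  assert (Hr : r ^ 4 = 6 * s7) by (apply Rpower_quarter; lra).
  assert (Pr : 0 < r) by apply exp_pos.
  set (w := r ^ 2).
  assert (Hw : w ^ 2 = 6 * s7) by (unfold w; rewrite <- Hr; ring).
  assert (Pw : 0 < w) by (apply pow_lt; easy).
  assert (Bw : 398 / 100 < w < 399 / 100) by (split; nra).
  set (h := w * (1 + s7) * s3 / 6).
  assert (Hh : sqrt (7 + 4 * s7) = h).
  { replace (7 + 4 * s7) with (h ^ 2) by (unfold h; field [H3 H7 Hw]).
    apply sqrt_pow2. unfold h. repeat apply Rmult_le_pos; lra. }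
  rewrite Hh in Hp.
  set (a := sqrt (3 + s7)) in *.
  assert (Ha : a ^ 2 = 3 + s7) by (apply pow2_sqrt; lra).
  assert (Pa : 0 < a) by (apply sqrt_lt_R0; lra).
  assert (Hra : r < a) by (unfold w in Bw; nra).
  set (U3 := (a + r) / (a - r)) in *.
  assert (PU3 : 1 < U3).
  { apply Rmult_lt_reg_r with (a - r); [lra|]. unfold U3. field_simplify; lra. }
  assert (Ph : 41 / 10 < h).
  { unfold h. assert (14 < w * (1 + s7)) by nra. nra. }
  set (u := s3 + s7) in *.
  set (y := p / (2 * (2 - s3))).
  assert (Hpy : p = 2 * (2 - s3) * y) by (unfold y; field; lra).
  assert (Pp : 0 < p).
  { rewrite Hp. repeat apply Rmult_lt_0_compat; try apply sqrt_lt_R0; unfold u; lra. }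
  assert (Py : 0 < y) by (apply Rdiv_lt_0_compat; lra).
  assert (Hyy : y ^ 2 = u * ((2 + s7 + h) / 2) * U3).
  { unfold y. rewrite Hp.
    replace ((sqrt 2 * (2 - s3) * sqrt u * sqrt (2 + s7 + h) * sqrt U3 / (2 * (2 - s3))) ^ 2)
      with (sqrt 2 ^ 2 * sqrt u ^ 2 * sqrt (2 + s7 + h) ^ 2 * sqrt U3 ^ 2 / 4) by (field; lra).
    rewrite !pow2_sqrt by (unfold u; lra). field. }
  set (sg := ((4 + 2 * s3 + (1 + s3) * s7) + w * (3 + s3) * (3 + s7) / 6) / 2).
  assert (Hsg : sg ^ 2 = u * ((2 + s7 + h) / 2) * ((3 + s7) * (3 + s7 + w) / 4)).
  { unfold sg, u, h. field [H3 H7 Hw]. }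
  assert (HU3 : (U3 + 1) ^ 2 = (3 + s7) * (3 + s7 + w) / 4 * U3).
  (* Since a^2 = 3 + s7 and r^2 = w, this rationalises the quotient (a + r)/(a - r). *)
  { assert (E16 : (3 + s7 + w) * (3 + s7 - w) = 16) by ring [H7 Hw].
    assert (Earr : (a + r) * (a - r) = 3 + s7 - w).
    { replace ((a + r) * (a - r)) with (a ^ 2 - r ^ 2) by ring. rewrite Ha. reflexivity. }
    replace (U3 + 1) with (2 * a / (a - r)) by (unfold U3; field; lra).
    replace ((2 * a / (a - r)) ^ 2) with (4 * a ^ 2 / (a - r) ^ 2) by (field; lra).
    replace ((3 + s7) * (3 + s7 + w) / 4 * U3)
      with (a ^ 2 * ((3 + s7 + w) * ((a + r) * (a - r))) / (4 * (a - r) ^ 2))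
      by (rewrite Ha; unfold U3; field; lra).
    rewrite Earr, E16. field. lra. }
  assert (Psg : 0 < sg).
  { unfold sg. assert (0 < (1 + s3) * s7) by (apply Rmult_lt_0_compat; lra).
    assert (0 < w * (3 + s3) * (3 + s7)) by (repeat apply Rmult_lt_0_compat; lra). lra. }
  assert (PuU : 0 < u * ((2 + s7 + h) / 2)) by (apply Rmult_lt_0_compat; unfold u; lra).
  assert (Hq : y ^ 2 - sg * y + u * ((2 + s7 + h) / 2) = 0).
  { assert (E : y ^ 2 + u * ((2 + s7 + h) / 2) = sg * y); [|lra].
    apply (pow_inj_pos 1); [pose proof (pow2_ge_0 y); lra|apply Rmult_le_pos; lra|].
    replace ((sg * y) ^ 2) with (sg ^ 2 * y ^ 2) by ring. rewrite Hsg, Hyy.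
    set (X := u * ((2 + s7 + h) / 2)).
    replace ((X * U3 + X) ^ 2) with (X ^ 2 * (U3 + 1) ^ 2) by ring. rewrite HU3. ring. }
  split.
  - assert (BU3 : 11 < U3).
    { apply Rnot_le_lt. intros Hc.
      assert (K : 27 / 2 < (3 + s7) * (3 + s7 + w) / 4).
      { assert (564 / 100 * (962 / 100) < (3 + s7) * (3 + s7 + w))
          by (apply Rmult_gt_0_lt_compat; lra). lra. }
      assert (27 / 2 * U3 < (U3 + 1) ^ 2) by (rewrite HU3; apply Rmult_lt_compat_r; lra).
      nra. }
    assert (BX : 19 < u * ((2 + s7 + h) / 2)).
    { assert (437 / 100 * (437 / 100) < u * ((2 + s7 + h) / 2))
        by (apply Rmult_gt_0_lt_compat; unfold u; lra). lra. }
    assert (By : 14 ^ 2 < y ^ 2).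
    { rewrite Hyy. assert (19 * 11 < u * ((2 + s7 + h) / 2) * U3)
        by (apply Rmult_gt_0_lt_compat; lra). lra. }
    assert (14 < y).
    { apply Rnot_le_lt. intros Hc. assert (y ^ 2 <= 14 ^ 2) by (apply pow_incr; lra). lra. }
    rewrite Hpy. assert (534 / 1000 * 14 < 2 * (2 - s3) * y)
      by (apply Rmult_gt_0_lt_compat; lra). lra.
  - rewrite Hpy. unfold A.
    replace ((2 * (2 - s3) * y) ^ 8 - 8 * (2 * (2 - s3) * y) ^ 7 +
       28 * (16 * (2 - s3) ^ 4) * (2 * (2 - s3) * y) ^ 4 -
       16 * (16 * (2 - s3) ^ 4) ^ 2 * (2 * (2 - s3) * y - 1))
     with (256 * (2 - s3) ^ 7 * ((2 - s3) * (y ^ 8 - 4 * (2 + s3) * y ^ 7 + 28 * y ^ 4 - 32 * (2 - s3) * y + 16)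
       + 4 * (3 - s3 ^ 2) * y ^ 7)) by ring [H3].
    rewrite (octic_value s3 s7 w y H3 H7 Hw Hq), H3. ring.
Qed.

(** With rho(q)^4 = 1/2 the degree 3 equation becomes b^4 + (1 - b)^4 = 1/2, a quadratic in b(1 -
    b); the bound b(1 - b) <= 1/4 selects 1 - sqrt(3)/2. Both values are symmetric in b and 1 - b up
    to the sign of 2b - 1, which is positive because [rho] is larger at q^3 than at q. *)
Lemma values_at_exp_3PI (q := exp (- PI)) :
  rho (q ^ 3) ^ 4 * (1 - rho (q ^ 3) ^ 4) = (2 - sqrt 3) ^ 4 / 4 /\
  multiplier 3 q = sqrt (6 * sqrt 3 - 9).
Proof.
  assert (Hq : 0 < q < 1) by (apply exp_neg_bounds, PI_RGT_0).
  assert (Hq3 : 0 < q ^ 3 < 1) by (apply pow_unit_interval; [easy|lia]).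
  pose proof rho_exp_PI as Hu. fold q in Hu.
  pose proof (rho_bounds _ Hq) as Bu. pose proof (rho_bounds _ Hq3) as Bv.
  pose proof (rho_lt_pow 3 q ltac:(lia) Hq) as Hlt.
  pose proof (modular_equation_3 q Hq) as HD. pose proof (a3_pos q Hq) as Ha.
  pose proof (a3_pow q Hq) as Ea. pose proof (multiplier_3 q Hq) as HM.
  assert (Hb : 0 < b3 q) by (apply Rmult_lt_0_compat; lra).
  assert (Eb : b3 q ^ 4 = 1 / 2 * rho (q ^ 3) ^ 4) by (unfold b3; rewrite <- Hu; ring).
  unfold alpha in Ea. rewrite Hu in Ea.
  set (v4 := rho (q ^ 3) ^ 4) in *.
  replace (a3 q) with (1 - b3 q) in * by lra.
  set (b := b3 q) in *.
  set (s3 := sqrt 3). assert (H3 : s3 ^ 2 = 3) by (apply pow2_sqrt; lra).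
  assert (B3 : 173 / 100 < s3 < 1733 / 1000) by apply sqrt_3_bounds.
  assert (Hc : b * (1 - b) = 1 - s3 / 2).
  { assert (Hs : (1 - b) ^ 4 + b ^ 4 = 1 / 2) by lra.
    assert (E : (b * (1 - b) - 1 + s3 / 2) * (b * (1 - b) - 1 - s3 / 2) = 0).
    { transitivity (((1 - b) ^ 4 + b ^ 4) / 2 + 1 / 2 - s3 ^ 2 / 4); [field|]. rewrite Hs, H3. field. }
    apply Rmult_integral in E. destruct E as [E|E]; [lra|].
    pose proof (pow2_ge_0 (2 * b - 1)). nra. }
  assert (Hb2 : 1 / 2 < b).
  { apply Rnot_le_lt. intros Hle. assert (b ^ 4 <= (1 - b) ^ 4) by (apply pow_incr; lra).
    assert (Hvu : rho q ^ 4 < v4).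
    { unfold v4. assert (rho q ^ 2 < rho (q ^ 3) ^ 2) by nra.
      replace (rho q ^ 4) with ((rho q ^ 2) ^ 2) by ring.
      replace (rho (q ^ 3) ^ 4) with ((rho (q ^ 3) ^ 2) ^ 2) by ring.
      pose proof (pow2_ge_0 (rho q)). nra. }
    lra. }
  split.
  - transitivity (4 * (b * (1 - b)) ^ 4).
    + transitivity ((2 * b ^ 4) * (2 * (1 - b) ^ 4)); [rewrite Eb, Ea; field|ring].
    + rewrite Hc. field.
  - rewrite HM. symmetry. apply sqrt_lem_1; [lra| |].
    + unfold f3. assert (Hs : b <= sqrt (1 - b + b ^ 2)).
      { apply le_of_sq; [apply sqrt_pos|]. rewrite pow2_sqrt; nra. }
      lra.
    + unfold f3. set (z := sqrt (1 - b + b ^ 2)).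
      assert (Hz : z ^ 2 = 1 - b + b ^ 2) by (apply pow2_sqrt; nra).
      assert (Hz0 : 0 <= z) by apply sqrt_pos.
      assert (Hzz : z ^ 2 = s3 / 2) by lra.
      assert (Hd : (2 * b - 1) ^ 2 = 2 * s3 - 3) by (replace ((2 * b - 1) ^ 2) with (1 - 4 * (b * (1 - b))) by ring; lra).
      assert (Hdz : (2 * b - 1) * z = (3 - s3) / 2).
      { apply (pow_inj_pos 1); [apply Rmult_le_pos; lra|lra|].
        rewrite Rpow_mult_distr, Hd, Hzz. field [H3]. }
      replace ((1 - 2 * b + 2 * z) * (1 - 2 * b + 2 * z))
        with ((2 * b - 1) ^ 2 - 4 * ((2 * b - 1) * z) + 4 * z ^ 2) by ring.
      rewrite Hd, Hdz, Hzz. field.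
Qed.

Theorem theorem6p4 (p : R)
  (hp : p = sqrt 2 * (2 - sqrt 3) * sqrt (sqrt 3 + sqrt 7)
            * sqrt (2 + sqrt 7 + sqrt (7 + 4 * sqrt 7))
            * sqrt ((sqrt (3 + sqrt 7) + Rpower (6 * sqrt 7) (1 / 4))
                    / (sqrt (3 + sqrt 7) - Rpower (6 * sqrt 7) (1 / 4)))) :
  phi (exp (- (21 * PI))) / phi (exp (- PI))
  = Rpower (m p / (7 * Rpower (6 * sqrt 3 - 9) (1 / 2))) (1 / 2).
Proof.
  destruct (octic_class_invariant p hp) as [Hp7 Hp8]. clear hp.
  set (A := 16 * (2 - sqrt 3) ^ 4) in *.
  pose proof values_at_exp_3PI as [Hv HM3]. cbv zeta in Hv, HM3.
  set (q1 := exp (- PI)) in *.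
  assert (Hq1 : 0 < q1 < 1) by (apply exp_neg_bounds, PI_RGT_0).
  set (q := q1 ^ 3) in *.
  assert (Hq : 0 < q < 1) by (apply pow_unit_interval; [easy|lia]).
  assert (Hqs : q <= 1 / 100).
  { assert (q1 <= / 5).
    { unfold q1. rewrite exp_Ropp. apply Rinv_le_contravar; [lra|].
      replace PI with (PI / 2 + PI / 2) by field. rewrite exp_plus.
      pose proof (exp_ineq1_le (PI / 2)). pose proof PI2_3_2. nra. }
    assert (q1 ^ 3 <= (/ 5) ^ 3) by (apply pow_incr; lra). unfold q. lra. }
  assert (E21 : exp (- (21 * PI)) = q ^ 7).
  { unfold q, q1. rewrite <- pow_mult, exp_pow_nat. f_equal. simpl. ring. }
  assert (Hq7 : 0 < q ^ 7 < 1) by (apply pow_unit_interval; [easy|lia]).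
  rewrite E21.
  pose proof (phi_ge_1 _ Hq1) as G1. pose proof (phi_ge_1 _ Hq) as G3.
  pose proof (phi_ge_1 _ Hq7) as G7.
  set (M := multiplier 7 q). set (mm := 7 / M).
  assert (PM : 0 < M) by (apply Rdiv_lt_0_compat; apply pow_lt; lra).
  pose proof (mult_approx 7 q ltac:(lia) ltac:(lra)) as BM. fold M in BM.
  apply Rabs_le_between in BM.
  pose proof (b7_approx q ltac:(lra)) as Bb. apply Rabs_le_between in Bb.
  pose proof (modular_equation_7 q Hq) as HD. pose proof (a7_pos q Hq) as Ha.
  pose proof (b7_pos q Hq) as Hb.
  pose proof (degree7_param q Hq) as [Hk _]. cbv zeta in Hk.
  set (b := b7 q) in *.
  assert (HM : M = f7 b) by (apply multiplier_7; easy). unfold f7 in HM.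
  assert (PP : 0 <= 2 - 3 * b + 2 * b ^ 2) by nra.
  assert (PQ : 0 <= 2 - 3 * b + 6 * b ^ 2 - 3 * b ^ 3 + 2 * b ^ 4).
  { assert (0 <= b ^ 2 * (6 - 3 * b)) by (apply Rmult_le_pos; nra).
    assert (0 <= b ^ 4) by (apply pow_le; lra). nra. }
  rewrite sqrt_mult, <- Rmult_assoc in HM by easy.
  destruct (degree7_multiplier_quotient b (sqrt b) _ _ _ M (eq_sym (pow2_sqrt b ltac:(lra)))
    (sqrt_lt_R0 b Hb) (pow2_sqrt _ PP) (pow2_sqrt _ PQ) ltac:(lra) Hk HM) as [Hc Hquad].
  fold mm in Hc, Hquad. set (p' := 1 + mm * (2 * b - 1)) in *.
  assert (Emm : mm * M = 7) by (unfold mm; field; lra).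
  assert (Pmm : 0 < mm) by (apply Rdiv_lt_0_compat; lra).
  (* For q <= 1/100 the multiplier is at most 1.07 and 2b - 1 is above 0.95, which puts p' on the
     branch where the octic has a single root. *)
  assert (Hp'7 : 7 < p').
  { assert (654 / 100 < mm) by (apply Rmult_lt_reg_r with M; lra).
    assert (q ^ 2 <= (1 / 100) ^ 2) by (apply pow_incr; lra).
    assert (654 / 100 * (95 / 100) < mm * (2 * b - 1)) by (apply Rmult_gt_0_lt_compat; lra).
    unfold p'. lra. }
  assert (Ep : p' = p).
  { apply (octic_root_unique A); try easy.
    - unfold A. pose proof sqrt_3_bounds.
      split; [apply Rmult_lt_0_compat; [lra|apply pow_lt; lra]|].
      assert ((2 - sqrt 3) ^ 4 <= (28 / 100) ^ 4) by (apply pow_incr; lra). lra.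
    - apply (octic_of_quotient p' mm (b * (1 - b)) A); try lra.
      + unfold p'; ring.
      + rewrite Hc. unfold A. replace ((rho q ^ 2) ^ 2) with (rho q ^ 4) by ring.
        rewrite Hv. field. }
  rewrite Ep in *. clearbody p'. subst p'.
  assert (Em : m p = mm).
  { unfold m. set (D := (2 + 5 * p) ^ 2 - 4 * (1 - p) ^ 3).
    assert (ED : D = (2 * mm ^ 2 - (2 + 5 * p)) ^ 2).
    { unfold D. replace ((1 - p) ^ 3) with ((2 + 5 * p) * mm ^ 2 - mm ^ 4) by lra. ring. }
    (* The sign that picks the larger root: mm^2 (mm^2 - (2 + 5p)) = (p - 1)^3 is positive. *)
    assert (Hpos : 0 <= 2 * mm ^ 2 - (2 + 5 * p)).
    { assert (0 < (p - 1) ^ 3) by (apply pow_lt; lra).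
      assert (0 < mm ^ 2) by (apply pow_lt; lra).
      assert (0 < mm ^ 2 * (mm ^ 2 - (2 + 5 * p))) by nra.
      assert (0 < mm ^ 2 - (2 + 5 * p)) by (apply Rmult_lt_reg_l with (mm ^ 2); lra). lra. }
    rewrite ED, sqrt_pow2 by easy.
    replace (1 + 5 * p / 2 + 1 / 2 * (2 * mm ^ 2 - (2 + 5 * p))) with (mm ^ 2) by field.
    rewrite Rpower_half by (apply pow_lt; lra). apply sqrt_pow2; lra. }
  rewrite Em.
  assert (PM3 : 0 < multiplier 3 q1) by (apply Rdiv_lt_0_compat; apply pow_lt; fold q; lra).
  rewrite (Rpower_half (6 * sqrt 3 - 9)).
  (* On a nonpositive radicand [sqrt] would return 0, but the multiplier it equals is positive. *)
  2:{ apply Rnot_le_lt. intros Hle. rewrite HM3, sqrt_neg_0 in PM3; lra. }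
  rewrite <- HM3.
  rewrite Rpower_half by (apply Rdiv_lt_0_compat; lra).
  symmetry. replace (mm / (7 * multiplier 3 q1)) with ((phi (q ^ 7) / phi q1) ^ 2).
  - apply sqrt_pow2. apply Rmult_le_pos; [lra|left; apply Rinv_0_lt_compat; lra].
  - unfold mm, M, multiplier. fold q. field. lra.
Qed.
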